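(* Let $p,q,r$ be positive integers, $n=p+q$, $r\le n$, and let $K=\mathrm{GL}_p\times\mathrm{GL}_q$ act diagonally on $\mathfrak X=\mathcal F\ell(V^+)\times\mathcal F\ell(V^-)\times\mathrm{Gr}_r(V)$, where $V=V^+\oplus V^-=\mathbb C^p\oplus\mathbb C^q$. With the notation of the context (parameter set $\overline{\mathfrak T}$, points $\mathcal F_\omega\in\mathfrak X$, graphs $\Gamma(\omega)$, category $\mathscr J$): (1) The map $\overline{\mathfrak T}\to\mathfrak X/K$, $\omega\mapsto\mathbb O_\omega:=K\cdot\mathcal F_\omega$, is a bijection. (2) For every $\omega\in\overline{\mathfrak T}$, $$\dim\mathbb O_\omega=p^2+q^2-\sum_{x=i^{\pm}\ \text{free point}} i-\sum_{x\ \text{marked point}}\#\{\text{marked points on the same row on the left of }x,\text{ including }x\}-\sum_{\alpha\ \text{edge}}\#\{\text{marked points and edges on the left of }\alpha,\text{ including }\alpha\},$$ where free points, marked points and edges refer to the graph $\Gamma(\omega)$. (3) For all $\omega,\omega'\in\overline{\mathfrak T}$, $$\mathbb O_\omega\subset\overline{\mathbb O_{\omega'}}\iff \dim\mathrm{Hom}(\mathcal I,\mathcal F_\omega)\ge\dim\mathrm{Hom}(\mathcal I,\mathcal F_{\omega'})\ \text{ for all indecomposable }\mathcal I\in\mathscr J.$$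
   Context: Everything is over $\mathbb C$. $V=\mathbb C^n$, $V^+=\mathbb C^p\times\{0\}^q$ with standard basis $e_1^+,\dots,e_p^+$, and $V^-=\{0\}^p\times\mathbb C^q$ with standard basis $e_1^-,\dots,e_q^-$. $\mathcal F\ell(\cdot)$ is the variety of complete flags and $\mathrm{Gr}_r(V)$ the Grassmannian of $r$-dimensional subspaces. Parameters. $\mathfrak T_{a,b}$ is the set of $a\times b$ partial permutation matrices ($0/1$ matrices with at most one $1$ in each row and each column). $\mathfrak T^\circ$ is the set of $n\times r$ matrices $\omega=\begin{pmatrix}\tau_1\\ \tau_2\end{pmatrix}$ with $\tau_1\in\mathfrak T_{p,r}$, $\tau_2\in\mathfrak T_{q,r}$, $\operatorname{rank}\omega=r$. The symmetric group $\mathfrak S_r$ acts on the right by permuting columns, and $\overline{\mathfrak T}=\mathfrak T^\circ/\mathfrak S_r$. For $\omega\in\overline{\mathfrak T}$, $[\omega]:=\operatorname{Im}\omega\in\mathrm{Gr}_r(V)$, and $\mathcal F_\omega=(\mathcal F^+,\mathcal F^-,[\omega])$, where $\mathcal F^{\pm}$ are the standard complete flags of $V^\pm$ with respect to the bases above. Graph. $\Gamma(\omega)$ has vertices $1^+,\dots,p^+$ (drawn from left to right on one row) and $1^-,\dots,q^-$ (drawn from left to right on another row). For each column of $\omega$ containing two $1$'s, in row $i$ of $\tau_1$ and row $j$ of $\tau_2$, there is an edge joining $i^+$ and $j^-$. For each column with a single $1$, in row $i$ of $\tau_1$ (resp. row $j$ of $\tau_2$), the vertex $i^+$ (resp. $j^-$)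 is marked. A vertex that is neither marked nor incident with an edge is a free point. For an edge $\alpha=(i^+,j^-)$, a marked point $k^+$ (resp. $\ell^-$) is on the left of $\alpha$ if $k\le i$ (resp. $\ell\le j$), and an edge $(k^+,\ell^-)$ is on the left of $\alpha$ if $k\le i$ and $\ell\le j$. Category $\mathscr J$. Objects are the finite-dimensional representations of the quiver with three branches pointing to a common vertex, consisting of vector spaces and linear maps $C\to D$, $L_1\to L_2\to\cdots\to L_p\xrightarrow{\alpha}D$, $M_1\to\cdots\to M_q\xrightarrow{\beta}D$, such that all maps are injective and $D=\operatorname{Im}\alpha\oplus\operatorname{Im}\beta$; morphisms are morphisms of quiver representations (full subcategory). A point $((F_k^+)_{k=1}^p,(F_\ell^-)_{\ell=1}^q,W)\in\mathfrak X$ is viewed as the object with $D=V$, $C=W$, $L_k=F_k^+$, $M_\ell=F_\ell^-$ and all maps inclusions. In this way $\mathcal F_\omega$ is regarded as an object of $\mathscr J$. *)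

(* Defs.v *)
From HB Require Import structures.
From mathcomp Require Import all_boot all_order all_fingroup all_algebra.
From mathcomp Require Import generic_quotient.
From mathcomp Require Import classical_sets functions reals topology_structure.
From mathcomp Require Import complex.
(* the notations of mpoly clash with those of topology_structure *)
From mathcomp Require Import (canonicals, coercions) mpoly.

Set Implicit Arguments.
Unset Strict Implicit.
Unset Printing Implicit Defensive.

Import GRing.Theory.

Local Open Scope classical_set_scope.
Local Open Scope ring_scope.

Section KrullDimension.
Variable T : topologicalType.
Implicit Types (A : set T).

Definition irreducible_set A : Prop :=
  A !=set0 /\
  forall Z1 Z2, closed Z1 -> closed Z2 ->
    A `<=` Z1 `|` Z2 -> A `<=` Z1 \/ A `<=` Z2.

(* Z 0 < Z 1 < ... < Z m, all irreducible and closed in the subspace A; the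
   values Z i for i > m are irrelevant *)
Definition irreducible_chain A (m : nat) (Z : nat -> set T) : Prop :=
  (forall i, (i <= m)%N ->
     irreducible_set (Z i) /\ exists2 F, closed F & Z i = A `&` F) /\
  (forall i, (i < m)%N -> Z i `<` Z i.+1).

Definition has_krull_dim A (d : nat) : Prop :=
  (exists Z, irreducible_chain A d Z) /\
  (forall m Z, irreducible_chain A m Z -> (m <= d)%N).

End KrullDimension.

Section DependentProduct.
Import VectorInternalTheory.
Variables (K : fieldType) (I : finType) (V : I -> vectType K).

Definition dprodv := {dffun forall i : I, V i}.
HB.instance Definition _ := Choice.on dprodv.

Implicit Types f g h : dprodv.

Definition dprodv_zero : dprodv := [ffun i => 0 : V i].
Definition dprodv_opp f : dprodv := [ffun i => - f i].
Definition dprodv_add f g : dprodv := [ffun i => f i + g i].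
Definition dprodv_scale (a : K) f : dprodv := [ffun i => a *: f i].

Fact dprodv_addA : associative dprodv_add.
Proof. by move=> f g h; apply/ffunP => i; rewrite !ffunE addrA. Qed.
Fact dprodv_addC : commutative dprodv_add.
Proof. by move=> f g; apply/ffunP => i; rewrite !ffunE addrC. Qed.
Fact dprodv_add0 : left_id dprodv_zero dprodv_add.
Proof. by move=> f; apply/ffunP => i; rewrite !ffunE add0r. Qed.
Fact dprodv_addN : left_inverse dprodv_zero dprodv_opp dprodv_add.
Proof. by move=> f; apply/ffunP => i; rewrite !ffunE addNr. Qed.

HB.instance Definition _ :=
  GRing.isZmodule.Build dprodv dprodv_addA dprodv_addC dprodv_add0 dprodv_addN.

Fact dprodv_scaleA a b f :
  dprodv_scale a (dprodv_scale b f) = dprodv_scale (a * b) f.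
Proof. by apply/ffunP => i; rewrite !ffunE scalerA. Qed.
Fact dprodv_scale1 : left_id 1 dprodv_scale.
Proof. by move=> f; apply/ffunP => i; rewrite !ffunE scale1r. Qed.
Fact dprodv_scaleDr : right_distributive dprodv_scale +%R.
Proof. by move=> a f g; apply/ffunP => i; rewrite !ffunE scalerDr. Qed.
Fact dprodv_scaleDl f : {morph dprodv_scale^~ f : a b / a + b}.
Proof. by move=> a b; apply/ffunP => i; rewrite !ffunE scalerDl. Qed.

HB.instance Definition _ := GRing.Zmodule_isLmodule.Build K dprodv
  dprodv_scaleA dprodv_scale1 dprodv_scaleDr dprodv_scaleDl.

Let coords : finType := {i : I & 'I_(dim (V i))}.

Fact dprodv_vect_iso : Vector.axiom #|coords| dprodv.
Proof.
pose c (f : dprodv) : 'rV[K]_#|coords| :=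
  \row_k v2r (f (tag (enum_val k))) 0 (tagged (enum_val k)).
exists c.
  by move=> a f g; apply/rowP => k; rewrite !mxE !ffunE linearP !mxE.
exists (fun r : 'rV_#|coords| => [ffun i : I =>
          r2v (\row_j r 0 (enum_rank (existT _ i j : coords))) : V i]).
  move=> f; apply/ffunP => i; rewrite ffunE; apply: (canLR v2rK).
  by apply/rowP => j; rewrite !mxE enum_rankK.
move=> r; apply/rowP => k; rewrite mxE ffunE r2vK mxE; congr (r 0 _).
by rewrite -[RHS]enum_valK; congr enum_rank; case: (enum_val k).
Qed.

HB.instance Definition _ := Lmodule_hasFinDim.Build K dprodv dprodv_vect_iso.

End DependentProduct.

Record quiver := Quiver {
  qvert : finType;
  qarr : finType;
  qsrc : qarr -> qvert;
  qtgt : qarr -> qvert }.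

Section Representations.
Variables (K : fieldType) (Q : quiver).

Record rep := Rep {
  rspace :> qvert Q -> vectType K;
  rmap : forall a : qarr Q, 'Hom(rspace (qsrc a), rspace (qtgt a)) }.

Implicit Types X Y Z : rep.

Definition commutes_at X Y (a : qarr Q)
    (phi : dprodv (fun u => 'Hom(X u, Y u) : vectType K)) :
    'Hom(X (qsrc a), Y (qtgt a)) :=
  (phi (qtgt a) \o rmap X a)%VF - (rmap Y a \o phi (qsrc a))%VF.

Definition rep_hom X Y : {vspace dprodv (fun u => 'Hom(X u, Y u) : vectType K)} :=
  (\bigcap_(a : qarr Q) lker (linfun (@commutes_at X Y a)))%VS.

Definition rep_zero X : Prop := forall u, \dim {:X u} = 0%N.

Definition rep_iso X Y : Prop :=
  exists2 phi, phi \in rep_hom X Y &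
  exists2 psi, psi \in rep_hom Y X &
    forall u, (psi u \o phi u)%VF = \1%VF /\ (phi u \o psi u)%VF = \1%VF.

Definition rep_sum X Y : rep :=
  @Rep (fun u => (X u * Y u)%type : vectType K)
    (fun a => linfun (fun x : X (qsrc a) * Y (qsrc a) =>
                        (rmap X a x.1, rmap Y a x.2))).

End Representations.

Section RepresentationTheory.
Variables (K : fieldType) (Q : quiver).
Implicit Types X Y : rep K Q.

Lemma commutes_at_linear X Y a : linear (@commutes_at K Q X Y a).
Proof.
move=> c f g; rewrite /commutes_at.
have E u : (c *: f + g) u = c *: f u + g u.
  by rewrite [LHS]ffunE; congr (_ + _); rewrite [LHS]ffunE.
rewrite !E; apply/lfunP => x; do ![rewrite lfunE /=].
by rewrite linearP /= scalerBr opprD -!addrA; congr (_ + _); rewrite addrCA.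
Qed.

HB.instance Definition _ X Y a :=
  GRing.isLinear.Build K _ _ _ (@commutes_at K Q X Y a)
    (@commutes_at_linear X Y a).

Lemma rep_homP X Y (phi : dprodv (fun u => 'Hom(X u, Y u) : vectType K)) :
  reflect (forall a, (phi (qtgt a) \o rmap X a = rmap Y a \o phi (qsrc a))%VF)
          (phi \in rep_hom X Y).
Proof.
rewrite memvE /rep_hom; apply: (iffP subv_bigcapP) => phiP a.
  by have := phiP a isT; rewrite -memvE memv_ker lfunE /= subr_eq0 => /eqP.
by move=> _; rewrite -memvE memv_ker lfunE /= subr_eq0 phiP.
Qed.

Lemma rep_sumE X Y a (x : X (qsrc a)) (y : Y (qsrc a)) :
  rmap (rep_sum X Y) a (x, y) = (rmap X a x, rmap Y a y).
Proof.
pose f (z : X (qsrc a) * Y (qsrc a)) := (rmap X a z.1, rmap Y a z.2).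
have f_lin : linear f by move=> c u v; rewrite /f /= !linearP.
pose F := GRing.isLinear.Build K _ _ _ f f_lin.
pose f' : {linear _ -> _} := HB.pack f F.
exact: (lfunE f').
Qed.

End RepresentationTheory.

Section ThreeBranches.
Variables p q : nat.

(* vL i and vM i stand for L_(i+1) and M_(i+1) *)
Inductive vertexJ := vC | vL of 'I_p | vM of 'I_q | vD.

(* aL i : L_(i+1) -> L_(i+2), and similarly for aM *)
Inductive arrowJ := aC | aL of 'I_p.-1 | aalpha | aM of 'I_q.-1 | abeta.

Definition vertexJ_code (v : vertexJ) : option (option ('I_p + 'I_q)) :=
  match v with
  | vC => None | vD => Some None
  | vL i => Some (Some (inl i)) | vM j => Some (Some (inr j))
  end.
Definition vertexJ_decode (c : option (option ('I_p + 'I_q))) : vertexJ :=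
  match c with
  | None => vC | Some None => vD
  | Some (Some (inl i)) => vL i | Some (Some (inr j)) => vM j
  end.
Lemma vertexJ_codeK : cancel vertexJ_code vertexJ_decode.
Proof. by case. Qed.

Definition arrowJ_code (a : arrowJ) :
    option (option (option ('I_p.-1 + 'I_q.-1))) :=
  match a with
  | aC => None | aalpha => Some None | abeta => Some (Some None)
  | aL i => Some (Some (Some (inl i))) | aM j => Some (Some (Some (inr j)))
  end.
Definition arrowJ_decode (c : option (option (option ('I_p.-1 + 'I_q.-1)))) :
    arrowJ :=
  match c with
  | None => aC | Some None => aalpha | Some (Some None) => abeta
  | Some (Some (Some (inl i))) => aL i | Some (Some (Some (inr j))) => aM j
  end.
Lemma arrowJ_codeK : cancel arrowJ_code arrowJ_decode.
Proof. by case. Qed.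

HB.instance Definition _ := Equality.copy vertexJ (can_type vertexJ_codeK).
HB.instance Definition _ := Choice.copy vertexJ (can_type vertexJ_codeK).
HB.instance Definition _ := Countable.copy vertexJ (can_type vertexJ_codeK).
HB.instance Definition _ : isFinite vertexJ := CanIsFinite vertexJ_codeK.

HB.instance Definition _ := Equality.copy arrowJ (can_type arrowJ_codeK).
HB.instance Definition _ := Choice.copy arrowJ (can_type arrowJ_codeK).
HB.instance Definition _ := Countable.copy arrowJ (can_type arrowJ_codeK).
HB.instance Definition _ : isFinite arrowJ := CanIsFinite arrowJ_codeK.

Lemma ord_pred_lt m (i : 'I_m.-1) : (i.+1 < m)%N.
Proof. by case: m i => [|m] [j]. Qed.

Definition ord_here m (i : 'I_m.-1) : 'I_m := widen_ord (leq_pred m) i.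
Definition ord_next m (i : 'I_m.-1) : 'I_m := Ordinal (ord_pred_lt i).

Lemma pred_lt m : (0 < m)%N -> (m.-1 < m)%N.
Proof. by case: m. Qed.
Definition ord_last m (m_gt0 : (0 < m)%N) : 'I_m := Ordinal (pred_lt m_gt0).

Variables (hp : (0 < p)%N) (hq : (0 < q)%N).

Definition srcJ (a : arrowJ) : vertexJ :=
  match a with
  | aC => vC
  | aL i => vL (ord_here i) | aalpha => vL (ord_last hp)
  | aM j => vM (ord_here j) | abeta => vM (ord_last hq)
  end.
Definition tgtJ (a : arrowJ) : vertexJ :=
  match a with
  | aL i => vL (ord_next i) | aM j => vM (ord_next j)
  | aC | aalpha | abeta => vD
  end.

Definition quiverJ : quiver := @Quiver vertexJ arrowJ srcJ tgtJ.

Variable K : fieldType.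

Definition in_J (X : rep K quiverJ) : Prop :=
  let alpha := rmap X (aalpha : qarr quiverJ) : 'Hom(_, X vD) in
  let beta := rmap X (abeta : qarr quiverJ) : 'Hom(_, X vD) in
  [/\ forall a, lker (rmap X a) = 0%VS,
      (limg alpha + limg beta)%VS = fullv
    & (limg alpha :&: limg beta)%VS = 0%VS].

Record objJ := ObjJ { objJ_rep :> rep K quiverJ; objJ_prop : in_J objJ_rep }.

Definition indecomposableJ (X : objJ) : Prop :=
  ~ rep_zero X /\
  forall Y Z : objJ, rep_iso X (rep_sum Y Z) -> rep_zero Y \/ rep_zero Z.

End ThreeBranches.

Arguments vC {p q}.
Arguments vL {p q}.
Arguments vM {p q}.
Arguments vD {p q}.
Arguments aC {p q}.
Arguments aL {p q}.
Arguments aalpha {p q}.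
Arguments aM {p q}.
Arguments abeta {p q}.

Section Linear.
Variable K : fieldType.

Definition im_mx m n (A : 'M[K]_(m, n)) : {vspace 'cV[K]_m} :=
  limg (linfun (mulmx A : 'cV_n -> 'cV_m)).

Definition span_first m n (A : 'M[K]_(m, n)) (k : nat) : {vspace 'cV[K]_m} :=
  <<[seq col j A | j : 'I_n <- enum 'I_n & (j <= k)%N]>>%VS.

Lemma dim_im_mx m n (A : 'M[K]_(m, n)) : \rank A = n -> \dim (im_mx A) = n.
Proof.
move=> rA; rewrite /im_mx limg_dim_eq; first by rewrite dimvf /dim /= muln1.
apply/eqP; rewrite -subv0; apply/subvP => v; rewrite memv_cap memv_ker lfunE /=.
case/andP=> _ /eqP Av0; rewrite memv0 -trmx_eq0.
have: row_free A^T by rewrite /row_free mxrank_tr rA.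
by move/row_free_inj => inj; apply/eqP/inj; rewrite mul0mx -trmx_mul Av0 trmx0.
Qed.

Lemma dim_span_first m n (A : 'M[K]_(m, n)) (k : 'I_n) :
  \rank A = n -> \dim (span_first A k) = k.+1.
Proof.
move=> rA.
have frA : free [seq col j A | j <- enum 'I_n].
  pose X : n.-tuple 'cV[K]_m := [tuple col j A | j < n].
  have -> : [seq col j A | j <- enum 'I_n] = X by [].
  apply/freeP => c c0 i.
  have E : \sum_(i < n) c i *: X`_i = A *m (\col_i c i).
    apply/colP => a; rewrite summxE mxE; apply: eq_bigr => j _.
    by rewrite -tnth_nth tnth_mktuple !mxE mulrC.
  have: row_free A^T by rewrite /row_free mxrank_tr rA.
  move/row_free_inj => inj.
  have /(congr1 trmx): A *m (\col_i c i) = 0 by rewrite -E.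
  rewrite trmx_mul trmx0 => cA0.
  have /rowP/(_ i): (\col_i c i)^T = 0 by apply: inj; rewrite mul0mx.
  by rewrite !mxE.
have sub : subseq [seq col j A | j : 'I_n <- enum 'I_n & (j <= k)%N]
                  [seq col j A | j <- enum 'I_n].
  exact/map_subseq/filter_subseq.
have fr : free [seq col j A | j : 'I_n <- enum 'I_n & (j <= k)%N].
  by rewrite (subseq_uniqP (free_uniq frA) sub) filter_free.
move: fr; rewrite /free => /eqP ->; rewrite size_map -(size_map val).
rewrite -(filter_map val (fun j => (j <= k)%N)) val_enum_ord.
have -> := @filter_iota_leq n 0 k (ltn_ord k).
exact: size_iota.
Qed.

End Linear.

Section FlagVariety.
Variables (R : realType) (p q r : nat).

Local Notation C := (R[i])%C.
Local Notation V := 'cV[C]_(p + q).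

(* columns: the standard bases e_i^+ of V^+ and e_j^- of V^- *)
Definition basis_plus : 'M[C]_(p + q, p) := col_mx 1%:M 0.
Definition basis_minus : 'M[C]_(p + q, q) := col_mx 0 1%:M.

Definition Vplus : {vspace V} := im_mx basis_plus.
Definition Vminus : {vspace V} := im_mx basis_minus.

(* F k is the (k+1)-dimensional member of the flag *)
Definition complete_flag m (U : {vspace V}) (F : {ffun 'I_m -> {vspace V}}) :=
  [forall k : 'I_m, (F k <= U)%VS && (\dim (F k) == k.+1)] &&
  [forall k : 'I_m, forall l : 'I_m, (k <= l)%N ==> (F k <= F l)%VS].

Definition is_point (x : {ffun 'I_p -> {vspace V}} * {ffun 'I_q -> {vspace V}}
                         * {vspace V}) : bool :=
  [&& complete_flag Vplus x.1.1, complete_flag Vminus x.1.2 & \dim x.2 == r].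

Definition flagGr := {x | is_point x}.
HB.instance Definition _ := Choice.on flagGr.

Implicit Type x y : flagGr.

Definition flag_plus x : {ffun 'I_p -> {vspace V}} := (val x).1.1.
Definition flag_minus x : {ffun 'I_q -> {vspace V}} := (val x).1.2.
Definition grass x : {vspace V} := (val x).2.

(* The Zariski topology.  The flag varieties and the Grassmannian are
    quotients GL_p / B_p, GL_q / B_q and (rank r matrices) / GL_r, so [flagGr] is
    the quotient of the space of frames (A | B | M), and carries the quotient
    of the Zariski topology: a subset is closed when its preimage is cut out,
    in the space of frames, by polynomials in the matrix entries.  For a frame of a point, the dimensions of the
    members of the flags force A, B and M to have full column rank. *)
Definition frame := 'M[C]_(p + q, p + (q + r)).

Definition is_frame (Phi : frame) x : Prop :=
  [/\ forall k : 'I_p, flag_plus x k = span_first (lsubmx Phi) k,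
      forall l : 'I_q, flag_minus x l = span_first (lsubmx (rsubmx Phi)) l
    & grass x = im_mx (rsubmx (rsubmx Phi))].

Local Notation frame_poly := (mpoly.mpoly ((p + q) * (p + (q + r))) C).
Definition frame_eval (Phi : frame) (f : frame_poly) : C :=
  mpoly.meval (mxvec Phi 0) f.

Definition zariski_closed (Z : set flagGr) : Prop :=
  exists S : set frame_poly, forall x Phi, is_frame Phi x ->
    (Z x <-> forall f, S f -> frame_eval Phi f = 0).

Definition zariski_open (U : set flagGr) : Prop := zariski_closed (~` U).

Lemma zariski_openT : zariski_open setT.
Proof.
exists setT => x Phi _; split=> [|/(_ 1 I)/eqP]; first by case.
by rewrite /frame_eval mpoly.meval1 oner_eq0.
Qed.

Lemma zariski_openI : setI_closed zariski_open.
Proof.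
move=> U1 U2 [S1 H1] [S2 H2].
exists [set f | exists f1 f2, [/\ S1 f1, S2 f2 & f = (f1 * f2)%R]].
move=> x Phi Px; have {}H1 := H1 x Phi Px; have {}H2 := H2 x Phi Px.
rewrite setCI; split.
  move=> Zx f [f1 [f2 [Sf1 Sf2 ->]]]; rewrite /frame_eval mpoly.mevalM.
  case: Zx => [/H1/(_ f1 Sf1)|/H2/(_ f2 Sf2)]; rewrite /frame_eval => ->.
    by rewrite mul0r.
  by rewrite mulr0.
move=> Hf; have [/H1|nZ1] := boolp.pselect (forall f, S1 f -> frame_eval Phi f = 0).
  by left.
have [f1 /boolp.not_implyP[Sf1 nf1]] := (boolp.existsNP _).2 nZ1.
right; apply/H2 => f2 Sf2.
have /eqP : frame_eval Phi (f1 * f2) = 0 by apply: Hf; exists f1, f2.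
by rewrite /frame_eval mpoly.mevalM mulf_eq0 => /orP[/eqP//|/eqP].
Qed.

Lemma zariski_open_bigcup (I : Type) (U : I -> set flagGr) :
  (forall i, zariski_open (U i)) -> zariski_open (\bigcup_i U i).
Proof.
move=> oU; exists [set f | exists j (S : set frame_poly),
  (forall x Phi, is_frame Phi x ->
    ((~` U j) x <-> forall f, S f -> frame_eval Phi f = 0)) /\ S f].
move=> x Phi Px; rewrite setC_bigcup; split.
  by move=> Zx f [j [S [HS Sf]]]; apply: (HS x Phi Px).1 Sf; apply: Zx.
move=> Hf j _; have [S HS] := oU j.
by apply: (HS x Phi Px).2 => f Sf; apply: Hf; exists j, S.
Qed.

HB.instance Definition _ := isOpenTopological.Build flagGr
  zariski_openT zariski_openI zariski_open_bigcup.

Lemma closed_zariski (Z : set flagGr) : closed Z <-> zariski_closed Z.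
Proof. by rewrite -openC -[in X in _ <-> X](setCK Z). Qed.

Definition Kmap (g : 'M[C]_p) (h : 'M[C]_q) : 'End(V) :=
  linfun (mulmx (block_mx g 0 0 h) : V -> V).

Definition Korbit x : set flagGr :=
  [set y | exists g h, [/\ g \in unitmx, h \in unitmx &
     [/\ forall k, flag_plus y k = (Kmap g h @: flag_plus x k)%VS,
         forall l, flag_minus y l = (Kmap g h @: flag_minus x l)%VS
       & grass y = (Kmap g h @: grass x)%VS]]].

Definition partial_perm_mx a b (A : 'M[C]_(a, b)) : bool :=
  [&& [forall i, forall j, (A i j == 0) || (A i j == 1)],
      [forall i, (#|[pred j | A i j == 1%R]| <= 1)%N]
    & [forall j, (#|[pred i | A i j == 1%R]| <= 1)%N]].

Definition is_param (w : 'M[C]_(p + q, r)) : bool :=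
  [&& partial_perm_mx (usubmx w), partial_perm_mx (dsubmx w) & \rank w == r].

Definition param := {w : 'M[C]_(p + q, r) | is_param w}.
HB.instance Definition _ := Choice.on param.

Implicit Types w : param.

Definition col_equiv w w' : bool :=
  [exists s : 'S_r, val w' == col_perm s (val w)].

Lemma col_equiv_is_equiv : equiv_class_of col_equiv.
Proof.
split=> [w|w w'|w2 w1 w3].
- by apply/existsP; exists 1%g; rewrite col_perm1.
- by apply/idP/idP => /existsP[s /eqP E]; apply/existsP; exists s^-1%g;
    rewrite E -col_permM mulVg col_perm1.
- move=> /existsP[s /eqP E1] /existsP[t /eqP E2].
  by apply/existsP; exists (t * s)%g; rewrite E2 E1 -col_permM.
Qed.

Canonical col_equivalence := EquivRelPack col_equiv_is_equiv.

Definition param_bar := {eq_quot col_equivalence}%qT.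

Lemma param_is_point w :
  is_point ([ffun k : 'I_p => span_first basis_plus k],
            [ffun l : 'I_q => span_first basis_minus l], im_mx (val w)).
Proof.
have std m (A : 'M[C]_(p + q, m)) : \rank A = m ->
    complete_flag (im_mx A) [ffun k : 'I_m => span_first A k].
  move=> rA; apply/andP; split; last first.
    apply/forallP => k; apply/forallP => l; apply/implyP => kl; rewrite !ffunE.
    apply/sub_span => v /mapP[j]; rewrite mem_filter => /andP[jk _] ->.
    by apply: map_f; rewrite mem_filter mem_enum (leq_trans jk kl).
  apply/forallP => k; rewrite ffunE dim_span_first // eqxx andbT.
  apply/span_subvP => v /mapP[j _ ->]; rewrite colE.
  have -> : A *m delta_mx j 0 = linfun (mulmx A : 'cV_m -> 'cV_(p + q)) (delta_mx j 0).
    by rewrite lfunE.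
  exact/memv_img/memvf.
rewrite /is_point /= !std ?rank_col_mx0 ?rank_col_0mx ?mxrank1 //=.
by have /and3P[_ _ /eqP rw] := valP w; rewrite dim_im_mx.
Qed.

Definition param_point w : flagGr := Sub _ (param_is_point w).

Lemma param_point_col_equiv w w' :
  col_equiv w w' -> param_point w = param_point w'.
Proof.
case/existsP => s /eqP E; apply/val_inj; congr (_, _); rewrite /= E.
rewrite col_permE; apply/esym/vspaceP => v; apply/memv_imgP/memv_imgP => -[u _ ->].
  by exists (perm_mx s^-1 *m u); rewrite ?memvf // !lfunE /= mulmxA.
exists (perm_mx s *m u); rewrite ?memvf // !lfunE /= -mulmxA; congr (_ *m _).
by rewrite mulmxA -perm_mxM mulVg perm_mx1 mul1mx.
Qed.

(* by [param_point_col_equiv], independent of the chosen representative *)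
Definition orbit_bar (c : param_bar) : set flagGr := Korbit (param_point (repr c)).

(* Vertices of the graph are numbered from 0: i : 'I_p is the vertex (i+1)^+. *)

Definition tau1 w : 'M[C]_(p, r) := usubmx (val w).
Definition tau2 w : 'M[C]_(q, r) := dsubmx (val w).

Definition edge w : pred ('I_p * 'I_q) := fun e =>
  [exists c, (tau1 w e.1 c == 1) && (tau2 w e.2 c == 1)].

Definition marked_plus w : pred 'I_p := fun i =>
  [exists c, (tau1 w i c == 1) && [forall j, tau2 w j c == 0]].
Definition marked_minus w : pred 'I_q := fun j =>
  [exists c, (tau2 w j c == 1) && [forall i, tau1 w i c == 0]].

Definition free_plus w : pred 'I_p := fun i =>
  ~~ marked_plus w i && [forall j, ~~ edge w (i, j)].
Definition free_minus w : pred 'I_q := fun j =>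
  ~~ marked_minus w j && [forall i, ~~ edge w (i, j)].

Definition marked_plus_left w (i : 'I_p) : nat :=
  #|[pred k | marked_plus w k & (k <= i)%N]|.
Definition marked_minus_left w (j : 'I_q) : nat :=
  #|[pred l | marked_minus w l & (l <= j)%N]|.
Definition edges_left w (e : 'I_p * 'I_q) : nat :=
  #|[pred f | edge w f & (f.1 <= e.1)%N && (f.2 <= e.2)%N]|.

Section PointsAsObjects.
Variables (hp : (0 < p)%N) (hq : (0 < q)%N).

Definition point_space x (v : vertexJ p q) : {vspace V} :=
  match v with
  | vC => grass x | vL k => flag_plus x k | vM l => flag_minus x l
  | vD => fullv
  end.

(* all maps are inclusions between subspaces of V *)
Definition point_rep x : rep C (quiverJ hp hq) :=
  @Rep C (quiverJ hp hq) (fun v => subvs_of (point_space x v))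
    (fun a => linfun (vsproj (point_space x (tgtJ a)) \o vsval)).

Lemma point_incl x a :
  (point_space x (srcJ hp hq a) <= point_space x (tgtJ a))%VS.
Proof.
have /and3P[/andP[_ /forallP cp] /andP[_ /forallP cm] _] := valP x.
case: a => [|i||j|] /=; rewrite ?subvf //.
  by have /forallP/(_ (ord_next i))/implyP := cp (ord_here i); apply; apply: leqnSn.
by have /forallP/(_ (ord_next j))/implyP := cm (ord_here j); apply; apply: leqnSn.
Qed.

Lemma point_repE x a u : vsval (rmap (point_rep x) a u) = vsval u.
Proof.
rewrite lfunE /= vsprojK //; apply: subvP (point_incl x a) _ _.
exact: subvsP.
Qed.

Lemma flag_plus_last x : flag_plus x (ord_last hp) = Vplus.
Proof.
have /and3P[/andP[/forallP/(_ (ord_last hp))/andP[s /eqP d] _] _ _] := valP x.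
apply/eqP; rewrite eqEdim s /= d /= prednK // dim_im_mx //.
by rewrite rank_col_mx0 mxrank1.
Qed.

Lemma flag_minus_last x : flag_minus x (ord_last hq) = Vminus.
Proof.
have /and3P[_ /andP[/forallP/(_ (ord_last hq))/andP[s /eqP d] _] _] := valP x.
apply/eqP; rewrite eqEdim s /= d /= prednK // dim_im_mx //.
by rewrite rank_col_0mx mxrank1.
Qed.

Lemma memVplus (v : V) : (v \in Vplus) = (dsubmx v == 0).
Proof.
apply/memv_imgP/eqP => [[u _ ->]|v0].
  by rewrite lfunE /= mul_col_mx col_mxKd mul0mx.
exists (usubmx v); rewrite ?memvf // lfunE /= mul_col_mx mul1mx mul0mx.
by rewrite -v0 vsubmxK.
Qed.

Lemma memVminus (v : V) : (v \in Vminus) = (usubmx v == 0).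
Proof.
apply/memv_imgP/eqP => [[u _ ->]|v0].
  by rewrite lfunE /= mul_col_mx col_mxKu mul0mx.
exists (dsubmx v); rewrite ?memvf // lfunE /= mul_col_mx mul1mx mul0mx.
by rewrite -v0 vsubmxK.
Qed.

Lemma mem_limg_point x a (y : subvs_of (point_space x (tgtJ a))) :
  (y \in limg (rmap (point_rep x) a)) =
  (vsval y \in point_space x (srcJ hp hq a)).
Proof.
apply/memv_imgP/idP => [[u _ ->]|yP]; first by rewrite point_repE subvsP.
by exists (vsproj _ (vsval y)); rewrite ?memvf //; apply/val_inj;
  rewrite /= point_repE vsprojK.
Qed.

Lemma point_in_J x : in_J (point_rep x).
Proof.
split.
- move=> a; apply/eqP; rewrite -subv0; apply/subvP => u.
  rewrite memv_ker memv0 => /eqP u0; apply/eqP/val_inj.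
  by rewrite /= -[LHS](point_repE (a := a)) u0 !linear0.
- apply/vspaceP => y; rewrite memvf; pose v : V := vsval y.
  have -> : y = vsproj fullv (col_mx (usubmx v) 0)
              + vsproj fullv (col_mx 0 (dsubmx v)).
    apply/val_inj; rewrite -[RHS]/(vsval (_ + _)) linearD /= !vsprojK ?memvf //.
    by rewrite add_col_mx addr0 add0r vsubmxK.
  apply: memv_add.
    rewrite (@mem_limg_point x aalpha) /= flag_plus_last vsprojK ?memvf //.
    by rewrite memVplus col_mxKd.
  rewrite (@mem_limg_point x abeta) /= flag_minus_last vsprojK ?memvf //.
  by rewrite memVminus col_mxKu.
- apply/eqP; rewrite -subv0; apply/subvP => y; rewrite memv_cap.
  rewrite (@mem_limg_point x aalpha) (@mem_limg_point x abeta) /=.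
  rewrite flag_plus_last flag_minus_last memVplus memVminus memv0.
  case/andP=> /eqP d0 /eqP u0; apply/eqP/val_inj.
  by rewrite -[RHS]/(vsval 0) linear0 -[LHS]vsubmxK u0 d0 col_mx0.
Qed.

Definition point_obj x : objJ hp hq C := ObjJ (point_in_J x).

End PointsAsObjects.

End FlagVariety.

(* Main.v *)
Require Import Defs.
From HB Require Import structures.
From mathcomp Require Import all_boot all_order all_fingroup all_algebra.
From mathcomp Require Import generic_quotient.
From mathcomp Require Import classical_sets functions reals topology_structure.
From mathcomp Require Import complex.
From mathcomp Require Import (canonicals, coercions) mpoly.
From mathcomp Require Import zify.

Set Implicit Arguments.
Unset Strict Implicit.
Unset Printing Implicit Defensive.

Import GRing.Theory.

Local Open Scope classical_set_scope.
Local Open Scope ring_scope.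

(* Bringing a frame of [W] to echelon form under pairs of upper triangular matrices, one row at a
   time, puts every point in the orbit of some [F_omega].  The numbers of columns of omega lying
   in the rectangles [1, k] x [1, l] are the dimensions of Hom(I, F_omega) for explicit small
   indecomposables I.  They determine omega up to a permutation of columns, and can only grow in
   the closure of an orbit, by semicontinuity of the kernel of a polynomial matrix.  Conversely,
   if they are larger for omega than for omega', elementary moves (exchange two rows, or move one
   entry to a free row), each realized by a polynomial curve, lead from omega' to omega.

   Let A be the algebra of endomorphisms preserving F_omega and S a complement of A in
   gl_p x gl_q.  Near the identity, K is the product of 1 + S and of the stabilizer; hence dim S
   bounds the chains of irreducible closed subsets of the orbit, and is attained along a flag of
   S.  A basis of A indexed by the graph of omega gives dim A. *)

(** Closedness on [flagGr] is defined by polynomials on frames, so all geometry is done with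
    matrices: a point stands for all its frames, and closure means the vanishing of polynomials. Two
    obstacles shape the rest. The Krull dimension is defined by chains alone, so the upper bound
    needs a counting argument. A chain in the orbit is lifted to frames and prolonged downwards by a
    chain inside the fibre over one point, of length the dimension of the group of changes of frame;
    the polynomial functions of bounded degree on frames of the orbit are too few for the lifted
    chain to exceed the sum of that dimension and dim S. Moreover, the factorization through 1 + S
    holds only generically. Solving by adjugates instead of inverses makes it polynomial up to a
    determinant, and a generic identity spreads to every group element along a line, where a product
    of two polynomials vanishes identically only if one factor does. For the order, semicontinuity
    holds for every representation X; the small indecomposables serve only to recover rank
    conditions from the inequalities on Hom. *)

(** * Classes of functions closed under ring operations *)

Section FunctionAlgebra.
Variables (K : comNzRingType) (X : Type).

(** Applied both to polynomials in one variable and to polynomials in the entries of a matrix, so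
    that determinants, adjugates and products are treated once. *)
Record funalg (A : (X -> K) -> Prop) : Prop := Funalg {
  fa_const : forall c, A (fun=> c);
  fa_add : forall F G, A F -> A G -> A (fun x => F x + G x);
  fa_mul : forall F G, A F -> A G -> A (fun x => F x * G x) }.

Variables (A : (X -> K) -> Prop) (algA : funalg A).

Lemma fa_ext F G : A F -> F =1 G -> A G.
Proof. by move=> AF /boolp.funext <-. Qed.

Lemma fa_sum I (s : seq I) (P : pred I) (F : I -> X -> K) :
  (forall i, A (F i)) -> A (fun x => \sum_(i <- s | P i) F i x).
Proof.
move=> AF; elim: s => [|i s IH].
  by apply: fa_ext (fa_const algA 0) _ => x; rewrite big_nil.
case Pi: (P i); last by apply: fa_ext IH _ => x; rewrite big_cons Pi.
by apply: fa_ext (fa_add algA (AF i) IH) _ => x; rewrite big_cons Pi.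
Qed.

Lemma fa_prod I (s : seq I) (P : pred I) (F : I -> X -> K) :
  (forall i, A (F i)) -> A (fun x => \prod_(i <- s | P i) F i x).
Proof.
move=> AF; elim: s => [|i s IH].
  by apply: fa_ext (fa_const algA 1) _ => x; rewrite big_nil.
case Pi: (P i); last by apply: fa_ext IH _ => x; rewrite big_cons Pi.
by apply: fa_ext (fa_mul algA (AF i) IH) _ => x; rewrite big_cons Pi.
Qed.

Lemma fa_exp F k : A F -> A (fun x => F x ^+ k).
Proof.
move=> AF; elim: k => [|k IH]; first exact: fa_const algA 1.
by apply: fa_ext (fa_mul algA AF IH) _ => x; rewrite exprS.
Qed.

Lemma fa_det n (M : X -> 'M[K]_n) :
  (forall i j, A (fun x => M x i j)) -> A (fun x => \det (M x)).
Proof.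
move=> AM; apply: fa_sum => s; apply: (fa_mul algA); first exact: fa_const algA _.
exact: fa_prod.
Qed.

Lemma fa_adj n (M : X -> 'M[K]_n) :
  (forall i j, A (fun x => M x i j)) -> forall i j, A (fun x => (\adj (M x)) i j).
Proof.
move=> AM i j; apply: (@fa_ext (fun x => cofactor (M x) j i)); last first.
  by move=> x; rewrite mxE.
apply: (fa_mul algA); first exact: fa_const algA _.
apply: fa_det => k l; apply: fa_ext (AM (lift j k) (lift i l)) _ => x.
by rewrite !mxE.
Qed.

Lemma fa_mulmx m n k (M : X -> 'M[K]_(m, n)) (M' : X -> 'M[K]_(n, k)) :
  (forall i j, A (fun x => M x i j)) -> (forall i j, A (fun x => M' x i j)) ->
  forall i j, A (fun x => (M x *m M' x) i j).
Proof.
move=> AM AM' i j.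
apply: (@fa_ext (fun x => \sum_l M x i l * M' x l j)); last by move=> x; rewrite mxE.
by apply: fa_sum => l; apply: (fa_mul algA).
Qed.

Lemma fa_meval N (v : X -> 'I_N -> K) (f : mpoly.mpoly N K) :
  (forall i, A (fun x => v x i)) -> A (fun x => mpoly.meval (v x) f).
Proof.
move=> Av; apply: (@fa_ext (fun x => \sum_(m <- mpoly.msupp f)
  mpoly.mcoeff m f * \prod_i v x i ^+ mpoly.fun_of_multinom m i)).
  apply: fa_sum => m; apply: (fa_mul algA); first exact: fa_const algA _.
  by apply: fa_prod => i; apply: fa_exp.
by move=> x; rewrite mpoly.mevalE.
Qed.

End FunctionAlgebra.

(** * Polynomial functions on a line and on spaces of matrices *)

Section PolynomialFunctions.
Variable K : fieldType.

Definition upoly (F : K -> K) : Prop := exists p : {poly K}, forall t, F t = p.[t].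

Lemma upoly_funalg : funalg upoly.
Proof.
split=> [c|F G [p Fp] [q Gq]|F G [p Fp] [q Gq]].
- by exists c%:P => t; rewrite hornerC.
- by exists (p + q) => t; rewrite hornerD Fp Gq.
- by exists (p * q) => t; rewrite hornerM Fp Gq.
Qed.

Lemma upolyX : upoly id.
Proof. by exists 'X => t; rewrite hornerX. Qed.

(** [msize] exceeds the total degree by one, so [e] bounds the degree of some polynomial
    representing the function, which is all that counting needs. *)
Definition dpoly m n (e : nat) (F : 'M[K]_(m, n) -> K) : Prop :=
  exists2 f : mpoly.mpoly (m * n) K, (mpoly.msize f <= e.+1)%N
    & forall x, F x = mpoly.meval (mxvec x 0) f.

Definition mpolyf m n (F : 'M[K]_(m, n) -> K) : Prop :=
  exists f : mpoly.mpoly (m * n) K, forall x, F x = mpoly.meval (mxvec x 0) f.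

Section Matrices.
Variables m n : nat.
Implicit Types F G : 'M[K]_(m, n) -> K.

Lemma mpolyf_funalg : funalg (@mpolyf m n).
Proof.
split=> [c|F G [p Fp] [q Gq]|F G [p Fp] [q Gq]].
- by exists (mpoly.mpolyC _ c) => x; rewrite mpoly.mevalC.
- by exists (p + q) => x; rewrite mpoly.mevalD Fp Gq.
- by exists (p * q) => x; rewrite mpoly.mevalM Fp Gq.
Qed.

Lemma mpolyf_entry i j : mpolyf (fun x : 'M[K]_(m, n) => x i j).
Proof.
exists (mpoly.mpolyX K (mpoly.mnm1 (mxvec_index i j))) => x.
by rewrite mpoly.mevalXU mxvecE.
Qed.

(** With [upoly] for [A], this restricts a polynomial on matrices to a polynomial curve; most
    vanishing statements are reduced to one variable in this way. *)
Lemma mpolyf_comp X (A : (X -> K) -> Prop) (g : X -> 'M[K]_(m, n)) F :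
  funalg A -> mpolyf F -> (forall i j, A (fun x => g x i j)) -> A (fun x => F (g x)).
Proof.
move=> algA [f Ff] Ag; apply: (@fa_ext K X A (fun x => mpoly.meval (mxvec (g x) 0) f)).
  apply: fa_meval => // k; case/mxvec_indexP: k => i j.
  by apply: fa_ext (Ag i j) _ => x; rewrite mxvecE.
by move=> x; rewrite Ff.
Qed.

Lemma mpolyf_linear (l : {linear 'M[K]_(m, n) -> K^o}) : mpolyf l.
Proof.
apply: (@fa_ext _ _ (@mpolyf m n) (fun x => \sum_i \sum_j x i j * l (delta_mx i j))).
  do 2!apply: (fa_sum mpolyf_funalg) => ?.
  by apply: (fa_mul mpolyf_funalg); [apply: mpolyf_entry|apply: (fa_const mpolyf_funalg)].
move=> x; rewrite {2}[x]matrix_sum_delta linear_sum; apply: eq_bigr => i _.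
by rewrite linear_sum; apply: eq_bigr => j _; rewrite linearZ.
Qed.

Lemma dpoly_mpolyf e F : dpoly e F -> mpolyf F.
Proof. by case=> f _ Ff; exists f. Qed.

Lemma mpolyf_dpoly F : mpolyf F -> exists e, dpoly e F.
Proof. by case=> f Ff; exists (mpoly.msize f); exists f. Qed.

Lemma dpolyW e e' F : (e <= e')%N -> dpoly e F -> dpoly e' F.
Proof. by move=> ee' [f fe Ff]; exists f => //; apply: leq_trans fe _. Qed.

Lemma dpoly_const c : @dpoly m n 0 (fun=> c).
Proof.
exists (mpoly.mpolyC _ c) => [|x]; last by rewrite mpoly.mevalC.
by rewrite mpoly.mmeasureC; case: eqP.
Qed.

Lemma dpoly_add e F G : dpoly e F -> dpoly e G -> dpoly e (fun x => F x + G x).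
Proof.
move=> [f fe Ff] [g ge Gg]; exists (f + g) => [|x]; last by rewrite mpoly.mevalD Ff Gg.
by apply: leq_trans (mpoly.mmeasureD_le _ _ _) _; rewrite geq_max fe ge.
Qed.

Lemma dpoly_mul e e' F G :
  dpoly e F -> dpoly e' G -> dpoly (e + e') (fun x => F x * G x).
Proof.
move=> [f fe Ff] [g ge Gg]; exists (f * g) => [|x]; last by rewrite mpoly.mevalM Ff Gg.
rewrite mpoly.msizeE; apply/bigmax_leqP_seq => mm /mpoly.msuppM_le.
case/allpairsP => -[m1 m2] [/= h1 h2 ->]; rewrite mpoly.mdegD.
have /leq_trans/(_ fe) := mpoly.msize_mdeg_lt h1.
have /leq_trans/(_ ge) := mpoly.msize_mdeg_lt h2.
by rewrite !ltnS => ? ? _; rewrite leq_add.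
Qed.
End Matrices.
End PolynomialFunctions.

Arguments upoly_funalg {K}.
Arguments mpolyf_funalg {K m n}.

(** * Counting functions along chains of irreducible sets *)

Section DimensionBound.
Variable K : fieldType.

Lemma dpoly_ext m n e (F G : 'M[K]_(m, n) -> K) : dpoly e F -> F =1 G -> dpoly e G.
Proof. by move=> dF /boolp.funext <-. Qed.

Lemma dpoly_exp m n e k (F : 'M[K]_(m, n) -> K) :
  dpoly e F -> dpoly (k * e) (fun x => F x ^+ k).
Proof.
move=> dF; elim: k => [|k IH].
  by apply: dpoly_ext (dpoly_const _ _ 1) _ => x; rewrite expr0.
by apply: dpoly_ext (dpoly_mul dF IH) _ => x; rewrite exprS.
Qed.

Lemma dpoly_prod m n I (s : seq I) (e : I -> nat) (F : I -> 'M[K]_(m, n) -> K) :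
  (forall i, dpoly (e i) (F i)) ->
  dpoly (\sum_(i <- s) e i) (fun x => \prod_(i <- s) F i x).
Proof.
move=> dF; elim: s => [|i s IH].
  by rewrite big_nil; apply: dpoly_ext (dpoly_const _ _ 1) _ => x; rewrite big_nil.
by rewrite big_cons; apply: dpoly_ext (dpoly_mul (dF i) IH) _ => x; rewrite big_cons.
Qed.

Lemma dpoly_comp m n m' n' e d (F : 'M[K]_(m, n) -> K)
    (g : 'M[K]_(m', n') -> 'M[K]_(m, n)) :
  dpoly e F -> (forall i j, dpoly d (fun x => g x i j)) ->
  dpoly (e * d) (fun x => F (g x)).
Proof.
move=> [f fe Ff] dg.
pose Fm (mm : mpoly.multinom (m * n)) x :=
  mpoly.mcoeff mm f * \prod_i mxvec (g x) 0 i ^+ mpoly.fun_of_multinom mm i.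
have dFm mm : mm \in mpoly.msupp f -> dpoly (e * d) (Fm mm).
  move=> /mpoly.msize_mdeg_lt/leq_trans/(_ fe); rewrite ltnS mpoly.mdegE => le_e.
  apply: (@dpolyW _ _ _ (0 + \sum_i mpoly.fun_of_multinom mm i * d)).
    by rewrite add0n -big_distrl leq_mul2r le_e orbT.
  apply: dpoly_mul; first exact: dpoly_const.
  apply: dpoly_prod => i; apply: dpoly_exp.
  by case/mxvec_indexP: i => i j; apply: dpoly_ext (dg i j) _ => x; rewrite mxvecE.
apply: (@dpoly_ext _ _ _ (fun x => \sum_(mm <- mpoly.msupp f) Fm mm x)); last first.
  by move=> x; rewrite Ff mpoly.mevalE.
elim: (mpoly.msupp f) dFm => [|mm s IH] dFm.
  apply: dpolyW (leq0n _) _; apply: dpoly_ext (dpoly_const _ _ 0) _ => x.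
  by rewrite big_nil.
apply: (@dpoly_ext _ _ _ (fun x => Fm mm x + \sum_(mm' <- s) Fm mm' x)).
  apply: dpoly_add; first by apply: dFm; rewrite mem_head.
  by apply: IH => mm' h; apply: dFm; rewrite inE h orbT.
by move=> x; rewrite big_cons.
Qed.

(** A monomial of degree at most e has all its exponents at most e, which leaves (e + 1)^(m n)
    candidates. The count is crude, but only the exponent m n matters for the growth. *)
Lemma dpoly_dependent m n e (J : finType) (F : J -> 'M[K]_(m, n) -> K) :
  (forall j, dpoly e (F j)) -> (e.+1 ^ (m * n) < #|J|)%N ->
  exists2 c : J -> K, exists j, c j != 0 & forall x, \sum_j c j * F j x = 0.
Proof.
move=> dF ltJ.
have /boolp.choice[f fP] : forall j, exists f : mpoly.mpoly (m * n) K,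
    (mpoly.msize f <= e.+1)%N /\ forall x, F j x = mpoly.meval (mxvec x 0) f.
  by move=> j; have [f ? ?] := dF j; exists f.
pose I := {ffun 'I_(m * n) -> 'I_e.+1}.
pose mon (a : I) : mpoly.multinom (m * n) :=
  mpoly.Multinom [tuple (a i : nat) | i < m * n].
pose A : 'M[K]_(#|J|, #|I|) :=
  \matrix_(j, a) mpoly.mcoeff (mon (enum_val a)) (f (enum_val j)).
have cardI : #|I| = (e.+1 ^ (m * n))%N by rewrite card_ffun !card_ord.
have kerA : kermx A != 0.
  by rewrite -mxrank_eq0 mxrank_ker subn_eq0 -ltnNge -cardI in ltJ *;
     apply: leq_ltn_trans (rank_leq_col A) ltJ.
have /rowV0Pn[u uA u0] := kerA.
have {}uA : u *m A = 0 by apply/sub_kermxP.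
exists (fun j => u 0 (enum_rank j)).
  by have /rV0Pn[j uj] := u0; exists (enum_val j); rewrite enum_valK.
have c0 : \sum_j u 0 (enum_rank j) *: f j = 0.
  apply/mpoly.mpolyP => mm; rewrite mpoly.mcoeff0 raddf_sum /=.
  (* A monomial with an exponent above [e] occurs in no [f j]; the others are indexed by [I]. *)
  have [i big|small] := pickP (fun i : 'I_(m * n) => (e < mpoly.fun_of_multinom mm i)%N);
    last first.
    pose a : I := [ffun i => inord (mpoly.fun_of_multinom mm i)].
    have -> : mm = mon a.
      apply/mpoly.mnmP => i; rewrite /mon /mpoly.fun_of_multinom /= tnth_mktuple.
      by rewrite ffunE inordK // ltnS leqNgt small.
    have /rowP/(_ (enum_rank a)) := uA; rewrite !mxE => {}uA.
    rewrite -[RHS]uA (reindex_onto (fun j => enum_rank j) (fun j => enum_val j)) /=.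
      apply: eq_big => [j|j _]; first by rewrite enum_rankK eqxx.
      by rewrite mpoly.mcoeffZ !mxE !enum_rankK.
    by move=> j _; rewrite enum_valK.
  apply: big1 => j _; rewrite mpoly.mcoeffZ.
  suff -> : mpoly.mcoeff mm (f j) = 0 by rewrite mulr0.
  apply: mpoly.memN_msupp_eq0; apply: mpoly.msize_mdeg_ge.
  have [le_f _] := fP j; apply: leq_trans le_f _.
  by apply: leq_trans big _; rewrite mpoly.mdegE (bigD1 i) //= leq_addr.
move=> x; have := congr1 (mpoly.meval (mxvec x 0)) c0.
rewrite mpoly.meval0 raddf_sum /= => h; rewrite -[RHS]h; apply: eq_bigr => j _.
by rewrite mpoly.mevalZ (fP j).2.
Qed.

(** Irreducibility through functions: the polynomial functions restricted to [Y] have no zero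
    divisors. [Y] need not be closed, and the empty set qualifies. *)
Definition irr m n (Y : set 'M[K]_(m, n)) : Prop :=
  forall F G, mpolyf F -> mpolyf G -> (forall x, Y x -> F x * G x = 0) ->
    (forall x, Y x -> F x = 0) \/ (forall x, Y x -> G x = 0).

Definition lindep_free m n (Y : set 'M[K]_(m, n)) (J : finType)
    (e : J -> 'M[K]_(m, n) -> K) : Prop :=
  forall c : J -> K, (forall x, Y x -> \sum_j c j * e j x = 0) -> forall j, c j = 0.

(** On [Y] only the terms with exponent 0 of a relation survive, so their coefficients vanish by
    independence. The rest is divisible by [F], which can be cancelled because [Y'] is irreducible
    and [F] is not zero on it; then repeat. *)
Lemma lindep_free_step m n (Y Y' : set 'M[K]_(m, n)) (J : finType) e F k :
  Y `<=` Y' -> irr Y' -> (forall j : J, mpolyf (e j)) -> mpolyf F ->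
  (forall x, Y x -> F x = 0) -> (exists2 x, Y' x & F x != 0) ->
  lindep_free Y e ->
  lindep_free Y' (fun (js : J * 'I_k) x => e js.1 x * F x ^+ js.2).
Proof.
move=> YY' irrY' pe pF FY [x0 Yx0 Fx0] free.
have key k' (c : nat -> J -> K) :
    (forall x, Y' x -> \sum_(s < k') (\sum_j c s j * e j x) * F x ^+ s = 0) ->
    forall s j, (s < k')%N -> c s j = 0.
  elim: k' c => // k' IH c c0.
  have cc0 : forall j, c 0%N j = 0.
    apply: free => x Yx; have := c0 x (YY' x Yx).
    rewrite big_ord_recl expr0 mulr1 [X in _ + X]big1 ?addr0 // => s _.
    by rewrite FY // expr0n mulr0.
  have IHc : forall s j, (s < k')%N -> c s.+1 j = 0.
    apply: (IH (fun s => c s.+1)).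
    pose G x := \sum_(s < k') (\sum_j c s.+1 j * e j x) * F x ^+ s.
    have pG : mpolyf G.
      apply: (fa_sum mpolyf_funalg) => s; apply: (fa_mul mpolyf_funalg).
        apply: (fa_sum mpolyf_funalg) => j; apply: (fa_mul mpolyf_funalg) => //.
        exact: (fa_const mpolyf_funalg).
      exact: (fa_exp mpolyf_funalg).
    have /(irrY' _ _ pF pG) : forall x, Y' x -> F x * G x = 0.
      move=> x Yx; rewrite -[RHS](c0 x Yx) big_ord_recl big1 ?mul0r ?add0r; last first.
        by move=> j _; rewrite cc0 mul0r.
      rewrite /G big_distrr; apply: eq_bigr => s _ /=.
      by rewrite mulrCA exprS.
    by case=> // /(_ x0 Yx0) F0; rewrite F0 eqxx in Fx0.
  by case=> [|s] j //; apply: IHc.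
move=> c c0 [j s]; pose c' (s : nat) j := \sum_(t < k | t == s :> nat) c (j, t).
have -> : c (j, s) = c' s j.
  by rewrite /c' (big_pred1 s) // => t.
apply: (key k) => // x Yx; rewrite -[RHS](c0 x Yx).
rewrite (eq_bigr (fun t : 'I_k => \sum_j c (j, t) * e j x * F x ^+ t)); last first.
  move=> t _; rewrite big_distrl; apply: eq_bigr => i _ /=.
  by rewrite /c' (big_pred1 t).
rewrite exchange_big /= [RHS](eq_bigr (fun js : J * 'I_k =>
   c (js.1, js.2) * e js.1 x * F x ^+ js.2)).
  by rewrite -(pair_bigA _ (fun j t => c (j, t) * e j x * F x ^+ t)).
by case=> i t _ /=; rewrite mulrA.
Qed.

Lemma expn_bound (E N M : nat) :
  (forall k, (0 < k)%N -> (k ^ M <= (E * k).+1 ^ N)%N) -> (M <= N)%N.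
Proof.
move=> H; rewrite leqNgt; apply/negP => ltNM.
(* This [k] makes ((E + 1) k)^N = (E + 1)^N k^N smaller than k^(N + 1), which is at most k^M if N <
   M. *)
pose k := (E.+1 ^ N).+1; have := H k isT; apply/negP; rewrite -ltnNge.
apply: (@leq_ltn_trans ((E.+1 * k) ^ N)).
  by case: (N) => // N'; rewrite leq_exp2r // mulSn addnC -addn1 leq_add2l.
apply: (@leq_trans (k ^ N.+1)); last by rewrite leq_pexp2l.
by rewrite expnMn expnS ltn_mul2r expn_gt0 /= ltnSn.
Qed.

(* A substitute for transcendence degrees: each step of the chain multiplies by [k] the number
   of independent functions of degree at most [E * k] on [Y i], while such functions, pulled
   back by [g], live in a space of dimension at most [(E * e * k).+1 ^ N]. *)
Theorem chain_bound m n N (Y : nat -> set 'M[K]_(m, n)) (M : nat)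
    (g : 'rV[K]_N -> 'M[K]_(m, n)) :
  (forall i j, mpolyf (fun v => g v i j)) ->
  (forall i, (i <= M)%N -> irr (Y i)) -> Y 0%N !=set0 ->
  (forall i, (i < M)%N -> Y i `<=` Y i.+1 /\ exists F,
     [/\ mpolyf F, forall x, Y i x -> F x = 0 & exists2 x, Y i.+1 x & F x != 0]) ->
  (forall F, mpolyf F -> (forall v, F (g v) = 0) -> forall x, Y M x -> F x = 0) ->
  (M <= N)%N.
Proof.
move=> pg irrY [x0 Yx0] step dense.
have [e dg] : exists e, forall i j, dpoly e (fun v => g v i j).
  have /boolp.choice[e eP] : forall ij : 'I_m * 'I_n,
      exists e, dpoly e (fun v => g v ij.1 ij.2).
    by move=> ij; apply: mpolyf_dpoly.
  exists (\sum_ij e ij)%N => i j; apply: dpolyW (eP (i, j)).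
  by rewrite (bigD1 (i, j)) //= leq_addr.
have key i : (i <= M)%N -> exists E, forall k, (0 < k)%N ->
    exists (J : finType) (f : J -> 'M[K]_(m, n) -> K),
      [/\ #|J| = (k ^ i)%N, forall j, dpoly (E * k) (f j) & lindep_free (Y i) f].
  elim: i => [|i IH] lti.
    exists 0%N => k _; exists unit, (fun _ _ => 1); split => [|_|].
    - by rewrite card_unit.
    - exact: dpoly_const.
    - by move=> c /(_ x0 Yx0); rewrite (big_pred1 tt) => [|[] //]; rewrite mulr1 => + [].
  have [E HE] := IH (ltnW lti).
  have [YY [F [pF FY0 FY1]]] := step i lti.
  have [d dF] := mpolyf_dpoly pF.
  exists (E + d)%N => k k0; have [J [f [cJ df freef]]] := HE k k0.
  exists (J * 'I_k)%type, (fun (js : J * 'I_k) x => f js.1 x * F x ^+ js.2); split.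
  - by rewrite card_prod card_ord cJ expnSr.
  - move=> [j s]; apply: (@dpolyW _ _ _ (E * k + s * d)).
      by rewrite mulnDl leq_add2l mulnC leq_mul2l ltnW ?orbT.
    by apply: dpoly_mul => //; apply: dpoly_exp.
  - apply: (lindep_free_step YY) => //; first exact: irrY.
    by move=> j; apply: dpoly_mpolyf (df j).
have [E HE] := key M (leqnn M).
apply: (@expn_bound (E * e)) => k k0.
have [J [f [cJ df freef]]] := HE k k0.
rewrite leqNgt -cJ -[X in (_ ^ X)%N]mul1n; apply/negP => ltJ.
have dfg j : dpoly (E * e * k) (fun v => f j (g v)).
  by rewrite mulnAC; apply: dpoly_comp.
have [c [j cj] c0] := dpoly_dependent dfg ltJ.
suff /freef/(_ j) cj0 : forall x, Y M x -> \sum_j c j * f j x = 0.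
  by rewrite cj0 eqxx in cj.
apply: dense c0; apply: (fa_sum mpolyf_funalg) => i.
apply: (fa_mul mpolyf_funalg); first exact: (fa_const mpolyf_funalg).
exact: dpoly_mpolyf (df i).
Qed.

End DimensionBound.

(** * Triangular matrices, spans of columns and flags *)

Section LinearAlgebra.
Variable K : fieldType.

Definition upper m (A : 'M[K]_m) : Prop := forall i j : 'I_m, (j < i)%N -> A i j = 0.

Lemma upper1 m : @upper m 1%:M.
Proof. by move=> i j ij; rewrite mxE; case: eqP => // e; rewrite e ltnn in ij. Qed.

Lemma upperM m (A B : 'M[K]_m) : upper A -> upper B -> upper (A *m B).
Proof.
move=> uA uB i j ij; rewrite mxE big1 // => k _.
have [ki|ik] := ltnP k i; first by rewrite uA ?mul0r.
by rewrite uB ?mulr0 // (leq_trans ij).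
Qed.

Lemma upper_unit m (A : 'M[K]_m) : upper A -> (forall i, A i i != 0) -> A \in unitmx.
Proof.
move=> uA dA; rewrite unitmxE -det_tr det_trig.
  by rewrite unitfE; apply/prodf_neq0 => i _; rewrite mxE.
by apply/is_trig_mxP => i j ij; rewrite mxE uA.
Qed.

Lemma left_inverse m n (A : 'M[K]_(m, n)) : \rank A = n -> exists B, B *m A = 1%:M.
Proof.
move=> rA; have /row_freeP[B E] : row_free A^T by rewrite /row_free mxrank_tr rA.
by exists B^T; apply: trmx_inj; rewrite trmx_mul trmxK E trmx1.
Qed.

Lemma inj_rank m n (A : 'M[K]_(m, n)) k (v : 'M_(n, k)) : \rank A = n -> A *m v = 0 -> v = 0.
Proof.
by case/left_inverse=> B E Av; rewrite -[v]mul1mx -E -mulmxA Av mulmx0.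
Qed.

Lemma rank_inj m n (A : 'M[K]_(m, n)) : (forall v : 'cV_n, A *m v = 0 -> v = 0) -> \rank A = n.
Proof.
move=> inj; rewrite -mxrank_tr; apply/eqP/inj_row_free => v v0.
apply: trmx_inj; rewrite trmx0; apply: inj; apply: trmx_inj.
by rewrite trmx_mul trmxK trmx0.
Qed.

Lemma rank_unitmul m n (g : 'M[K]_m) (A : 'M[K]_(m, n)) : g \in unitmx -> \rank (g *m A) = \rank A.
Proof.
by move=> Ug; rewrite -mxrank_tr trmx_mul mxrankMfree ?mxrank_tr // row_free_unit unitmx_tr.
Qed.

Lemma unitmx_rankr m n (A : 'M[K]_(m, n)) (b : 'M[K]_n) : \rank (A *m b) = n -> b \in unitmx.
Proof.
by move=> rAb; rewrite -row_full_unit /row_full eqn_leq rank_leq_row -{1}rAb mxrankM_maxr.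
Qed.

Lemma mem_vbasis (V : vectType K) (U : {vspace V}) (i : 'I_(\dim U)) : (vbasis U)`_i \in U.
Proof. by apply/vbasis_mem/mem_nth; rewrite size_tuple. Qed.

Lemma coord_vbasis_nth (V : vectType K) (U : {vspace V}) (i j : 'I_(\dim U)) :
  coord (vbasis U) i (vbasis U)`_j = (i == j)%:R.
Proof. by rewrite coord_free ?(basis_free (vbasisP U)) // eq_sym. Qed.

Lemma mem_im_mx m n (A : 'M[K]_(m, n)) v : v \in im_mx A <-> exists c, v = A *m c.
Proof.
split=> [/memv_imgP[c _ ->]|[c ->]]; first by exists c; rewrite lfunE.
by apply/memv_imgP; exists c; rewrite ?memvf ?lfunE.
Qed.

Lemma mulmx_sum_col m n (A : 'M[K]_(m, n)) (c : 'cV_n) : A *m c = \sum_j c j 0 *: col j A.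
Proof. by apply/colP => i; rewrite summxE mxE; apply: eq_bigr => j _; rewrite !mxE mulrC. Qed.

Lemma mem_span_cols m n (A : 'M[K]_(m, n)) (S : pred 'I_n) v :
  v \in <<[seq col j A | j : 'I_n <- enum 'I_n & S j]>>%VS <->
  exists2 c : 'cV_n, forall i : 'I_n, ~~ S i -> c i 0 = 0 & v = A *m c.
Proof.
pose D : 'M[K]_n := diag_mx (\row_j (S j)%:R).
have DE (c : 'cV[K]_n) i : (D *m c) i 0 = (S i)%:R * c i 0.
  by rewrite mul_diag_mx !mxE.
have -> : <<[seq col j A | j : 'I_n <- enum 'I_n & S j]>>%VS = im_mx (A *m D).
  apply/eqP; rewrite eqEsubv; apply/andP; split.
    apply/span_subvP => u /mapP[j]; rewrite mem_filter => /andP[jk _] ->.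
    apply/mem_im_mx; exists (delta_mx j 0); rewrite -mulmxA colE; congr (_ *m _).
    apply/matrixP => i i'; rewrite ord1 DE !mxE eqxx andbT.
    by case: eqP => [->|_]; rewrite ?jk ?mul1r ?mulr0.
  apply/subvP => u /mem_im_mx[c ->]; rewrite -mulmxA.
  rewrite mulmx_sum_col; apply: memv_suml => j _; rewrite DE; case Sj: (S j); last first.
    by rewrite mul0r scale0r mem0v.
  apply/memvZ/memv_span/map_f; by rewrite mem_filter Sj mem_enum.
split=> [/mem_im_mx[c ->]|[c c0 ->]].
  exists (D *m c) => [i Si|]; last by rewrite mulmxA.
  by rewrite DE (negbTE Si) mul0r.
apply/mem_im_mx; exists c; rewrite -mulmxA; congr (_ *m _).
apply/colP => i; rewrite DE; case Si: (S i); first by rewrite mul1r.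
by rewrite c0 ?Si // mulr0.
Qed.

Lemma mem_span_first m n (A : 'M[K]_(m, n)) k v :
  v \in span_first A k <->
  exists2 c : 'cV_n, forall i : 'I_n, (k < i)%N -> c i 0 = 0 & v = A *m c.
Proof.
apply: iff_trans (mem_span_cols A (fun j => j <= k)%N v) _.
by split=> -[c c0 ->]; exists c => // i ki; apply: c0; [rewrite -ltnNge|rewrite ltnNge].
Qed.

Lemma dim_im_mx_le m n (A : 'M[K]_(m, n)) : (\dim (im_mx A) <= \rank A)%N.
Proof.
have sub : (im_mx A <= im_mx (col_base A))%VS.
  apply/subvP => v /mem_im_mx[c ->]; apply/mem_im_mx; exists (row_base A *m c).
  by rewrite mulmxA mulmx_base.
apply: leq_trans (dimvS sub) _; rewrite /im_mx.
apply: (@leq_trans (\dim {:'cV[K]_(\rank A)})); last by rewrite dimvf /dim /= muln1.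
by rewrite -(limg_ker_dim (linfun (mulmx (col_base A))) fullv) leq_addl.
Qed.

Lemma span_first_sub m n (A : 'M[K]_(m, n)) k : (span_first A k <= im_mx A)%VS.
Proof.
by apply/subvP => v /mem_span_first[c _ ->]; apply/mem_im_mx; exists c.
Qed.

Lemma span_first_upper m n (A : 'M[K]_(m, n)) b :
  upper b -> b \in unitmx -> forall k : 'I_n, \rank A = n ->
  span_first (A *m b) k = span_first A k.
Proof.
move=> ub Ub k rA; apply/eqP; rewrite eqEdim; apply/andP; split; last first.
  rewrite !dim_span_first // mxrankMfree //.
  by rewrite row_free_unit.
apply/subvP => v /mem_span_first[c c0 ->]; apply/mem_span_first.
exists (b *m c); last by rewrite mulmxA.
move=> i ki; rewrite mxE big1 // => j _.
have [ji|ij] := ltnP j i; first by rewrite ub ?mul0r.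
by rewrite c0 ?mulr0 // (leq_trans ki).
Qed.

(** Common source of the transition matrices for flags and for subspaces: [Q] records which
    coefficients are allowed in each column, and invertibility follows from the rank alone. *)
Lemma cols_trans m n (A A' : 'M[K]_(m, n)) (Q : 'I_n -> 'cV[K]_n -> Prop) :
  \rank A' = n -> (forall j, exists2 c, Q j c & col j A' = A *m c) ->
  exists b, [/\ forall j, Q j (col j b), b \in unitmx & A' = A *m b].
Proof.
move=> rA' AA'; have /boolp.choice[c cP] : forall j, exists c, Q j c /\ col j A' = A *m c.
  by move=> j; have [c] := AA' j; exists c.
pose b : 'M[K]_n := \matrix_(i, j) c j i 0.
have bE j : col j b = c j by apply/colP => i; rewrite !mxE.
have Ab : A' = A *m b.
  apply/matrixP => i j; have /colP/(_ i) := (cP j).2; rewrite !mxE => ->.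
  by apply: eq_bigr => k _; rewrite !mxE.
exists b; split=> // [j|]; first by rewrite bE; apply: (cP j).1.
by apply: (@unitmx_rankr m n A); rewrite -Ab.
Qed.

Lemma span_first_trans m n (A A' : 'M[K]_(m, n)) :
  \rank A' = n -> (forall k : 'I_n, span_first A k = span_first A' k) ->
  exists b, [/\ upper b, b \in unitmx & A' = A *m b].
Proof.
move=> rA' AA'; have [j|b [ub Ub Ab]] :=
    cols_trans (A := A) (Q := fun j c => forall i : 'I_n, (j < i)%N -> c i 0 = 0) rA'.
  apply/mem_span_first; rewrite AA'; apply/memv_span/map_f.
  by rewrite mem_filter leqnn mem_enum.
by exists b; split=> // i j ji; have := ub j i ji; rewrite mxE.
Qed.

Lemma im_mx_trans m n (A A' : 'M[K]_(m, n)) :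
  \rank A' = n -> (im_mx A' <= im_mx A)%VS -> exists2 b, b \in unitmx & A' = A *m b.
Proof.
move=> rA' /subvP AA'; have [j|b [_ Ub Ab]] := cols_trans (A := A) (Q := fun _ _ => True) rA'.
  have /mem_im_mx[c cE] : col j A' \in im_mx A; last by exists c.
  by apply/AA'/mem_im_mx; exists (delta_mx j 0); apply: colE.
by exists b.
Qed.

Lemma im_mxM m n (A : 'M[K]_(m, n)) b : b \in unitmx -> im_mx (A *m b) = im_mx A.
Proof.
move=> Ub; apply/vspaceP => v; apply/idP/idP => /mem_im_mx[c ->]; apply/mem_im_mx.
  by exists (b *m c); rewrite mulmxA.
by exists (invmx b *m c); rewrite -mulmxA mulKVmx.
Qed.

Lemma limg_mulmx_span_first m n k (g : 'M[K]_m) (A : 'M[K]_(m, n)) :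
  (linfun (mulmx g : 'cV_m -> 'cV_m) @: span_first A k)%VS = span_first (g *m A) k.
Proof.
rewrite limg_span -map_comp; congr <<_>>%VS; apply: eq_map => j /=.
by rewrite lfunE /= !colE mulmxA.
Qed.

Lemma limg_mulmx_im n m (g : 'M[K]_m) (A : 'M[K]_(m, n)) :
  (linfun (mulmx g : 'cV_m -> 'cV_m) @: im_mx A)%VS = im_mx (g *m A).
Proof.
rewrite /im_mx -limg_comp; congr (_ @: _)%VS; apply/lfunP => v.
by rewrite comp_lfunE !lfunE /= mulmxA.
Qed.

End LinearAlgebra.

(** * Block matrices acting on frames *)

Section BlockMatrices.
Variables (K : fieldType) (p q r : nat).

Definition blk (s : 'M[K]_p * 'M[K]_q) : 'M[K]_(p + q) := block_mx s.1 0 0 s.2.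

(** Changes of frame act on the right through these matrices, while [K] acts on the left through
    [blk]; the two actions commute. *)
Definition bdiag (b1 : 'M[K]_p) (b2 : 'M[K]_q) (z : 'M[K]_r) : 'M[K]_(p + (q + r)) :=
  block_mx b1 0 0 (block_mx b2 0 0 z).

Definition mkframe (A : 'M[K]_p) (B : 'M[K]_q) (M : 'M[K]_(p + q, r)) :
    'M[K]_(p + q, p + (q + r)) :=
  row_mx (col_mx A 0) (row_mx (col_mx 0 B) M).

Lemma row_mx_bdiag m (A : 'M[K]_(m, p)) (B : 'M[K]_(m, q)) (M : 'M[K]_(m, r)) b1 b2 z :
  row_mx A (row_mx B M) *m bdiag b1 b2 z = row_mx (A *m b1) (row_mx (B *m b2) (M *m z)).
Proof.
by rewrite !mul_row_block !mulmx0 !addr0 !add0r.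
Qed.

Lemma mkframe_bdiag A B M b1 b2 z :
  mkframe A B M *m bdiag b1 b2 z = mkframe (A *m b1) (B *m b2) (M *m z).
Proof. by rewrite row_mx_bdiag !mul_col_mx !mul0mx. Qed.

Lemma blk_mkframe s A B M :
  blk s *m mkframe A B M = mkframe (s.1 *m A) (s.2 *m B) (blk s *m M).
Proof.
by rewrite /mkframe !mul_mx_row !mul_block_col !mulmx0 !mul0mx !addr0 !add0r.
Qed.

Lemma mkframe_inj A B M A' B' M' :
  mkframe A B M = mkframe A' B' M' -> [/\ A = A', B = B' & M = M'].
Proof. by case/eq_row_mx=> /eq_col_mx[? _] /eq_row_mx[/eq_col_mx[_ ?] ?]. Qed.

Lemma bdiagM a1 a2 y b1 b2 z :
  bdiag a1 a2 y *m bdiag b1 b2 z = bdiag (a1 *m b1) (a2 *m b2) (y *m z).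
Proof. by rewrite /bdiag !mulmx_block !mulmx0 !mul0mx !addr0 !add0r. Qed.

Lemma bdiag1 : bdiag 1%:M 1%:M 1%:M = 1%:M.
Proof. by rewrite /bdiag -!scalar_mx_block. Qed.

Lemma bdiag_unit b1 b2 z :
  (bdiag b1 b2 z \in unitmx) = [&& b1 \in unitmx, b2 \in unitmx & z \in unitmx].
Proof. by rewrite !unitmxE !det_ublock !unitrM. Qed.

Lemma blkM s t : blk s *m blk t = blk (s.1 *m t.1, s.2 *m t.2).
Proof. by rewrite /blk !mulmx_block !mulmx0 !mul0mx !addr0 !add0r. Qed.

Lemma blk1 : blk (1%:M, 1%:M) = 1%:M.
Proof. by rewrite /blk /= -scalar_mx_block. Qed.

Lemma blk_unit s : (blk s \in unitmx) = (s.1 \in unitmx) && (s.2 \in unitmx).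
Proof. by rewrite !unitmxE det_ublock unitrM. Qed.

Lemma blk_linear : linear blk.
Proof.
by move=> a s t; rewrite /blk scale_block_mx add_block_mx !scaler0 !addr0.
Qed.

HB.instance Definition _ := GRing.isLinear.Build K _ _ _ blk blk_linear.

End BlockMatrices.

(** * Frames, orbits, and closures in terms of polynomials *)

Section Frames.
Variables (R : realType) (p q r : nat).
Local Notation C := (R[i])%C.
Local Notation flagGr := (flagGr R p q r).
Local Notation frame := 'M[C]_(p + q, p + (q + r)).
Implicit Types (x y : flagGr) (Phi Psi : frame).

Definition gunit (s : 'M[C]_p * 'M[C]_q) : Prop := s.1 \in unitmx /\ s.2 \in unitmx.

Definition in_bor (b1 : 'M[C]_p) (b2 : 'M[C]_q) : Prop := upper b1 /\ upper b2.

Lemma flag_full_rank m (A : 'M[C]_(p + q, m)) :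
  (forall k : 'I_m, \dim (span_first A k) = k.+1) -> \rank A = m.
Proof.
case: m A => [|m] A dA; first by apply/eqP; rewrite -leqn0 rank_leq_col.
apply/eqP; rewrite eqn_leq rank_leq_col /=.
apply: leq_trans (dim_im_mx_le A); rewrite -[X in (X <= _)%N](dA ord_max).
exact/dimvS/span_first_sub.
Qed.

Lemma complete_flag_span m (U : {vspace 'cV[C]_(p + q)}) F (A : 'M[C]_(p + q, m)) :
  complete_flag U F -> (forall k : 'I_m, F k = span_first A k) ->
  \rank A = m /\ forall j, col j A \in U.
Proof.
case/andP=> /forallP FU _ FA; split.
  by apply: flag_full_rank => k; rewrite -FA; have /andP[_ /eqP] := FU k.
move=> j; have /andP[/subvP FUj _] := FU j; apply: FUj; rewrite FA.
by apply/memv_span/map_f; rewrite mem_filter leqnn mem_enum.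
Qed.

(** The definition of a frame mentions neither zero blocks nor ranks. The ranks come from the
    dimensions of the members of the flags, the zero blocks from their inclusion in V^+ and V^-. *)
Lemma is_frame_mkframe Phi x : is_frame Phi x ->
  exists A B M, [/\ Phi = mkframe A B M, A \in unitmx, B \in unitmx & \rank M = r].
Proof.
case=> xA xB xM; have /and3P[cA cB /eqP dM] := valP x.
have [rA A0] := complete_flag_span cA xA.
have [rB B0] := complete_flag_span cB xB.
have {}A0 : dsubmx (lsubmx Phi) = 0.
  apply/matrixP => i j; have := A0 j; rewrite memVplus => /eqP/colP/(_ i).
  by rewrite !mxE.
have {}B0 : usubmx (lsubmx (rsubmx Phi)) = 0.
  apply/matrixP => i j; have := B0 j; rewrite memVminus => /eqP/colP/(_ i).
  by rewrite !mxE.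
have EA : lsubmx Phi = col_mx (usubmx (lsubmx Phi)) 0 by rewrite -A0 vsubmxK.
have EB : lsubmx (rsubmx Phi) = col_mx 0 (dsubmx (lsubmx (rsubmx Phi))).
  by rewrite -B0 vsubmxK.
exists (usubmx (lsubmx Phi)), (dsubmx (lsubmx (rsubmx Phi))), (rsubmx (rsubmx Phi)).
split.
- by rewrite /mkframe -EA -EB !hsubmxK.
- by rewrite -row_full_unit /row_full -(rank_col_mx0 q) -EA rA.
- by rewrite -row_full_unit /row_full -(rank_col_0mx p) -EB rB.
- apply/eqP; rewrite eqn_leq rank_leq_col /=; apply: leq_trans (dim_im_mx_le _).
  by rewrite -xM -{1}dM.
Qed.

Lemma is_frame_mk Phi x A B M : Phi = mkframe A B M ->
  is_frame Phi x <-> [/\ forall k : 'I_p, flag_plus x k = span_first (col_mx A 0) k,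
    forall k : 'I_q, flag_minus x k = span_first (col_mx 0 B) k & grass x = im_mx M].
Proof. by move=> ->; rewrite /is_frame /mkframe !row_mxKr !row_mxKl. Qed.

Lemma is_frameM Phi x b1 b2 z : is_frame Phi x -> in_bor b1 b2 ->
  bdiag b1 b2 z \in unitmx -> is_frame (Phi *m bdiag b1 b2 z) x.
Proof.
move=> Px [u1 u2]; rewrite bdiag_unit => /and3P[U1 U2 Uz].
have [A [B [M [E UA UB rM]]]] := is_frame_mkframe Px.
have /(is_frame_mk x)[+ _] := E => /(_ Px)[xA xB xM].
apply/(is_frame_mk x); first by rewrite E mkframe_bdiag.
have rA : \rank (col_mx A (0 : 'M_(q, p))) = p by rewrite rank_col_mx0 mxrank_unit.
have rB : \rank (col_mx (0 : 'M_(p, q)) B) = q by rewrite rank_col_0mx mxrank_unit.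
split=> [k|k|]; last by rewrite im_mxM.
  by rewrite -[X in col_mx _ X](mul0mx _ b1) -mul_col_mx span_first_upper.
by rewrite -[X in col_mx X _](mul0mx _ b2) -mul_col_mx span_first_upper.
Qed.

(** The frames of a point form one orbit of B_p x B_q x GL_r: two bases adapted to a flag differ by
    a triangular matrix, two bases of a subspace by an invertible one. *)
Lemma is_frame_trans Phi Psi x : is_frame Phi x -> is_frame Psi x ->
  exists b1 b2 z, [/\ in_bor b1 b2, bdiag b1 b2 z \in unitmx
                    & Psi = Phi *m bdiag b1 b2 z].
Proof.
move=> Px Qx; have [A [B [M [E UA UB rM]]]] := is_frame_mkframe Px.
have [A' [B' [M' [E' UA' UB' rM']]]] := is_frame_mkframe Qx.
have /(is_frame_mk x)[+ _] := E => /(_ Px)[xA xB xM].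
have /(is_frame_mk x)[+ _] := E' => /(_ Qx)[xA' xB' xM'].
have rA' : \rank (col_mx A' (0 : 'M_(q, p))) = p by rewrite rank_col_mx0 mxrank_unit.
have rB' : \rank (col_mx (0 : 'M_(p, q)) B') = q by rewrite rank_col_0mx mxrank_unit.
have [k|b1 [u1 U1 EA]] := span_first_trans (A := col_mx A 0) rA'; first by rewrite -xA.
have [k|b2 [u2 U2 EB]] := span_first_trans (A := col_mx 0 B) rB'; first by rewrite -xB.
have [|z Uz EM] := im_mx_trans (A := M) rM'; first by rewrite -xM -xM'.
exists b1, b2, z; split=> //; first by rewrite bdiag_unit U1 U2.
by rewrite E E' /mkframe row_mx_bdiag -EA -EB -EM.
Qed.

Lemma mkframe_point A B M : A \in unitmx -> B \in unitmx -> \rank M = r ->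
  exists x, is_frame (mkframe A B M) x.
Proof.
move=> UA UB rM.
have std m (D D' : 'M[C]_(p + q, m)) : \rank D = m -> im_mx D = im_mx D' ->
    complete_flag (im_mx D') [ffun k : 'I_m => span_first D k].
  move=> rD <-; apply/andP; split; last first.
    apply/forallP => k; apply/forallP => l; apply/implyP => kl; rewrite !ffunE.
    apply/sub_span => v /mapP[j]; rewrite mem_filter => /andP[jk _] ->.
    by apply: map_f; rewrite mem_filter mem_enum (leq_trans jk kl).
  by apply/forallP => k; rewrite ffunE dim_span_first // eqxx andbT span_first_sub.
have xP : is_point r ([ffun k : 'I_p => span_first (col_mx A (0 : 'M_(q, p))) k],
    [ffun l : 'I_q => span_first (col_mx (0 : 'M_(p, q)) B) l], im_mx M).
  rewrite /is_point /= !std ?rank_col_mx0 ?rank_col_0mx ?mxrank_unit //=.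
  - by rewrite dim_im_mx.
  - rewrite -(im_mxM (basis_minus R p q) UB); congr im_mx.
    by rewrite mul_col_mx mul0mx mul1mx.
  - rewrite -(im_mxM (basis_plus R p q) UA); congr im_mx.
    by rewrite mul_col_mx mul0mx mul1mx.
exists (Sub _ xP); apply/(is_frame_mk _ erefl).
by split=> [k|k|]; rewrite /flag_plus /flag_minus /grass SubK /= ?ffunE.
Qed.

Definition wframe (M : 'M[C]_(p + q, r)) : frame := mkframe 1%:M 1%:M M.

Lemma param_point_frame (w : param R p q r) : is_frame (wframe (val w)) (param_point w).
Proof.
apply/(is_frame_mk _ erefl).
by split=> [k|k|]; rewrite /flag_plus /flag_minus /grass SubK /= ?ffunE.
Qed.

Lemma KorbitP Phi x y : is_frame Phi x ->
  Korbit x y <-> exists2 s, gunit s & is_frame (blk s *m Phi) y.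
Proof.
move=> Px; have [A [B [M [E UA UB rM]]]] := is_frame_mkframe Px.
have /(is_frame_mk x)[+ _] := E => /(_ Px)[xA xB xM].
have act g h : [/\ forall k, (Kmap g h @: flag_plus x k)%VS = span_first (col_mx (g *m A) 0) k,
     forall k, (Kmap g h @: flag_minus x k)%VS = span_first (col_mx 0 (h *m B)) k
   & (Kmap g h @: grass x)%VS = im_mx (blk (g, h) *m M)].
  split=> [k|k|].
  - rewrite xA /Kmap limg_mulmx_span_first mul_block_col.
    by rewrite !mulmx0 mul0mx !addr0.
  - rewrite xB /Kmap limg_mulmx_span_first mul_block_col.
    by rewrite !mulmx0 mul0mx !add0r.
  - by rewrite xM limg_mulmx_im.
split=> [[g [h [Ug Uh [yA yB yM]]]]|[[g h] [Ug Uh]]].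
  have [aA aB aM] := act g h; exists (g, h) => //.
  apply/(is_frame_mk y); first by rewrite E blk_mkframe.
  by split=> [k|k|]; rewrite ?yA ?yB ?yM ?aA ?aB ?aM.
move/(is_frame_mk y) => H; have {H}[|yA yB yM] := H (g *m A) (h *m B) (blk (g, h) *m M).
  by rewrite E blk_mkframe.
by have [aA aB aM] := act g h; exists g, h; split=> //; split=> [k|k|];
  rewrite ?yA ?yB ?yM ?aA ?aB ?aM.
Qed.

Lemma is_frame_act Phi x s : is_frame Phi x -> gunit s ->
  exists2 y, Korbit x y & is_frame (blk s *m Phi) y.
Proof.
move=> Px [U1 U2]; have [A [B [M [E UA UB rM]]]] := is_frame_mkframe Px.
have [||| y Py] := @mkframe_point (s.1 *m A) (s.2 *m B) (blk s *m M).
- by rewrite unitmx_mul U1 UA.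
- by rewrite unitmx_mul U2 UB.
- by rewrite rank_unitmul // blk_unit U1.
rewrite E blk_mkframe; exists y => //; apply/(KorbitP _ Px).
by exists s => //; rewrite E blk_mkframe.
Qed.

Lemma gunitM s t : gunit s -> gunit t -> gunit (s.1 *m t.1, s.2 *m t.2).
Proof. by case=> a b [c d]; split; rewrite unitmx_mul ?a ?b. Qed.

Lemma gunitV s : gunit s -> exists2 t, gunit t & blk t *m blk s = 1%:M.
Proof.
case=> a b; exists (invmx s.1, invmx s.2); first by split; rewrite unitmx_inv.
by rewrite blkM /= !mulVmx // blk1.
Qed.

Lemma gunit1 : gunit (1%:M, 1%:M).
Proof. by split; rewrite unitmx1. Qed.

Lemma Korbit_refl x Phi : is_frame Phi x -> Korbit x x.
Proof.
move=> Px; apply/(KorbitP _ Px); exists (1%:M, 1%:M); first exact: gunit1.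
by rewrite blk1 mul1mx.
Qed.

Lemma Korbit_eq x y Phi : is_frame Phi x -> Korbit x y -> Korbit y = Korbit x.
Proof.
move=> Px /(KorbitP _ Px)[s Us Py]; apply/seteqP; split=> z.
  case/(KorbitP _ Py) => t Ut; rewrite mulmxA blkM => Pz.
  by apply/(KorbitP _ Px); exists (t.1 *m s.1, t.2 *m s.2) => //; apply: gunitM.
case/(KorbitP _ Px) => t Ut Pz; have [s' Us' E] := gunitV Us.
apply/(KorbitP _ Py); exists (t.1 *m s'.1, t.2 *m s'.2); first exact: gunitM.
by rewrite -blkM mulmxA -(mulmxA (blk t)) E mulmx1.
Qed.

Lemma Korbit_frame x y Phi Psi : is_frame Phi x -> is_frame Psi y -> Korbit x y ->
  exists s b1 b2 z, [/\ gunit s, in_bor b1 b2, bdiag b1 b2 z \in unitmx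
    & Psi = blk s *m Phi *m bdiag b1 b2 z].
Proof.
move=> Px Py /(KorbitP _ Px)[s Us Py'].
by have [b1 [b2 [z [? ? ?]]]] := is_frame_trans Py' Py; exists s, b1, b2, z.
Qed.

Lemma mpolyf_mull m n k (g : 'M[C]_(k, m)) (F : 'M[C]_(k, n) -> C) :
  mpolyf F -> mpolyf (fun x : 'M[C]_(m, n) => F (g *m x)).
Proof.
move=> pF; apply: (mpolyf_comp mpolyf_funalg pF) => i j.
apply: (fa_mulmx mpolyf_funalg) => a b; last exact: mpolyf_entry.
exact: (fa_const mpolyf_funalg).
Qed.

Lemma mpolyf_mulr m n k (g : 'M[C]_(n, k)) (F : 'M[C]_(m, k) -> C) :
  mpolyf F -> mpolyf (fun x : 'M[C]_(m, n) => F (x *m g)).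
Proof.
move=> pF; apply: (mpolyf_comp mpolyf_funalg pF) => i j.
apply: (fa_mulmx mpolyf_funalg) => a b; first exact: mpolyf_entry.
exact: (fa_const mpolyf_funalg).
Qed.

(** [F] need not be invariant under changes of frame, so the set is cut out by all the translates of
    [F] under them. *)
Lemma closed_poly (F : frame -> C) : mpolyf F ->
  closed [set x : flagGr | forall Phi, is_frame Phi x -> F Phi = 0].
Proof.
move=> pF; apply/closed_zariski.
exists [set f | exists b1 b2 z, [/\ in_bor b1 b2, bdiag b1 b2 z \in unitmx
   & forall Phi, frame_eval Phi f = F (Phi *m bdiag b1 b2 z)]] => x Phi Px; split.
  by move=> Zx f [b1 [b2 [z [bor Ub ->]]]]; apply: Zx; apply: is_frameM.
move=> Zx Psi Qx; have [b1 [b2 [z [bor Ub ->]]]] := is_frame_trans Px Qx.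
have [f fE] : mpolyf (fun Phi => F (Phi *m bdiag b1 b2 z)).
  exact: mpolyf_mulr pF.
by rewrite fE; apply: Zx; exists b1, b2, z; split.
Qed.

Lemma closed_polysE (Z : set flagGr) : closed Z -> exists2 FF : set (frame -> C),
  forall F, FF F -> mpolyf F
  & forall x Phi, is_frame Phi x -> (Z x <-> forall F, FF F -> F Phi = 0).
Proof.
case/closed_zariski => S HS; exists [set F | exists2 f, S f & F = fun Phi => frame_eval Phi f].
  by move=> F [f _ ->]; exists f.
move=> x Phi Px; split=> [/(HS x Phi Px) H F [f Sf ->]|H]; first exact: H.
by apply/(HS x Phi Px) => f Sf; apply: (H (fun Phi => frame_eval Phi f)); exists f.
Qed.

Lemma closureP (A : set flagGr) x Phi : is_frame Phi x ->
  closure A x <-> forall F, mpolyf F ->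
    (forall y Psi, A y -> is_frame Psi y -> F Psi = 0) -> F Phi = 0.
Proof.
move=> Px; split=> [clx F pF FA|H].
  apply: (closed_poly pF (t := x)) Px.
  by apply: closureS clx => y Ay Psi Py; apply: FA Py.
have [FF pFF HFF] := closed_polysE (@closed_closure _ A).
apply/(HFF x Phi Px) => F FFF; apply: H; first exact: pFF.
by move=> y Psi /subset_closure Ay Py; apply: (HFF y Psi Py).1.
Qed.

(** The working form of orbit closures, in which no point of the orbit appears any more: only the
    matrices obtained from one frame by the two group actions. *)
Lemma closure_KorbitP x0 Phi0 x Phi : is_frame Phi0 x0 -> is_frame Phi x ->
  closure (Korbit x0) x <-> forall F, mpolyf F ->
    (forall s b1 b2 z, gunit s -> in_bor b1 b2 -> bdiag b1 b2 z \in unitmx ->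
       F (blk s *m Phi0 *m bdiag b1 b2 z) = 0) -> F Phi = 0.
Proof.
move=> P0 Px; split=> [/(closureP _ Px) H F pF H0|H].
  apply: H => // y Psi Oy Py; have [s [b1 [b2 [z [Us bor Ub ->]]]]] := Korbit_frame P0 Py Oy.
  exact: H0.
apply/(closureP _ Px) => F pF HF; apply: H => // s b1 b2 z Us bor Ub.
have [y Oy Py] := is_frame_act P0 Us.
exact: HF Oy (is_frameM Py bor Ub).
Qed.

(** Translation by an element of [K] permutes the polynomials that vanish on all frames of an orbit,
    so the closure is stable under [K]. *)
Lemma Korbit_sub_closure x0 Phi0 x Phi : is_frame Phi0 x0 -> is_frame Phi x ->
  closure (Korbit x0) x -> Korbit x `<=` closure (Korbit x0).
Proof.
move=> P0 Px /(closure_KorbitP P0 Px) clx y /(KorbitP _ Px)[s Us Py].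
apply/(closure_KorbitP P0 Py) => F pF F0.
apply: (clx (fun X => F (blk s *m X))) (mpolyf_mull _ pF) _ => t b1 b2 z Ut bor Ub.
rewrite mulmxA mulmxA blkM; apply: F0 => //; exact: gunitM.
Qed.

End Frames.

(** * Configurations coding the parameters *)

Section Configurations.
Variables (p q r : nat).

(* Column [c] has its entries 1 in row [(P c).1] of the upper block and row [(P c).2] of the
   lower one; rows are numbered from 1, and 0 means that the block has no 1 in the column. *)
Definition config := 'I_r -> nat * nat.
Implicit Types P Q : config.

Record valid P : Prop := Valid {
  valid_le1 : forall c, ((P c).1 <= p)%N;
  valid_le2 : forall c, ((P c).2 <= q)%N;
  valid_neq0 : forall c, (0 < (P c).1)%N || (0 < (P c).2)%N;
  valid_inj1 : forall c c', (0 < (P c).1)%N -> (P c).1 = (P c').1 -> c = c';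
  valid_inj2 : forall c c', (0 < (P c).2)%N -> (P c).2 = (P c').2 -> c = c' }.

Section Matrix.
Variable K : fieldType.

Definition cmx P : 'M[K]_(p + q, r) :=
  col_mx (\matrix_(i, c) (i.+1 == (P c).1)%:R) (\matrix_(j, c) (j.+1 == (P c).2)%:R).

Lemma cmx_mul_plus P n (v : 'M[K]_(r, n)) c (i : 'I_p) k : valid P ->
  (P c).1 = i.+1 -> (cmx P *m v) (lshift q i) k = v c k.
Proof.
move=> vP xc; rewrite mul_col_mx col_mxEu mxE (bigD1 c) //= big1 => [|c' c'c].
  by rewrite mxE xc eqxx mul1r addr0.
rewrite mxE; case: eqP => [e|_]; last by rewrite mul0r.
have cc : c = c' by apply: (valid_inj1 vP); rewrite xc.
by rewrite cc eqxx in c'c.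
Qed.

Lemma cmx_mul_minus P n (v : 'M[K]_(r, n)) c (j : 'I_q) k : valid P ->
  (P c).2 = j.+1 -> (cmx P *m v) (rshift p j) k = v c k.
Proof.
move=> vP xc; rewrite mul_col_mx col_mxEd mxE (bigD1 c) //= big1 => [|c' c'c].
  by rewrite mxE xc eqxx mul1r addr0.
rewrite mxE; case: eqP => [e|_]; last by rewrite mul0r.
have cc : c = c' by apply: (valid_inj2 vP); rewrite xc.
by rewrite cc eqxx in c'c.
Qed.

(** Each column has a 1 in a row where the other columns vanish, so every coefficient of a
    combination of the columns can be read off as a coordinate. The full rank follows. *)
Lemma cmx_coord P n c : valid P -> exists i, forall (v : 'M[K]_(r, n)) k, (cmx P *m v) i k = v c k.
Proof.
move=> vP; case: (posnP (P c).1) => [x0|x0].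
  have y0 : (0 < (P c).2)%N by have := valid_neq0 vP c; rewrite x0.
  have yq : ((P c).2.-1 < q)%N by rewrite prednK // valid_le2.
  exists (rshift p (Ordinal yq)) => v k; apply: cmx_mul_minus => //=.
  by rewrite prednK.
have xp : ((P c).1.-1 < p)%N by rewrite prednK // valid_le1.
exists (lshift q (Ordinal xp)) => v k; apply: cmx_mul_plus => //=.
by rewrite prednK.
Qed.

Lemma cmx_inj P n (v : 'M[K]_(r, n)) : valid P -> cmx P *m v = 0 -> v = 0.
Proof.
move=> vP v0; apply/matrixP => c k; have [i iE] := cmx_coord n c vP.
by rewrite -iE v0 !mxE.
Qed.

Lemma cmx_rank P : valid P -> \rank (cmx P) = r.
Proof.
by move=> vP; apply: rank_inj => v; apply: cmx_inj.
Qed.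

End Matrix.
End Configurations.

Section ConfigParam.
Variables (R : realType) (p q r : nat).
Local Notation C := (R[i])%C.

Lemma natr_eq1 (b : bool) : (b%:R == 1 :> C) = b.
Proof. by case: b; rewrite ?mulr1n ?mulr0n ?eqxx // eq_sym oner_eq0. Qed.

Lemma partial_perm_coded m (f : 'I_r -> nat) :
  (forall c c', (0 < f c)%N -> f c = f c' -> c = c') ->
  partial_perm_mx (\matrix_(i < m, c < r) (i.+1 == f c)%:R : 'M[C]_(m, r)).
Proof.
move=> f_inj; apply/and3P; split.
- by do 2!apply/forallP => ?; rewrite mxE; case: (_.+1 == _); rewrite ?mulr1n ?mulr0n eqxx ?orbT.
- apply/forallP => i; apply/card_le1_eqP => c c'; rewrite !inE !mxE !natr_eq1.
  by move=> /eqP e /eqP e'; apply: f_inj; rewrite -?e -?e'.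
- apply/forallP => c; apply/card_le1_eqP => i i'; rewrite !inE !mxE !natr_eq1.
  by move=> /eqP <- /eqP/succn_inj/ord_inj.
Qed.

Lemma cmx_is_param (P : config r) : valid p q P -> is_param (cmx p q C P).
Proof.
move=> vP; rewrite /is_param cmx_rank // eqxx andbT /cmx col_mxKu col_mxKd.
by rewrite !partial_perm_coded //; [apply: (valid_inj2 vP)|apply: (valid_inj1 vP)].
Qed.

Definition param_of (P : config r) (vP : valid p q P) : param R p q r :=
  exist _ (cmx p q C P) (cmx_is_param vP).

Lemma param_config (w : param R p q r) : exists2 P, valid p q P & val w = cmx p q C P.
Proof.
have /and3P[p1 p2 /eqP rw] := valP w; set M : 'M_(p + q, r) := val w in p1 p2 rw *.
have code m (A : 'M[C]_(m, r)) : partial_perm_mx A -> exists f : 'I_r -> nat,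
    [/\ forall c, (f c <= m)%N, forall c c', (0 < f c)%N -> f c = f c' -> c = c'
      & forall i c, A i c = (i.+1 == f c)%:R].
  move=> /and3P[/forallP A01 /forallP Ar /forallP Ac].
  exists (fun c => if [pick i | A i c == 1] is Some i then i.+1 else 0%N).
  have E i c : A i c = (i.+1 == (if [pick i | A i c == 1] is Some i then i.+1 else 0%N))%:R.
    case: pickP => [i' Ai'|A0]; last first.
      have /forallP/(_ c)/orP[/eqP -> // | ] := A01 i.
      by rewrite A0.
    case: (eqVneq i' i) Ai' => [->|ne] Ai'; first by rewrite (eqP Ai') eqxx.
    rewrite eqSS; have /negbTE -> : i != i' :> nat by rewrite eq_sym.
    have /forallP/(_ c)/orP[/eqP -> // | Ai] := A01 i.
    by have /card_le1_eqP/(_ i i' Ai Ai') e := Ac c; rewrite e eqxx in ne.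
  split=> // [c|c c']; first by case: pickP.
  case: pickP => // i /eqP Ai _; case: pickP => // i' /eqP Ai' [/ord_inj ii'].
  by have /card_le1_eqP := Ar i; apply; rewrite inE ?Ai // ii' Ai'.
have [f1 [f1m f1i E1]] := code _ _ p1; have [f2 [f2m f2i E2]] := code _ _ p2.
have EM : M = cmx p q C (fun c => (f1 c, f2 c)).
  rewrite -[M]vsubmxK; congr col_mx; apply/matrixP => i c; rewrite [RHS]mxE.
    exact: E1.
  exact: E2.
exists (fun c => (f1 c, f2 c)) => //; split=> //= c.
(* A column without any 1 would give a kernel vector of [M], against its rank. *)
rewrite !lt0n -negb_and; apply/negP => /andP[/eqP f10 /eqP f20].
have M0 : M *m delta_mx c 0 = (0 : 'cV_(p + q)).
  rewrite -colE; apply/colP => i; rewrite EM !mxE.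
  by case: (fintype.split i) => j; rewrite !mxE /= ?f10 ?f20.
have /colP/(_ c) := inj_rank rw M0.
by rewrite !mxE !eqxx => /eqP; rewrite oner_eq0.
Qed.

Lemma param_point_cmx (w : param R p q r) P : val w = cmx p q C P ->
  is_frame (wframe (cmx p q C P)) (param_point w).
Proof. by move=> <-; apply: param_point_frame. Qed.

End ConfigParam.

(** * The order by rank numbers and the elementary moves *)

Section ConfigurationOrder.
Variables (p q r : nat).
Implicit Types P Q : config r.

Lemma nat_min (A : nat -> Prop) : (exists n, A n) ->
  exists n, A n /\ forall m, (m < n)%N -> ~ A m.
Proof.
case=> n; elim/ltn_ind: n => n IH An.
have [[m [mn Am]]|no] := boolp.pselect (exists m, (m < n)%N /\ A m); first exact: IH Am.
by exists n; split=> // m mn Am; apply: no; exists m.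
Qed.

Lemma sum_bool_gt0 (I : finType) (b : pred I) :
  (0 < \sum_i b i)%N -> exists i, b i.
Proof.
case: (pickP b) => [i bi _|b0]; first by exists i.
by rewrite big1 // => i _; rewrite b0.
Qed.

Lemma sum_bool_le1 (I : finType) (b : pred I) :
  (forall i j, b i -> b j -> i = j) -> (\sum_i b i <= 1)%N.
Proof.
move=> b_inj; case: (pickP b) => [i bi|b0]; last by rewrite big1 // => i _; rewrite b0.
rewrite (bigD1 i) //= bi big1 // => j ji; case bj: (b j) => //.
by rewrite (b_inj j i) ?eqxx in ji.
Qed.

Lemma sum_bool_ge1 (I : finType) (b : pred I) i : b i -> (0 < \sum_i b i)%N.
Proof. by move=> bi; rewrite (bigD1 i) //= bi. Qed.

(* [srk P k.+1 l.+1] is the dimension of the intersection of [Im omega] with the sum of the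
   k-th and l-th members of the two standard flags, see [dim_rk_space]. *)
Definition srk P (k l : nat) : nat := \sum_c (((P c).1 < k) && ((P c).2 < l))%N.

Definition rect P (k1 k2 l1 l2 : nat) : nat :=
  \sum_c [&& k1 <= (P c).1, (P c).1 < k2, l1 <= (P c).2 & (P c).2 < l2]%N.

(** Inclusion-exclusion, kept additive to avoid truncated subtraction. The presence or absence of
    points in a rectangle is deduced from it. *)
Lemma rectE P k1 k2 l1 l2 : (k1 <= k2)%N -> (l1 <= l2)%N ->
  (srk P k2 l2 + srk P k1 l1 = srk P k1 l2 + srk P k2 l1 + rect P k1 k2 l1 l2)%N.
Proof.
move=> k12 l12; rewrite /srk /rect -!big_split; apply: eq_bigr => c _ /=; lia.
Qed.

(** The value 0 for [a] or [d] erases an entry, so it is always available; any other value must be a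
    free row. That the result is valid is asked for separately. *)
Inductive move P : config r -> Prop :=
| MoveSwap u v of ((P u).1 < (P v).1)%N & ((P v).2 < (P u).2)%N :
    move P (fun c => if c == u then ((P u).1, (P v).2)
                     else if c == v then ((P v).1, (P u).2) else P c)
| MovePlus v a of (a < (P v).1)%N & (forall c, (0 < a)%N -> (P c).1 <> a) :
    move P (fun c => if c == v then (a, (P v).2) else P c)
| MoveMinus u d of (d < (P u).2)%N & (forall c, (0 < d)%N -> (P c).2 <> d) :
    move P (fun c => if c == u then ((P u).1, d) else P c).

(** Argument of Bruhat type, with columns seen as points of the plane. Where the rank numbers first
    differ, [Q] has a point (a, l0) that [P] lacks. Let u be the lowest point of [P] above it at
    abscissa a, and v the leftmost point of [P] to the right of a with height at least l0 and below
    u. Exchanging the heights of u and v adds 1 to [srk] on a rectangle where [P] is strictly below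
    [Q]. If u or v is missing, the other one is moved to the abscissa a or to the height l0, which
    is then free. *)
Lemma move_exists P Q : valid p q P -> valid p q Q ->
  (forall k l, (k <= p.+1)%N -> (l <= q.+1)%N -> (srk P k l <= srk Q k l)%N) ->
  (exists k l, [/\ (k <= p.+1)%N, (l <= q.+1)%N & (srk P k l < srk Q k l)%N]) ->
  exists P', [/\ move P P', valid p q P',
    forall k l, (srk P k l <= srk P' k l)%N,
    forall k l, (k <= p.+1)%N -> (l <= q.+1)%N -> (srk P' k l <= srk Q k l)%N
  & exists k l, [/\ (k <= p.+1)%N, (l <= q.+1)%N & (srk P k l < srk P' k l)%N]].
Proof.
move=> vP vQ PQ [k1 [l1 [k1p l1q D1]]].
have srk0 X l : srk X 0 l = 0%N by rewrite /srk big1.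
have srk0' X k : srk X k 0 = 0%N by rewrite /srk big1 // => c _; rewrite andbF.
(* [srk] uses strict inequalities, so [a.+1] is the first index that sees points of abscissa [a].
   Minimality of [a], then of [l0], isolates the point (a, l0) of [Q]. *)
have [a [[lea [l2 [l2q D2]]] mina]] : exists a, ((a <= p)%N /\ exists l,
    (l <= q.+1)%N /\ (srk P a.+1 l < srk Q a.+1 l)%N) /\ forall m, (m < a)%N ->
    ~ ((m <= p)%N /\ exists l, (l <= q.+1)%N /\ (srk P m.+1 l < srk Q m.+1 l)%N).
  apply: nat_min; case: k1 k1p D1 => [|k1] k1p D1; first by rewrite !srk0 in D1.
  by exists k1; split=> //; exists l1.
have [l0 [[l0q D0] minl]] : exists l0, ((l0 <= q)%N /\
    (srk P a.+1 l0.+1 < srk Q a.+1 l0.+1)%N) /\ forall m, (m < l0)%N ->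
    ~ ((m <= q)%N /\ (srk P a.+1 m.+1 < srk Q a.+1 m.+1)%N).
  apply: nat_min; case: l2 l2q D2 => [|l2] l2q D2; first by rewrite !srk0' in D2.
  by exists l2.
have F1 l : (l <= q.+1)%N -> srk P a l = srk Q a l.
  move=> lq; case: a lea mina {D2 D0 minl} => [|a] lea mina; first by rewrite !srk0.
  have := PQ a.+1 l (leqW lea) lq; rewrite leq_eqVlt => /orP[/eqP //|lt].
  by case: (mina a (ltnSn a)); split; [apply: ltnW|exists l].
have F2 l : (l <= l0)%N -> srk P a.+1 l = srk Q a.+1 l.
  case: l => [|l] ll; first by rewrite !srk0'.
  have lq : (l < q.+1)%N by rewrite ltnS (leq_trans _ l0q) // ltnW.
  have := PQ a.+1 l.+1 lea lq; rewrite leq_eqVlt => /orP[/eqP //|lt].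
  by case: (minl l ll).
have F1a := F1 l0 (leqW l0q); have F1b := F1 l0.+1 l0q; have F2a := F2 l0 (leqnn l0).
have [cQ Qc] : exists c, Q c = (a, l0).
  have : (0 < rect Q a a.+1 l0 l0.+1)%N.
    have := rectE P (leqnSn a) (leqnSn l0); have := rectE Q (leqnSn a) (leqnSn l0).
    lia.
  case/sum_bool_gt0 => c cP; exists c; case: (Q c) cP => x y /= cP; congr (_, _); lia.
have al0 : (0 < a)%N || (0 < l0)%N by have := valid_neq0 vQ cQ; rewrite Qc.
(* For l0 > 0, validity allows [Q] a single point of height [l0], already used at abscissa [a]; the
   comparison of counts leaves none for [P] up to abscissa [a]. *)
have noP c : P c <> (a, l0) /\ ((0 < l0)%N -> ((P c).1 <= a)%N -> (P c).2 <> l0).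
  have H : (0 < l0)%N -> ((P c).1 <= a)%N -> (P c).2 <> l0.
    move=> l0_gt0 xa yl.
    have : (rect Q 0 a.+1 l0 l0.+1 <= 1)%N.
      apply: sum_bool_le1 => i j bi bj; apply: (valid_inj2 vQ); lia.
    have : (0 < rect P 0 a.+1 l0 l0.+1)%N by apply: (@sum_bool_ge1 _ _ c); lia.
    have := rectE P (leq0n a.+1) (leqnSn l0); have := rectE Q (leq0n a.+1) (leqnSn l0).
    by rewrite !srk0; lia.
  split=> // Pc; have [l0_gt0|] := posnP l0; last by move=> h; apply: (H h); rewrite Pc.
  have a0 : (0 < a)%N by move: al0; rewrite l0_gt0 orbF.
  have : (rect Q a a.+1 l0 l0.+1 <= 1)%N.
    apply: sum_bool_le1 => i j bi bj; apply: (valid_inj1 vQ); lia.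
  have : (0 < rect P a a.+1 l0 l0.+1)%N.
    by apply: (@sum_bool_ge1 _ _ c); rewrite Pc /=; lia.
  have := rectE P (leqnSn a) (leqnSn l0); have := rectE Q (leqnSn a) (leqnSn l0).
  lia.
have rowa : (0 < a)%N -> forall c, (P c).1 = a -> (l0 < (P c).2)%N.
  move=> a0 c xa; case: ltngtP => // [yl|yl]; last first.
    by case: (noP c).1; case: (P c) xa yl => x y /= -> ->.
  have : (rect Q a a.+1 0 l0.+1 <= 1)%N.
    apply: sum_bool_le1 => i j bi bj; apply: (valid_inj1 vQ); lia.
  have : (0 < rect Q a a.+1 l0 l0.+1)%N.
    by apply: (@sum_bool_ge1 _ _ cQ); rewrite Qc /=; lia.
  have : (0 < rect P a a.+1 0 l0)%N by apply: (@sum_bool_ge1 _ _ c); lia.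
  have := rectE P (leqnSn a) (leq0n l0); have := rectE Q (leqnSn a) (leq0n l0).
  have := rectE Q (leqnSn a) (leq0n l0.+1); have := rectE Q (leqnSn a) (leqnSn l0).
  by rewrite !srk0'; lia.
(* [b] and [c] close the rectangle; they are [q.+1] and [p.+1] when no point of [P] does *)
have [b [lt0b leb bP minb]] : exists b, [/\ (l0 < b)%N, (b <= q.+1)%N,
    b = q.+1 \/ (exists u, P u = (a, b)) & forall u, (P u).1 = a -> (l0 < (P u).2)%N ->
    (b <= (P u).2)%N].
  have [ex|no] := boolp.pselect (exists b u, P u = (a, b) /\ (l0 < b)%N); last first.
    exists q.+1; split=> //; first by left.
    by move=> u xa ltu; case: no; exists (P u).2, u; split=> //; rewrite -xa; case: (P u).
  have [b [[u [Pu ltb]] minb]] := nat_min ex.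
  exists b; split=> //; [|by right; exists u|].
    by have := valid_le2 vP u; rewrite Pu => /leqW.
  move=> u' xa ltu; rewrite leqNgt; apply/negP => /minb; case; exists u'.
  by rewrite -xa; case: (P u') ltu.
have [c [ltac lec cP minc]] : exists c, [/\ (a < c)%N, (c <= p.+1)%N,
    c = p.+1 \/ (exists v, [/\ (P v).1 = c, l0 <= (P v).2 & (P v).2 < b]%N)
  & forall v, (a < (P v).1)%N -> (l0 <= (P v).2)%N -> ((P v).2 < b)%N -> (c <= (P v).1)%N].
  have [ex|no] := boolp.pselect (exists c v, [/\ (P v).1 = c, a < c, l0 <= (P v).2 & (P v).2 < b]%N);
      last first.
    exists p.+1; split=> //; first by left.
    by move=> v h1 h2 h3; case: no; exists (P v).1, v.
  have [c [[v [Pv ltc h1 h2]] minc]] := nat_min ex.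
  exists c; split=> //; [|by right; exists v|].
    by have := valid_le1 vP v; rewrite Pv => /leqW.
  by move=> v' h1' h2' h3'; rewrite leqNgt; apply/negP => /minc; case; exists v'.
(* [P] has no point with abscissa in [a, k) and height in [l0, l), whereas [Q] has (a, l0) there;
   the other three corners compare in favour of [Q]. *)
have claim k l : (a < k)%N -> (k <= c)%N -> (l0 < l)%N -> (l <= b)%N ->
    (srk P k l < srk Q k l)%N.
  move=> ak kc ll lb.
  have TP : rect P a k l0 l = 0%N.
    apply/eqP; rewrite -leqn0 leqNgt; apply/negP => /sum_bool_gt0[u].
    case/and4P=> xa xk yl0 yl; case: (ltngtP a (P u).1) xa => // xa _.
      by have := minc u xa yl0 (leq_trans yl lb); lia.
    have := minb u (esym xa); case: (ltngtP l0 (P u).2) yl0 => // [_ _ /(_ isT)|yl' _ _].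
      by lia.
    by case: (noP u).1; case: (P u) xa yl' => x y /= -> ->.
  have TQ : (0 < rect Q a k l0 l)%N.
    by apply: (@sum_bool_ge1 _ _ cQ); rewrite Qc /=; lia.
  have := rectE P (ltnW ak) (ltnW ll); have := rectE Q (ltnW ak) (ltnW ll).
  have := PQ k l0 (leq_trans kc lec) (leqW l0q).
  by have := F1 l (leq_trans lb leb); lia.
(* [d] is the lower edge of the rectangle where the move raises [srk]. In the last two cases the
   rectangle is unbounded on a side where the indices stop at [b] or at [c] anyway. *)
have finish P' d : (forall k l, srk P' k l + 0 = srk P k l + ((a < k <= c) && (d < l <= b)))%N \/
     [/\ b = q.+1 & forall k l, srk P' k l = srk P k l + ((a < k <= c) && (d < l)) :> nat]%N \/
     [/\ c = p.+1 & forall k l, srk P' k l = srk P k l + ((a < k) && (d < l <= b)) :> nat]%N ->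
   (l0 <= d)%N -> (d < b)%N -> move P P' -> valid p q P' ->
   exists P', [/\ move P P', valid p q P',
    forall k l, (srk P k l <= srk P' k l)%N,
    forall k l, (k <= p.+1)%N -> (l <= q.+1)%N -> (srk P' k l <= srk Q k l)%N
  & exists k l, [/\ (k <= p.+1)%N, (l <= q.+1)%N & (srk P k l < srk P' k l)%N]].
  move=> H l0d db mP vP'; exists P'; split=> //.
  - by move=> k l; case: H => [/(_ k l)|[[_ /(_ k l)]|[_ /(_ k l)]]]; lia.
  - move=> k l kp lq.
    have := PQ k l kp lq.
    have [] := boolP ((a < k <= c) && (d < l <= b))%N => [/andP[/andP[h1 h2] /andP[h3 h4]]|h].
      have := claim k l h1 h2 (leq_ltn_trans l0d h3) h4.
      by case: H => [/(_ k l)|[[_ /(_ k l)]|[_ /(_ k l)]]]; lia.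
    by case: H => [/(_ k l)|[[eb /(_ k l)]|[ec /(_ k l)]]]; lia.
  - exists a.+1, d.+1; split; [lia|lia|].
    by case: H => [/(_ a.+1 d.+1)|[[_ /(_ a.+1 d.+1)]|[_ /(_ a.+1 d.+1)]]]; lia.
have sum1 P' v : (forall e, e != v -> P' e = P e) -> forall k l,
    (srk P' k l + (((P v).1 < k) && ((P v).2 < l)) =
     srk P k l + (((P' v).1 < k) && ((P' v).2 < l)))%N.
  move=> E k l; rewrite /srk (bigD1 v) //= [in RHS](bigD1 v) //=.
  rewrite (eq_bigr (fun e => (((P e).1 < k) && ((P e).2 < l))%N : nat)); first by lia.
  by move=> e ev; rewrite E.
case: cP => [ec|[v [xv yv0 yvb]]]; last first.
- have avc : (a < (P v).1)%N by rewrite xv.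
  case: bP => [eb|[u Pu]].
  + have freea e : (0 < a)%N -> (P e).1 <> a.
      move=> a0 xe; have := minb e xe (rowa a0 e xe); have := valid_le2 vP e; lia.
    pose P' := fun e => if e == v then (a, (P v).2) else P e.
    apply: (finish P' (P v).2) => //.
    * right; left; split=> // k l.
      have E e : e != v -> P' e = P e by rewrite /P' => /negbTE ->.
      by have := sum1 P' v E k l; rewrite {2 3}/P' eqxx /=; lia.
    * exact: MovePlus.
    * split=> [e|e|e|e e'|e e']; rewrite /P'.
      - by case: eqP => //= _; apply: (valid_le1 vP).
      - by case: eqP => //= _; apply: (valid_le2 vP).
      - by case: eqP => //= _; [lia|apply: valid_neq0 vP e].
      - case: eqP => [->|_]; case: eqP => [->|_] //=.
          by move=> a0 xe; case: (freea e' a0).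
          by move=> x0 xe; case: (freea e); rewrite -?xe.
          exact: (valid_inj1 vP).
      - by case: eqP => [->|_]; case: eqP => [->|_] //=; apply: (valid_inj2 vP).
  + have uv : u != v by apply/eqP => uv; rewrite uv in Pu; rewrite Pu /= ltnn in avc.
    have vu : (v == u) = false by rewrite eq_sym (negbTE uv).
    pose P' := fun e => if e == u then ((P u).1, (P v).2)
                     else if e == v then ((P v).1, (P u).2) else P e.
    apply: (finish P' (P v).2) => //.
    * left => k l; rewrite addn0 /srk.
      rewrite (bigD1 v) //= [in RHS](bigD1 v) //= (bigD1 u) //= [in RHS](bigD1 u) //=.
      rewrite (eq_bigr (fun e => (((P e).1 < k) && ((P e).2 < l))%N : nat)); last first.
        by move=> e /andP[ev eu]; rewrite /P' (negbTE ev) (negbTE eu).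
      by rewrite /P' eqxx vu eqxx Pu /= xv; lia.
    * by apply: MoveSwap; rewrite Pu.
    * have yu0 : (0 < b)%N by lia.
      split=> [e|e|e|e e'|e e']; rewrite /P' Pu.
      - by case: eqP => //= _; case: eqP => //= _; apply: (valid_le1 vP).
      - case: eqP => //= _; first exact: (valid_le2 vP).
        by case: eqP => //= _; [have := valid_le2 vP u; rewrite Pu|apply: (valid_le2 vP)].
      - case: eqP => //= _; first by lia.
        by case: eqP => //= _; [lia|apply: (valid_neq0 vP)].
      - have X e1 : (if e1 == u then (a, (P v).2) else if e1 == v then ((P v).1, b) else P e1).1
            = (P e1).1.
          by case: eqP => [->|_]; [rewrite Pu|case: eqP => [->|_]].
        by rewrite !X; apply: (valid_inj1 vP).
      - have inj := valid_inj2 vP; pose s := tperm u v.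
        have X e1 : (if e1 == u then (a, (P v).2) else if e1 == v then ((P v).1, b) else P e1).2
            = (P (s e1)).2.
          rewrite /s; case: tpermP => [->|->|/eqP/negbTE -> /eqP/negbTE ->] //.
            by rewrite eqxx.
          by rewrite vu eqxx Pu.
        by rewrite !X => y0 /(inj _ _ y0)/perm_inj.
- case: bP => [eb|[u Pu]].
    (* If both u and v were missing, the strict inequality would hold at the last corner, where both
       numbers are equal to r. *)
    have := claim p.+1 q.+1; rewrite ec eb; have full X : valid p q X -> srk X p.+1 q.+1 = r.
      move=> vX; rewrite /srk (eq_bigr (fun=> 1%N)) ?sum1_card ?card_ord // => e _.
      by rewrite !ltnS (valid_le1 vX) (valid_le2 vX).
    by rewrite !full // ltnn => H; suff : false by []; apply: H; lia.
  have freed e : (0 < l0)%N -> (P e).2 <> l0.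
    move=> l0_gt0 ye; have [xa|xa] := leqP (P e).1 a; first exact: (noP e).2 ye.
    by have := minc e xa; have := valid_le1 vP e; lia.
  pose P' := fun e => if e == u then ((P u).1, l0) else P e.
  apply: (finish P' l0) => //.
  * right; right; split=> // k l.
    have E e : e != u -> P' e = P e by rewrite /P' => /negbTE ->.
    by have := sum1 P' u E k l; rewrite {2 3}/P' eqxx Pu /=; lia.
  * by apply: MoveMinus; rewrite ?Pu.
  * split=> [e|e|e|e e'|e e']; rewrite /P'.
    - by case: eqP => //= _; apply: (valid_le1 vP).
    - by case: eqP => //= _; apply: valid_le2 vP e.
    - by case: eqP => //= _; [rewrite Pu|apply: valid_neq0 vP e].
    - by case: eqP => [->|_]; case: eqP => [->|_] //=; apply: (valid_inj1 vP).
    - case: eqP => [->|_]; case: eqP => [->|_] //=.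
        by move=> a0 xe; case: (freed e' a0).
        by move=> x0 xe; case: (freed e); rewrite -?xe.
        exact: (valid_inj2 vP).
Qed.

End ConfigurationOrder.

(** * Polynomial identities in one variable *)

Section PolynomialCurves.
Variable R : realType.
Local Notation C := (R[i])%C.

Lemma horner_eq0 (a : {poly C}) : (forall t, a.[t] = 0) -> a = 0.
Proof.
move=> a0; apply/eqP; apply: contraT => an0.
(* The integers below [size a] are too many roots for a nonzero [a]; they are distinct in
   characteristic 0. *)
have := @max_poly_roots _ a [seq i%:R | i <- iota 0 (size a)] an0.
rewrite size_map size_iota ltnn; apply.
  by apply/allP => x /mapP[i _ ->]; rewrite /root a0.
by rewrite map_inj_uniq ?iota_uniq // => i j /eqP; rewrite Num.Theory.eqr_nat => /eqP.
Qed.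

(** Plays the role of density of open sets: one nonzero value of [G] allows cancelling it
    everywhere. *)
Lemma upoly_mul_eq0 (F G : C -> C) t0 : upoly F -> upoly G -> G t0 != 0 ->
  (forall t, F t * G t = 0) -> forall t, F t = 0.
Proof.
move=> [a Fa] [b Gb] G0 FG t; have /eqP : a * b = 0.
  by apply: horner_eq0 => s; rewrite hornerM -Fa -Gb.
rewrite mulf_eq0 => /orP[/eqP a0|/eqP b0]; first by rewrite Fa a0 horner0.
by rewrite Gb b0 horner0 eqxx in G0.
Qed.

Lemma upoly_affine (a b : C) : upoly (fun t => a + t * b).
Proof.
exists (a%:P + b *: 'X) => t.
by rewrite hornerD hornerC hornerZ hornerX mulrC.
Qed.

End PolynomialCurves.

(** The columns of [b] and the standard basis span the same flag, so the inverse is again a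
    transition matrix between two bases adapted to one flag. *)
Lemma upper_inv (K : fieldType) m (b : 'M[K]_m) : upper b -> b \in unitmx -> upper (invmx b).
Proof.
move=> ub Ub; have [k|b' [ub' _ e]] := @span_first_trans K m m b 1%:M (mxrank1 _ _).
  by rewrite -[b]mul1mx span_first_upper ?mxrank1.
suff -> : invmx b = b' by [].
by rewrite -[LHS]mulmx1 e mulKmx.
Qed.

Lemma upper_diag (K : fieldType) m (b : 'M[K]_m) : upper b -> b \in unitmx -> forall i, b i i != 0.
Proof.
move=> ub; rewrite unitmxE -det_tr det_trig; last first.
  by apply/is_trig_mxP => i j ij; rewrite mxE ub.
by rewrite unitfE => /prodf_neq0 + i => /(_ i isT); rewrite mxE.
Qed.

(** * Polynomial curves realizing the moves *)

Section Degenerations.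
Variables (R : realType) (p q r : nat).
Local Notation C := (R[i])%C.
Local Notation frame := 'M[C]_(p + q, p + (q + r)).
Implicit Types P : config r.

Lemma curve_closure (x0 x : flagGr R p q r) (Phi0 Phi : frame) (g : C -> frame) :
  is_frame Phi0 x0 -> is_frame Phi x -> (forall i j, upoly (fun t => g t i j)) ->
  g 0 = Phi -> (forall t, t != 0 -> exists s b1 b2 z, [/\ gunit s, in_bor b1 b2,
    bdiag b1 b2 z \in unitmx & g t = blk s *m Phi0 *m bdiag b1 b2 z]) ->
  closure (Korbit x0) x.
Proof.
move=> P0 Px pg g0 gt; apply/(closure_KorbitP P0 Px) => F pF F0; rewrite -g0.
(* The factor [t] takes care of the value 0, the only parameter at which the curve may leave the
   orbit. *)
apply: (@upoly_mul_eq0 R (fun t => F (g t)) id 1) => [|||t].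
- exact: (mpolyf_comp upoly_funalg pF pg).
- exact: upolyX.
- exact: oner_neq0.
- have [->|/gt[s [b1 [b2 [z [Us bor Ub ->]]]]]] := eqVneq t 0; first by rewrite mulr0.
  by rewrite F0 ?mul0r.
Qed.

Definition colmx m (f : 'I_r -> 'cV[C]_m) : 'M[C]_(m, r) := \matrix_(i, c) f c i 0.

Lemma col_colmx m (f : 'I_r -> 'cV[C]_m) c : col c (colmx f) = f c.
Proof. by apply/colP => i; rewrite !mxE. Qed.

Lemma eq_col m n (A B : 'M[C]_(m, n)) : (forall c, col c A = col c B) -> A = B.
Proof.
by move=> AB; apply/matrixP => i c; have /colP/(_ i) := AB c; rewrite !mxE.
Qed.

Lemma col_mulmx m n k (A : 'M[C]_(m, n)) (B : 'M[C]_(n, k)) c : col c (A *m B) = A *m col c B.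
Proof. by rewrite !colE mulmxA. Qed.

Definition ebasis m (k : nat) : 'cV[C]_m := \col_i (i.+1 == k)%:R.

Definition ecol (xy : nat * nat) : 'cV[C]_(p + q) := col_mx (ebasis p xy.1) (ebasis q xy.2).

Lemma cmxE P : cmx p q C P = colmx (fun c => ecol (P c)).
Proof.
apply/matrixP => i c; rewrite !mxE.
by case: (fintype.split i) => j; rewrite !mxE.
Qed.

Lemma upoly_col (u v : 'cV[C]_(p + q)) i : upoly (fun t => (u + t *: v) i 0).
Proof. by apply: fa_ext (upoly_affine (u i 0) (v i 0)) _ => t; rewrite !mxE. Qed.

(** Only the basis of the subspace moves, with velocity [d]. Being triangular, [s] fixes the
    standard flags, so its effect on the first two blocks is undone by a change of frame; [y] is the
    change of basis of the subspace, invertible for reasons of rank. *)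
Lemma curve_closure_cmx (x0 x : flagGr R p q r) P P' (d : 'I_r -> 'cV[C]_(p + q)) :
  valid p q P -> is_frame (wframe (cmx p q C P)) x0 -> is_frame (wframe (cmx p q C P')) x ->
  (forall t, t != 0 -> exists s y, [/\ gunit s, in_bor s.1 s.2 & forall e,
     blk s *m ecol (P e) = colmx (fun e => ecol (P' e) + t *: d e) *m col e y]) ->
  closure (Korbit x0) x.
Proof.
move=> vP P0 Px gt; pose g t := colmx (fun e => ecol (P' e) + t *: d e).
have pg i j : upoly (fun t => g t i j).
  by apply: fa_ext (upoly_col (ecol (P' j)) (d j) i) _ => t; rewrite [RHS]mxE.
apply: (@curve_closure _ _ _ _ (fun t => wframe (g t)) P0 Px) => [i j||t /gt].
- rewrite /wframe /mkframe; case: (splitP j) => [j' ej|j' ej].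
    have -> : j = lshift _ j' by apply: val_inj.
    apply: (fa_ext (fa_const upoly_funalg ((col_mx 1%:M 0 : 'M[C]_(p + q, p)) i j'))).
    by move=> t; rewrite row_mxEl.
  have -> : j = rshift _ j' by apply: val_inj.
  case: (splitP j') => [j2 ej2|j2 ej2].
    have -> : j' = lshift _ j2 by apply: val_inj.
    apply: (fa_ext (fa_const upoly_funalg ((col_mx 0 1%:M : 'M[C]_(p + q, q)) i j2))).
    by move=> t; rewrite row_mxEr row_mxEl.
  have -> : j' = rshift _ j2 by apply: val_inj.
  by apply: fa_ext (pg i j2) _ => t; rewrite !row_mxEr.
- congr wframe; rewrite cmxE; apply: eq_col => e.
  by rewrite !col_colmx scale0r addr0.
case=> -[a b] [y [[Ua Ub] [ua ub] Ecol]].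
have E : blk (a, b) *m cmx p q C P = g t *m y.
  by apply: eq_col => e; rewrite !col_mulmx cmxE col_colmx Ecol.
have rE : \rank (blk (a, b) *m cmx p q C P) = r.
  by rewrite rank_unitmul ?cmx_rank // blk_unit Ua.
have Uy : y \in unitmx by rewrite E in rE; apply: unitmx_rankr rE.
exists (a, b), (invmx a), (invmx b), (invmx y); split=> //.
- by split; apply: upper_inv.
- by rewrite bdiag_unit !unitmx_inv; apply/and3P.
- rewrite /wframe blk_mkframe mkframe_bdiag /= !mulmx1 !mulmxV //.
  by rewrite E -mulmxA mulmxV // mulmx1.
Qed.

Lemma ebasisS m (i : 'I_m) : ebasis m i.+1 = delta_mx i 0.
Proof. by apply/colP => j; rewrite !mxE eqSS andbT. Qed.

Lemma ebasis0 m : ebasis m 0 = 0.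
Proof. by apply/colP => j; rewrite !mxE. Qed.

Definition rcol m (g : 'M[C]_m) (j0 : 'I_m) (w : 'cV[C]_m) : 'M[C]_m :=
  \matrix_(i, j) if j == j0 then w i 0 else g i j.

Lemma rcol_ebasis m g j0 w k : (k <= m)%N ->
  @rcol m g j0 w *m ebasis m k = if k == j0.+1 then w else g *m ebasis m k.
Proof.
case: k => [|k] km; first by rewrite ebasis0 !mulmx0.
rewrite (ebasisS (Ordinal km)) -!colE eqSS.
by apply/colP => i; rewrite !mxE -val_eqE /=; case: (k == j0); rewrite ?mxE.
Qed.

Lemma rcol_upper m (g : 'M[C]_m) (j0 : 'I_m) (w : 'cV[C]_m) : upper g ->
  (forall i : 'I_m, (j0 < i)%N -> w i 0 = 0) -> upper (rcol g j0 w).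
Proof.
by move=> ug w0 i j ji; rewrite mxE; case: eqP => [e|_]; [apply: w0; rewrite -e|apply: ug].
Qed.

Lemma rcol_unit m (g : 'M[C]_m) (j0 : 'I_m) (w : 'cV[C]_m) : upper g -> g \in unitmx ->
  (forall i : 'I_m, (j0 < i)%N -> w i 0 = 0) -> w j0 0 != 0 -> rcol g j0 w \in unitmx.
Proof.
move=> ug Ug w0 wj0; apply: upper_unit; first exact: rcol_upper.
by move=> i; rewrite mxE; case: (i =P j0) => [->|_] //; apply: upper_diag.
Qed.

(** Sends the basis vector numbered j + 1 to e_a + t e_(j+1) and fixes the others: a group element
    for t nonzero, the move itself at t = 0. For a = 0 the vector e_a is 0 and this is a
    rescaling. *)
Definition shiftmx m (j : 'I_m) (a : nat) (t : C) : 'M[C]_m :=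
  rcol 1%:M j (ebasis m a + t *: ebasis m j.+1).

Lemma shift_col0 m (j : 'I_m) a t : (a <= j)%N ->
  forall i : 'I_m, (j < i)%N -> (ebasis m a + t *: ebasis m j.+1) i 0 = 0.
Proof.
move=> aj i ji; rewrite !mxE; have -> : (i.+1 == a) = false by apply/eqP; lia.
by have -> : (i.+1 == j.+1) = false by [apply/eqP; lia]; rewrite mulr0 addr0.
Qed.

Lemma shiftmx_upper m (j : 'I_m) a t : (a <= j)%N -> upper (shiftmx j a t).
Proof. by move=> aj; apply: rcol_upper (@upper1 _ m) (shift_col0 t aj). Qed.

Lemma shiftmx_unit m (j : 'I_m) a t : (a <= j)%N -> t != 0 -> shiftmx j a t \in unitmx.
Proof.
move=> aj t0; apply: rcol_unit (@upper1 _ m) (unitmx1 _ _) (shift_col0 t aj) _.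
by rewrite !mxE eqxx mulr1 (_ : (j.+1 == a) = false) ?add0r //; apply/eqP; lia.
Qed.

Lemma shiftmx_ebasis m (j : 'I_m) a t k : (k <= m)%N ->
  @shiftmx m j a t *m ebasis m k =
  if k == j.+1 then ebasis m a + t *: ebasis m j.+1 else ebasis m k.
Proof. by move=> km; rewrite rcol_ebasis // mul1mx. Qed.

Lemma move_closure (x0 x : flagGr R p q r) P P' :
  move P P' -> valid p q P ->
  is_frame (wframe (cmx p q C P)) x0 -> is_frame (wframe (cmx p q C P')) x ->
  closure (Korbit x0) x.
Proof.
move=> mv vP P0; pose E1 k : 'cV[C]_(p + q) := col_mx (ebasis p k) 0.
pose E2 k : 'cV[C]_(p + q) := col_mx 0 (ebasis q k).
have ecE k l : ecol (k, l) = E1 k + E2 l by rewrite add_col_mx addr0 add0r.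
have scE1 t k : t *: E1 k = col_mx (t *: ebasis p k) 0 by rewrite scale_col_mx scaler0.
have scE2 t k : t *: E2 k = col_mx 0 (t *: ebasis q k) by rewrite scale_col_mx scaler0.
have blkE s k l : blk s *m ecol (k, l) = col_mx (s.1 *m ebasis p k) (s.2 *m ebasis q l).
  by rewrite mul_block_col !mul0mx addr0 add0r.
have ord_of m k : (0 < k <= m)%N -> exists i : 'I_m, k = i.+1.
  by case: k => // k km; exists (Ordinal km).
case: mv => [u v ac db|v a ac freea|u d db freed] Px.
- have uv : u != v by apply/eqP => uv; rewrite uv ltnn in ac.
  have [|c cE] := ord_of p (P v).1; first by rewrite (leq_ltn_trans _ ac) //= (valid_le1 vP).
  have [|b bE] := ord_of q (P u).2; first by rewrite (leq_ltn_trans _ db) //= (valid_le2 vP).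
  (* The group element sends column v to column u of the curve, and, thanks to the sign in - t,
     column u to column u minus t times column v of the curve. The matrix below records these
     coefficients. *)
  apply: (curve_closure_cmx (d := fun e => if e == u then E1 (P v).1 else 0) vP P0 Px) => t t0.
  exists (shiftmx c (P u).1 t, shiftmx b (P v).2 (- t)).
  exists (colmx (fun e => if e == u then delta_mx u 0 - t *: delta_mx v 0
                    else if e == v then delta_mx u 0 else delta_mx e 0)).
  rewrite cE in ac; rewrite bE in db; split=> [||e].
  + by split; apply: shiftmx_unit; rewrite ?oppr_eq0.
  + by split; apply: shiftmx_upper.
  set h := fun e => _; have fE k : colmx h *m delta_mx k 0 = h k by rewrite -colE col_colmx.
  rewrite [P e]surjective_pairing blkE /= !shiftmx_ebasis ?(valid_le1 vP) ?(valid_le2 vP) //.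
  rewrite col_colmx -cE -bE; rewrite -cE in ac; rewrite -bE in db.
  have [->|eu] := eqVneq e u.
    rewrite eqxx (_ : (P u).1 == _ = false); last by apply/eqP; lia.
    rewrite mulmxBr -scalemxAr !fE /h eqxx eq_sym (negbTE uv) eqxx.
    rewrite scaler0 addr0 !ecE scalerDr opprD !addrA scE1 scE2 /E1 /E2 scaleNr.
    by rewrite !opp_col_mx !add_col_mx !oppr0 !addr0 !add0r addrK.
  have [->|ev] := eqVneq e v.
    rewrite eqxx (_ : (P v).2 == _ = false); last by apply/eqP; lia.
    by rewrite fE /h eqxx ecE scE1 /E1 /E2 !add_col_mx !addr0 add0r.
  rewrite fE /h (negbTE eu) (negbTE ev) scaler0 addr0 [in RHS](surjective_pairing (P e)).
  case: eqP => [xe|_]; first by rewrite (valid_inj1 vP _ xe) ?xe ?eqxx // in ev; lia.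
  by case: eqP => [xe|_ //]; first by rewrite (valid_inj2 vP _ xe) ?xe ?eqxx // in eu; lia.
- have [|c cE] := ord_of p (P v).1; first by rewrite (leq_ltn_trans _ ac) //= (valid_le1 vP).
  apply: (curve_closure_cmx (d := fun e => if e == v then E1 (P v).1 else 0) vP P0 Px) => t t0.
  exists (shiftmx c a t, 1%:M), 1%:M; rewrite cE in ac; split=> [||e].
  + by split; [apply: shiftmx_unit|apply: unitmx1].
  + by split; [apply: shiftmx_upper|apply: upper1].
  rewrite -col_mulmx mulmx1 col_colmx [P e]surjective_pairing blkE /=.
  rewrite shiftmx_ebasis ?(valid_le1 vP) // mul1mx -cE.
  have [->|ev] := eqVneq e v.
    by rewrite eqxx ecE scE1 /E1 /E2 !add_col_mx !addr0 add0r.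
  rewrite scaler0 addr0 [in RHS](surjective_pairing (P e)).
  by case: eqP => [xe|_ //]; first by rewrite (valid_inj1 vP _ xe) ?xe ?eqxx // in ev; lia.
- have [|b bE] := ord_of q (P u).2; first by rewrite (leq_ltn_trans _ db) //= (valid_le2 vP).
  apply: (curve_closure_cmx (d := fun e => if e == u then E2 (P u).2 else 0) vP P0 Px) => t t0.
  exists (1%:M, shiftmx b d t), 1%:M; rewrite bE in db; split=> [||e].
  + by split; [apply: unitmx1|apply: shiftmx_unit].
  + by split; [apply: upper1|apply: shiftmx_upper].
  rewrite -col_mulmx mulmx1 col_colmx [P e]surjective_pairing blkE /=.
  rewrite shiftmx_ebasis ?(valid_le2 vP) // mul1mx -bE.
  have [->|eu] := eqVneq e u.
    by rewrite eqxx ecE scE2 /E1 /E2 !add_col_mx !addr0 !add0r.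
  rewrite scaler0 addr0 [in RHS](surjective_pairing (P e)).
  by case: eqP => [xe|_ //]; first by rewrite (valid_inj2 vP _ xe) ?xe ?eqxx // in eu; lia.
Qed.

End Degenerations.

(** * Echelon form under pairs of triangular matrices *)

Section NormalForm.
Variables (R : realType) (p q : nat).
Local Notation C := (R[i])%C.
Local Notation ebasis := (@ebasis R).

Definition cons_config s (xy : nat * nat) (P : config s) : config (1 + s) :=
  fun c => match fintype.split c with inl _ => xy | inr c' => P c' end.

Lemma cmx_cons s xy (P : config s) :
  cmx p q C (cons_config xy P) = row_mx (ecol R p q xy) (cmx p q C P).
Proof.
rewrite !cmxE; apply/matrixP => i c; rewrite !mxE /cons_config.
by case: (fintype.split c) => c'; rewrite ?(ord1 c') !mxE.
Qed.

Lemma cons_valid s xy (P : config s) : valid p q P -> (xy.1 <= p)%N -> (xy.2 <= q)%N ->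
  (0 < xy.1)%N || (0 < xy.2)%N ->
  (forall c, (0 < xy.1)%N -> (P c).1 <> xy.1) -> (forall c, (0 < xy.2)%N -> (P c).2 <> xy.2) ->
  valid p q (cons_config xy P).
Proof.
move=> [v1 v2 v0 i1 i2] xp yq n0 fx fy.
have inj (h : nat * nat -> nat) :
    (forall c c', (0 < h (P c))%N -> h (P c) = h (P c') -> c = c') ->
    (forall c, (0 < h xy)%N -> h (P c) <> h xy) -> forall c c', (0 < h (cons_config xy P c))%N ->
    h (cons_config xy P c) = h (cons_config xy P c') -> c = c'.
  move=> h_inj hP c c'; rewrite /cons_config.
  case E: (fintype.split c) => [i|i]; case E': (fintype.split c') => [i'|i'];
    rewrite -(splitK c) -(splitK c') E E'.
  - by rewrite !ord1.
  - by move=> h0 /esym/hP; case.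
  - by move=> h0 e; case: (hP i); rewrite -?e.
  - by move=> h0 /(h_inj _ _ h0) ->.
split=> [c|c|c||].
- by rewrite /cons_config; case: (fintype.split c).
- by rewrite /cons_config; case: (fintype.split c).
- by rewrite /cons_config; case: (fintype.split c).
- exact: (inj fst i1 fx).
- exact: (inj snd i2 fy).
Qed.

(** The rank factorization of the nonzero row supplies the column operations: multiplied by the
    inverse of [row_ebase], the row becomes a multiple of the first basis row. *)
Lemma pivot_row n s (N : 'M[C]_(n, 1 + s)) i : row i N != 0 ->
  exists z, [/\ z \in unitmx, (N *m z) i (lshift s 0) != 0
    & forall j, (N *m z) i (rshift 1 j) = 0].
Proof.
set u := row i N => u0; exists (invmx (row_ebase u)).
have rU : \rank u = 1%N.
  by apply/eqP; rewrite eqn_leq rank_leq_row lt0n mxrank_eq0.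
have E : u *m invmx (row_ebase u) = col_ebase u *m pid_mx 1.
  by rewrite -{1}(mulmx_ebase u) mulmxK ?row_ebase_unit // rU.
have Ni j : (N *m invmx (row_ebase u)) i j = (u *m invmx (row_ebase u)) 0 j.
  by move: (invmx _) => z; rewrite /u -row_mul [RHS]mxE.
have Ce : col_ebase u 0 0 != 0.
  have := col_ebase_unit u; rewrite unitmxE det_mx11 unitfE; apply.
split; first by rewrite unitmx_inv row_ebase_unit.
  by rewrite Ni E mxE big_ord1 mxE /= mulr1.
by move=> j; rewrite Ni E mxE big_ord1 mxE /= mulr0.
Qed.

Lemma max_support m (v : 'cV[C]_m) : v != 0 ->
  exists j, v j 0 != 0 /\ forall i : 'I_m, (j < i)%N -> v i 0 = 0.
Proof.
case/cV0Pn => j0 vj0; have [j vj maxj] := @arg_maxnP _ j0 (fun j => v j 0 != 0) val vj0.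
exists j; split=> // i ji; apply/eqP; apply: contraTT ji => vi.
by rewrite -leqNgt; apply: maxj.
Qed.

Lemma dsub_blk n (s : 'M[C]_p * 'M[C]_q) (X : 'M[C]_(p + q, n)) :
  dsubmx (blk s *m X) = s.2 *m dsubmx X.
Proof. by rewrite -{1}[X]vsubmxK mul_block_col !mul0mx add0r col_mxKd. Qed.

(** The inductive step in matrix form: [kappa] subtracts from the pivot column a combination of the
    columns already normalized, and [t'] may differ from [t] only off the vectors of [P]. *)
Lemma extend_column s (N : 'M[C]_(p + q, 1 + s)) z1 z' t t' (P : config s) xy kappa :
  z1 \in unitmx -> z' \in unitmx ->
  rsubmx (N *m z1) *m z' = blk t *m cmx p q C P ->
  (forall c, blk t' *m ecol R p q (P c) = blk t *m ecol R p q (P c)) ->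
  blk t' *m ecol R p q xy = lsubmx (N *m z1) - rsubmx (N *m z1) *m z' *m kappa ->
  exists2 z, z \in unitmx & N *m z = blk t' *m cmx p q C (cons_config xy P).
Proof.
move=> U1 U' E1 E2 E3; exists (z1 *m block_mx 1%:M 0 (- (z' *m kappa)) z').
  by rewrite unitmx_mul U1 unitmxE det_lblock det1 mul1r -unitmxE.
rewrite mulmxA -{1}[N *m z1]hsubmxK mul_row_block mulmx1 mulmx0 add0r mulmxN mulmxA.
rewrite -E3 cmx_cons mul_mx_row E1; congr row_mx.
by apply: eq_col => c; rewrite !col_mulmx cmxE col_colmx E2.
Qed.

Lemma rank_rsubmx s (N : 'M[C]_(p + q, 1 + s)) z : z \in unitmx -> \rank N = s.+1 ->
  \rank (rsubmx (N *m z)) = s.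
Proof.
move=> Uz rN; apply: rank_inj => v v0.
have : N *m (z *m col_mx 0 v) = 0.
  by rewrite mulmxA -[N *m z]hsubmxK mul_row_col mulmx0 add0r.
move/(inj_rank rN)/(congr1 (mulmx (invmx z))); rewrite mulKmx // mulmx0.
by move/(congr1 (@dsubmx _ 1 s 1)); rewrite col_mxKd linear0.
Qed.

Definition normalizable m s (N : 'M[C]_(p + q, s)) : Prop :=
  exists g h z (P : config s), [/\ upper g /\ g \in unitmx, upper h /\ h \in unitmx,
    z \in unitmx, valid p q P & [/\ forall c, (0 < (P c).1)%N -> (q + (P c).1 <= m)%N,
      forall c, ((P c).2 <= m)%N & N *m z = blk (g, h) *m cmx p q C P]].

Lemma normalizable0 m s (N : 'M[C]_(p + q, s)) : s = 0%N -> normalizable m N.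
Proof.
case: s N => // N _.
exists 1%:M, 1%:M, 1%:M, (fun=> (0%N, 0%N)); split.
- by split; [apply: upper1|apply: unitmx1].
- by split; [apply: upper1|apply: unitmx1].
- exact: unitmx1.
- by split=> -[].
- by split=> [[]|[]|] //; apply/matrixP => i [].
Qed.

(* Rows are added one at a time, the minus rows first: [m] bounds the rows already used. *)
Theorem normal_form m s (N : 'M[C]_(p + q, s)) : (m <= p + q)%N -> \rank N = s ->
  (forall (i : 'I_p) c, (m <= q + i)%N -> N (lshift q i) c = 0) ->
  (forall (j : 'I_q) c, (m <= j)%N -> N (rshift p j) c = 0) ->
  normalizable m N.
Proof.
elim: m s N => [|m IH] s N mpq rN N1 N2.
  have N0 : N = 0.
    apply/matrixP => i c; rewrite mxE -(splitK i).
    by case: (fintype.split i) => j; [apply: N1|apply: N2].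
  by apply: normalizable0; rewrite -rN N0 mxrank0.
case: s N rN N1 N2 => [|s] N rN N1 N2; first exact: normalizable0.
have weaken : (forall (i : 'I_p) c, (m <= q + i)%N -> N (lshift q i) c = 0) ->
    (forall (j : 'I_q) c, (m <= j)%N -> N (rshift p j) c = 0) -> normalizable m.+1 N.
  move=> N1' N2'; have [g [h [z [P [? ? ? ? [b1 b2 E]]]]]] := IH _ N (ltnW mpq) rN N1' N2'.
  exists g, h, z, P; split=> //; split=> // c; last by apply: leqW.
  by move=> x0; apply/leqW/b1.
have rowz (z : 'M_(s.+1)) i : (forall c, N i c = 0) -> forall c, (N *m z) i c = 0.
  by move=> Ni c; rewrite mxE big1 // => k _; rewrite Ni mul0r.
(* For a minus row, all plus rows are still zero: the new column is (0, m + 1) and the pivot column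
   needs no correction. *)
have [mq|qm] := ltnP m q.
  pose j0 := Ordinal mq.
  have [row0|rowN] := eqVneq (row (rshift p j0) N) 0.
    apply: weaken => [i c mi|j c]; first by apply: N1; lia.
    rewrite leq_eqVlt => /orP[/eqP mj|]; last exact: N2.
    have /rowP/(_ c) := row0; rewrite !mxE => <-; congr (N (rshift p _) c).
    exact: val_inj.
  have [z1 [Uz1 piv piv0]] := @pivot_row _ s N _ rowN.
  have [|||g [h [z' [P [[ug Ug] [uh Uh] Uz' vP [b1 b2 E]]]]]] :=
      IH s (rsubmx (N *m z1 : 'M_(_, 1 + s))) (ltnW mpq).
  - exact: rank_rsubmx.
  - by move=> i c mi; rewrite mxE; apply: rowz => c'; apply: N1; lia.
  - move=> j c; rewrite leq_eqVlt mxE => /orP[/eqP mj|mj].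
      by rewrite (_ : j = j0) ?piv0 //; apply: val_inj.
    by apply: rowz => c'; apply: N2.
  have x0 c : (P c).1 = 0%N by apply/eqP; rewrite -leqn0 leqNgt; apply/negP => /b1; lia.
  set w := dsubmx (lsubmx (N *m z1 : 'M_(_, 1 + s))).
  have wE : lsubmx (N *m z1 : 'M_(_, 1 + s)) = col_mx 0 w.
    rewrite -[LHS]vsubmxK; congr col_mx; apply/matrixP => i c.
    by rewrite [RHS]mxE 2!mxE; apply: rowz => c'; apply: N1; lia.
  have w0 (i : 'I_q) : (j0 < i)%N -> w i 0 = 0.
    by move=> ji; rewrite 2!mxE; apply: rowz => c'; apply: N2.
  have wj : w j0 0 != 0 by rewrite 2!mxE.
  have [z Uz Ez] : exists2 z, z \in unitmx & N *m z =
      blk (g, rcol h j0 w) *m cmx p q C (cons_config (0, m.+1)%N P).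
    apply: (extend_column (kappa := 0) Uz1 Uz' E) => [c|].
      rewrite /ecol /blk !mul_block_col !mul0mx !addr0 !add0r rcol_ebasis ?(valid_le2 vP) //=.
      by have -> : ((P c).2 == m.+1) = false by [have := b2 c; lia].
    rewrite mulmx0 subr0 wE /ecol /blk mul_block_col !mul0mx addr0 add0r /=.
    by rewrite rcol_ebasis // eqxx ebasis0 mulmx0.
  exists g, (rcol h j0 w), z, (cons_config (0, m.+1)%N P); split=> //.
  - by split; [apply: rcol_upper|apply: rcol_unit].
  - apply: cons_valid => //= c _; have := b2 c; lia.
  - split=> // c; rewrite /cons_config; case: (fintype.split (c : 'I_(1 + s))) => c' //=.
      by rewrite x0.
    exact: leqW.
have ip : (m - q < p)%N by lia.
pose i0 := Ordinal ip.
have [row0|rowN] := eqVneq (row (lshift q i0) N) 0.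
  apply: weaken => [i c mi|j c mj]; last by have := ltn_ord j; lia.
  have [mi'|mi'] := eqVneq (q + i)%N m; last by apply: N1; lia.
  have /rowP/(_ c) := row0; rewrite !mxE => <-; congr (N (lshift q _) c).
  by apply: val_inj => /=; lia.
have [z1 [Uz1 piv piv0]] := @pivot_row _ s N _ rowN.
have [|||g [h [z' [P [[ug Ug] [uh Uh] Uz' vP [b1 b2 E]]]]]] :=
    IH s (rsubmx (N *m z1 : 'M_(_, 1 + s))) (ltnW mpq).
- exact: rank_rsubmx.
- move=> i c mi; rewrite mxE; have [mi'|mi'] := eqVneq (q + i)%N m.
    by rewrite (_ : i = i0) ?piv0 //; apply: val_inj => /=; lia.
  by apply: rowz => c'; apply: N1; lia.
- by move=> j c mj; have := ltn_ord j; lia.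
have xi c : ((P c).1 <= i0)%N.
  by case: (posnP (P c).1) => [-> //|/b1]; rewrite /=; lia.
set w1 := lsubmx (N *m z1 : 'M_(_, 1 + s)); set N' := rsubmx _ in E.
(* The minus part of the pivot column, in the basis given by [h]. By subtracting normalized columns,
   [kappa] clears from it the rows used by [P]; these columns vanish in row [i0], so the pivot entry
   survives. *)
pose v := invmx h *m dsubmx w1.
pose kappa := (dsubmx (cmx p q C P))^T *m v.
pose v2 := v - dsubmx (cmx p q C P *m kappa).
pose w2 := w1 - N' *m z' *m kappa.
have kappaE c (j : 'I_q) : j.+1 = (P c).2 -> kappa c 0 = v j 0.
  move=> jc; rewrite !mxE (bigD1 j) //= big1 ?addr0 => [|k kj].
    by rewrite /cmx col_mxKd !mxE jc eqxx mul1r.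
  rewrite /cmx col_mxKd !mxE -jc eqSS -val_eqE /= in kj *.
  by rewrite (negbTE kj) mul0r.
have v20 c (j : 'I_q) : j.+1 = (P c).2 -> v2 j 0 = 0.
  move=> jc; rewrite /v2 mxE [X in _ + X]mxE [X in _ - X]mxE.
  by rewrite (cmx_mul_minus _ _ vP (esym jc)) (kappaE c j jc) subrr.
have w2E : dsubmx w2 = h *m v2.
  by rewrite /w2 linearB /= E -mulmxA dsub_blk /= mulmxBr mulKVmx.
have N'0 (i : 'I_p) : (i0 <= i)%N -> (N' *m z' *m kappa) (lshift q i) 0 = 0.
  rewrite leq_eqVlt -mulmxA mxE => /orP[/eqP i0i|i0i]; apply: big1 => k _.
    have <- : i0 = i by apply: val_inj.
    by rewrite mxE piv0 mul0r.
  rewrite mxE rowz ?mul0r // => c; apply: N1; move: i0i => /=; lia.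
have u20 (i : 'I_p) : (i0 < i)%N -> usubmx w2 i 0 = 0.
  move=> i0i; rewrite 2!mxE [X in _ + X]mxE N'0 ?(ltnW i0i) // oppr0 addr0 mxE.
  by rewrite rowz // => c; apply: N1; move: i0i => /=; lia.
have u2i : usubmx w2 i0 0 != 0.
  by rewrite 2!mxE [X in _ + X]mxE N'0 // oppr0 addr0 mxE.
(* What remains, [v2], lives in minus rows that [P] does not use. Its last nonzero row gives [y0],
   and the remainder becomes the corresponding column of [h], which stays triangular. If [v2] is 0,
   the new column has no minus entry. *)
have [h' [y0 [uh' Uh' y0q [h'y0 h'P Py0]]]] : exists h' y0, [/\ upper h', h' \in unitmx,
    (y0 <= q)%N & [/\ h' *m ebasis q y0 = dsubmx w2,
    forall c, h' *m ebasis q (P c).2 = h *m ebasis q (P c).2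
  & forall c, (0 < y0)%N -> (P c).2 <> y0]].
  have [v2z|v2n] := eqVneq v2 0.
    by exists h, 0%N; split=> //; rewrite w2E v2z ebasis0 mulmx0.
  have [j0 [vj0 maxj]] := max_support v2n.
  have noj c : (P c).2 <> j0.+1.
    by move=> e; move: vj0; rewrite (v20 c j0) ?eqxx.
  have w20 (i : 'I_q) : (j0 < i)%N -> dsubmx w2 i 0 = 0.
    move=> ji; rewrite w2E mxE big1 // => k _; have [kj|jk] := leqP k j0.
      by rewrite uh ?mul0r // (leq_ltn_trans kj).
    by rewrite maxj ?mulr0.
  have w2j : dsubmx w2 j0 0 != 0.
    rewrite w2E mxE (bigD1 j0) //= big1 ?addr0 => [|k kj].
      by rewrite mulf_neq0 // upper_diag.
    have [kj'|jk] := leqP j0 k; last by rewrite uh ?mul0r.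
    by rewrite maxj ?mulr0 // ltn_neqAle eq_sym kj' andbT.
  exists (rcol h j0 (dsubmx w2)), j0.+1; split=> //.
  - exact: rcol_upper.
  - exact: rcol_unit.
  - split=> // [|c]; first by rewrite rcol_ebasis // eqxx.
    by rewrite rcol_ebasis ?(valid_le2 vP) //; case: eqP => // /noj.
pose g' := rcol g i0 (usubmx w2).
have [z Uz Ez] : exists2 z, z \in unitmx & N *m z =
    blk (g', h') *m cmx p q C (cons_config (i0.+1, y0) P).
  apply: (extend_column (kappa := kappa) Uz1 Uz' E) => [c|].
    rewrite /ecol /blk !mul_block_col !mul0mx !addr0 !add0r /= h'P.
    rewrite rcol_ebasis ?(valid_le1 vP) //.
    by have -> : ((P c).1 == i0.+1) = false by [have := xi c; rewrite /=; lia].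
  rewrite /ecol /blk mul_block_col !mul0mx addr0 add0r /= h'y0.
  by rewrite rcol_ebasis // eqxx vsubmxK.
exists g', h', z, (cons_config (i0.+1, y0) P); split=> //.
- by split; [apply: rcol_upper|apply: rcol_unit].
- by apply: cons_valid => //= c _; have := xi c; rewrite /=; lia.
- split=> // c; rewrite /cons_config; case: (fintype.split (c : 'I_(1 + s))) => c' //=.
  + by lia.
  + by move/b1/leqW.
  + by lia.
  + exact: leqW.
Qed.

End NormalForm.

(** * A representative in every orbit *)

Section OrbitRepresentatives.
Variables (R : realType) (p q r : nat).
Local Notation C := (R[i])%C.

(** An adapted basis takes from each member of the flag a vector outside the previous member [F0 k],
    which is 0 at the start. *)
Lemma flag_frame m (U : {vspace 'cV[C]_(p + q)}) F : complete_flag U F ->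
  exists A : 'M[C]_(p + q, m), forall k : 'I_m, F k = span_first A k.
Proof.
case/andP=> /forallP dF /forallP mF.
pose F0 k := if k is k'.+1 then if insub k' is Some i then F (i : 'I_m) else 0%VS else 0%VS.
have dimF k : \dim (F k) = k.+1 by have /andP[_ /eqP] := dF k.
have F0S (k : 'I_m) : F0 k.+1 = F k by rewrite /F0 valK.
have dimF0 k : (k <= m)%N -> \dim (F0 k) = k.
  case: k => [|k] km; first by rewrite dimv0.
  by rewrite (F0S (Ordinal km)) dimF.
have F0F (k : 'I_m) : (F0 k <= F k)%VS.
  case: k => -[|k] km; first exact: sub0v.
  rewrite (F0S (Ordinal (ltnW km))).
  by have /forallP/(_ (Ordinal km))/implyP := mF (Ordinal (ltnW km)); apply; apply: leqnSn.
have /boolp.choice[v vP] : forall k : 'I_m, exists v, v \in F k /\ v \notin F0 k.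
  move=> k; have : ~~ (F k <= F0 k)%VS.
    by apply/negP => /dimvS; rewrite dimF dimF0 ?(ltnW (ltn_ord k)) // ltnn.
  by case/subvPn => v; exists v.
have FE k : F k = (F0 k + <[v k]>)%VS.
  have [vF vF0] := vP k; apply/eqP; rewrite eq_sym eqEdim; apply/andP; split.
    by rewrite subv_add F0F -memvE.
  rewrite dimF ltnNge; apply: contra vF0 => le_dim.
  have : (F0 k + <[v k]> <= F0 k)%VS.
    rewrite -(dimv_leqif_sup (addvSl _ _)) eqn_leq dimvS ?addvSl //=.
    by rewrite (dimF0 k (ltnW (ltn_ord k))).
  by rewrite subv_add => /andP[_]; rewrite -memvE.
exists (colmx v) => k.
have mono k1 k2 : (k1 <= k2)%N -> (span_first (colmx v) k1 <= span_first (colmx v) k2)%VS.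
  move=> k12; apply/subvP => u /mem_span_first[c c0 ->]; apply/mem_span_first.
  by exists c => // i ki; apply: c0; apply: leq_ltn_trans ki.
have vin (j : 'I_m) : v j \in span_first (colmx v) j.
  apply/mem_span_first; exists (delta_mx j 0); last by rewrite -colE col_colmx.
  by move=> i ji; rewrite mxE; case: eqP => // ij; rewrite ij ltnn in ji.
apply/eqP; rewrite eqEsubv; apply/andP; split; last first.
  apply/span_subvP => u /mapP[j]; rewrite mem_filter => /andP[jk _] ->.
  rewrite col_colmx; have /forallP/(_ k)/implyP/(_ jk)/subvP := mF j; apply.
  exact: (vP j).1.
case: k => k km; elim: k km => [|k IH] km; rewrite FE subv_add.
  by rewrite sub0v -memvE vin.
rewrite (F0S (Ordinal (ltnW km))) -memvE vin andbT.
by apply: subv_trans (IH _) (mono _ _ _).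
Qed.

Theorem exists_param (x : flagGr R p q r) : exists2 P : config r, valid p q P &
  forall x0, is_frame (wframe (cmx p q C P)) x0 -> Korbit x0 x.
Proof.
have /and3P[cA cB /eqP dM] := valP x.
have [A EA] := flag_frame cA; have [B EB] := flag_frame cB.
have [M EM] : exists M : 'M[C]_(p + q, r), grass x = im_mx M.
  have e : \dim (grass x) = r by [].
  exists (\matrix_(i < p + q, j < r) (vbasis (grass x))`_j i 0).
  apply/vspaceP => v; apply/idP/idP => [vW|/mem_im_mx[c ->]].
    rewrite (coord_vbasis vW); apply: rpred_sum => j _; apply: rpredZ.
    apply/mem_im_mx; exists (delta_mx (cast_ord e j) 0).
    by rewrite -colE; apply/colP => i; rewrite !mxE.
  rewrite mulmx_sum_col; apply: rpred_sum => j _; apply: rpredZ.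
  have -> : col j (\matrix_(i < p + q, j < r) (vbasis (grass x))`_j i 0) = (vbasis (grass x))`_j.
    by apply/colP => i; rewrite !mxE.
  by apply/vbasis_mem/mem_nth; rewrite size_tuple e.
have Px : is_frame (row_mx A (row_mx B M)) x.
  by split=> [k|k|]; rewrite ?row_mxKr ?row_mxKl.
have [A1 [B1 [M1 [/eq_row_mx[EA1 /eq_row_mx[EB1 EM1]] UA UB rM]]]] := is_frame_mkframe Px.
rewrite {}EA1 {}EB1 {A B EA EB EM} EM1 in Px *.
have Us : blk (A1, B1) \in unitmx by rewrite blk_unit UA.
(* The pair (A1, B1) makes both flags standard, so the echelon form is applied to the subspace
   carried back by its inverse; the triangular factors then only change the frame. *)
have rN : \rank (invmx (blk (A1, B1)) *m M1) = r.
  by rewrite rank_unitmul // unitmx_inv.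
have [||g [h [z [P [[ug Ug] [uh Uh] Uz vP [_ _ E]]]]]] := normal_form (leqnn _) rN.
- by move=> i c; have := ltn_ord i; lia.
- by move=> j c; have := ltn_ord j; lia.
exists P => // x0 P0; apply/(KorbitP x P0); exists (A1 *m g, B1 *m h).
  by split; rewrite unitmx_mul ?UA ?UB.
have -> : blk (A1 *m g, B1 *m h) *m wframe (cmx p q C P) =
    mkframe A1 B1 M1 *m bdiag g h z.
  rewrite blk_mkframe mkframe_bdiag /= !mulmx1; congr mkframe.
  have <- := blkM (A1, B1) (g, h); rewrite -mulmxA -E !mulmxA mulmxV // mul1mx.
  by [].
by apply: is_frameM => //; rewrite bdiag_unit Ug Uh.
Qed.

End OrbitRepresentatives.

(* The coercion from linear functions needs the type of a component of a family of them. *)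
Local Notation hap phi u := (phi u : 'Hom(_, _)).

(** * Linear maps depending on parameters *)

Section LinearLemmas.
Variable K : fieldType.

Lemma dim_le_inj (U W : vectType K) (f : U -> W) (A : {vspace U}) (B : {vspace W}) :
  linear f -> (forall u, u \in A -> f u \in B) -> (forall u, u \in A -> f u = 0 -> u = 0) ->
  (\dim A <= \dim B)%N.
Proof.
move=> f_lin fAB f_inj.
pose F := GRing.isLinear.Build K _ _ _ f f_lin.
pose f' : {linear U -> W} := HB.pack f F.
have ker0 : (A :&: lker (linfun f'))%VS = 0%VS.
  apply/eqP; rewrite -subv0; apply/subvP => u; rewrite memv_cap memv_ker lfunE memv0.
  by case/andP=> uA /eqP/(f_inj u uA) ->.
rewrite -(limg_dim_eq ker0); apply: dimvS; apply/subvP => w /memv_imgP[u uA ->].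
by rewrite lfunE; apply: fAB.
Qed.

Lemma affine_mpolyf m n (W : lmodType K) (F : 'M[K]_(m, n) -> W) (l : {linear W -> K^o}) :
  (forall a x y, F (a *: x + y) = a *: (F x - F 0) + F y) -> mpolyf (fun x => l (F x)).
Proof.
move=> aff; pose g x := l (F x - F 0) : K^o.
have g_lin : linear g by move=> a x y; rewrite /g aff -addrA linearP.
pose G := GRing.isLinear.Build K _ _ _ g g_lin.
pose g' : {linear 'M[K]_(m, n) -> K^o} := HB.pack g G.
apply: (@fa_ext _ _ (@mpolyf K m n) (fun x => g' x + l (F 0))).
  apply: (fa_add mpolyf_funalg); first exact: mpolyf_linear.
  exact: (fa_const mpolyf_funalg).
by move=> x; rewrite /g' /= /g linearB subrK.
Qed.

Lemma left_inverse_im m n (A : 'M[K]_(m, n)) B v : B *m A = 1%:M -> v \in im_mx A ->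
  A *m (B *m v) = v.
Proof. by move=> BA /mem_im_mx[c ->]; rewrite (mulmxA B) BA mul1mx. Qed.

(* A maximal minor of [T x0] that does not vanish bounds the rank of [T x] nearby. *)
Lemma rank_minor m n (U W : vectType K) (T : 'M[K]_(m, n) -> 'Hom(U, W)) x0 h :
  (forall u a x y, T (a *: x + y) u = a *: (T x u - T 0 u) + T y u) ->
  (\dim (lker (T x0)) < h)%N ->
  exists2 F, mpolyf F & F x0 != 0 /\ forall x, (h <= \dim (lker (T x)))%N -> F x = 0.
Proof.
move=> aff lth; set L := limg (T x0); pose b := vbasis L.
have /boolp.choice[u uP] : forall i : 'I_(\dim L), exists u, T x0 u = b`_i.
  move=> i; have : b`_i \in L by apply: mem_vbasis.
  by case/memv_imgP => u _ ->; exists u.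
exists (fun x => \det (\matrix_(i, j) coord b j (T x (u i)))).
  apply: (fa_det mpolyf_funalg) => i j.
  apply: (@fa_ext _ _ _ (fun x => coord b j (T x (u i)))); last by move=> x; rewrite mxE.
  by apply: (affine_mpolyf (F := fun x => T x (u i))) => a x y; apply: aff.
split.
  have -> : \matrix_(i, j) coord b j (T x0 (u i)) = 1%:M.
    by apply/matrixP => i j; rewrite !mxE uP coord_vbasis_nth eq_sym.
  by rewrite det1 oner_eq0.
move=> x lehx; pose X := [tuple T x (u i) | i < \dim L].
have nfX : ~~ free X.
  apply/negP => /eqnP; rewrite size_tuple => dX.
  have : (\dim L <= \dim (limg (T x)))%N.
    rewrite -dX; apply/dimvS/span_subvP => w /mapP[i _ ->].
    exact/memv_img/memvf.
  have := limg_ker_dim (T x) fullv; have := limg_ker_dim (T x0) fullv.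
  by rewrite !capfv -/L; lia.
have [c [c0 [i ci]]] : exists c : 'I_(\dim L) -> K, \sum_i c i *: T x (u i) = 0 /\
    exists i, c i != 0.
  apply: boolp.contrapT => no; move/negP: nfX; apply; apply/freeP => c c0 i.
  apply/eqP; apply: boolp.contrapT => /negP ci; apply: no; exists c; split; last by exists i.
  by rewrite -[RHS]c0; apply: eq_bigr => j _; rewrite -tnth_nth tnth_mktuple.
apply/eqP/det0P; exists (\row_i c i).
  by apply/rV0Pn; exists i; rewrite mxE.
apply/rowP => j; rewrite !mxE -[RHS](linear0 (coord b j)) -c0 linear_sum.
by apply: eq_bigr => k _; rewrite !mxE linearZ.
Qed.

End LinearLemmas.

(** * Semicontinuity of the dimension of Hom *)

Section HomSemicontinuity.
Variables (R : realType) (p q r : nat) (hp : (0 < p)%N) (hq : (0 < q)%N).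
Local Notation C := (R[i])%C.
Local Notation V := 'cV[C]_(p + q).
Local Notation frame := 'M[C]_(p + q, p + (q + r)).
Implicit Types (x y : flagGr R p q r) (Phi : frame).

Definition tdim (u : vertexJ p q) : nat :=
  match u with vC => r | vL k => k.+1 | vM k => k.+1 | vD => (p + q)%N end.

(** A basis of the space at each vertex, read off the frame. In these bases a morphism to the point
    becomes a family of maps to coordinate spaces that do not depend on the point. *)
Definition Jmx Phi (u : vertexJ p q) : 'M[C]_(p + q, tdim u) :=
  match u with
  | vC => rsubmx (rsubmx Phi)
  | vL k => \matrix_(i, j) lsubmx Phi i (widen_ord (ltn_ord k) j)
  | vM k => \matrix_(i, j) lsubmx (rsubmx Phi) i (widen_ord (ltn_ord k) j)
  | vD => 1%:M
  end.

Lemma im_first (K : fieldType) m n (A : 'M[K]_(m, n)) (k : 'I_n) :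
  im_mx (\matrix_(i < m, j < k.+1) A i (widen_ord (ltn_ord k) j)) = span_first A k.
Proof.
set B := \matrix_(i, j) _; have colB j : col j B = col (widen_ord (ltn_ord k) j) A.
  by apply/colP => i; rewrite !mxE.
apply/eqP; rewrite eqEsubv; apply/andP; split.
  apply/subvP => v /mem_im_mx[c ->]; rewrite mulmx_sum_col; apply: rpred_sum => j _.
  apply/rpredZ/memv_span; rewrite colB; apply: map_f.
  by rewrite mem_filter mem_enum /= -ltnS ltn_ord.
apply/span_subvP => v /mapP[j]; rewrite mem_filter => /andP[jk _] ->.
apply/mem_im_mx; exists (delta_mx (Ordinal (jk : j < k.+1)%N) 0); rewrite -colE colB.
by congr col; apply: val_inj.
Qed.

Lemma Jmx_space Phi x : is_frame Phi x ->
  forall u, im_mx (Jmx Phi u) = point_space x u /\ \rank (Jmx Phi u) = tdim u.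
Proof.
move=> Px; have [A [B [M [E UA UB rM]]]] := is_frame_mkframe Px.
have rk_im n (D : 'M[C]_(p + q, n)) : \dim (im_mx D) = n -> \rank D = n.
  move=> dD; apply/eqP; rewrite eqn_leq rank_leq_col /=.
  by apply: leq_trans (dim_im_mx_le D); rewrite dD.
have [xA xB xM] := Px.
have im u : im_mx (Jmx Phi u) = point_space x u.
  case: u => [|k|k|] /=.
  - by rewrite xM.
  - by rewrite xA im_first.
  - by rewrite xB im_first.
  - by apply/vspaceP => v; rewrite memvf; apply/mem_im_mx; exists v; rewrite mul1mx.
move=> u; split=> //; apply: rk_im; rewrite im.
have /and3P[/andP[/forallP cA _] /andP[/forallP cB _] /eqP cM] := valP x.
case: u => [|k|k|] /=.
- exact: cM.
- by have /andP[_ /eqP] := cA k.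
- by have /andP[_ /eqP] := cB k.
- by rewrite dimvf /dim /= muln1.
Qed.

(** Affine and not linear in the frame, because the space at [vD] keeps the constant basis 1. *)
Lemma Jmx_affine u a Phi Psi :
  Jmx (a *: Phi + Psi) u = a *: (Jmx Phi u - Jmx 0 u) + Jmx Psi u.
Proof.
by case: u => [|k|k|] /=; apply/matrixP => i j; rewrite !mxE ?oppr0 ?addr0 ?subrr ?mulr0 ?add0r.
Qed.

Lemma Jmx_blk s Phi u : u <> vD -> Jmx (blk s *m Phi) u = blk s *m Jmx Phi u.
Proof.
have sub m n (D : 'M[C]_(p + q, n)) (f : 'I_m -> 'I_n) (X Y : 'M[C]_(p + q, m)) :
    (forall i j, Y i j = (blk s *m D) i (f j)) -> (forall i j, X i j = D i (f j)) ->
    Y = blk s *m X.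
  move=> EY EX; apply/matrixP => i j; rewrite EY !mxE; apply: eq_bigr => l _.
  by rewrite EX.
case: u => [|k|k|] //= _.
- apply: (sub _ _ Phi (fun j => rshift p (rshift q j))) => i j; by rewrite mxE [LHS]mxE.
- by apply: (sub _ _ Phi (fun j => lshift _ (widen_ord (ltn_ord k) j))) => i j; rewrite mxE [LHS]mxE.
- by apply: (sub _ _ Phi (fun j => rshift p (lshift _ (widen_ord (ltn_ord k) j)))) => i j;
    rewrite mxE [LHS]mxE [LHS]mxE.
Qed.

Definition lmul m n (M : 'M[C]_(m, n)) : 'Hom('cV[C]_n, 'cV[C]_m) := linfun (mulmx M).

Variable X : rep C (quiverJ hp hq).

Definition pres_dom : vectType C := dprodv (fun u => 'Hom(X u, 'cV[C]_(tdim u)) : vectType C).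
Definition pres_cod : vectType C :=
  dprodv (fun a : arrowJ p q => 'Hom(X (srcJ hp hq a), V) : vectType C).

(** The commutation equations in coordinates. The kernel is a copy of Hom from [X] to the point, and
    its source and target are fixed spaces, so that minors can be compared for varying frames. *)
Definition pres_fun Phi (phi : pres_dom) : pres_cod :=
  [ffun a : arrowJ p q =>
    (lmul (Jmx Phi (tgtJ a)) \o (phi (tgtJ a) \o rmap X (a : qarr (quiverJ hp hq))))%VF -
    (lmul (Jmx Phi (srcJ hp hq a)) \o phi (srcJ hp hq a))%VF].

Lemma pres_funE Phi phi a v : (pres_fun Phi phi a : 'Hom(_, _)) v =
  Jmx Phi (tgtJ a) *m phi (tgtJ a) (rmap X (a : qarr (quiverJ hp hq)) v) -
  Jmx Phi (srcJ hp hq a) *m phi (srcJ hp hq a) v.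
Proof. by rewrite ffunE; do ![rewrite lfunE /=]. Qed.

Lemma dprodvE (I : finType) (W : I -> vectType C) c (f g : dprodv W) i :
  (c *: f + g) i = c *: f i + g i.
Proof. by rewrite [LHS]ffunE; congr (_ + _); rewrite [LHS]ffunE. Qed.

Lemma dprodv0E (I : finType) (W : I -> vectType C) i : (0 : dprodv W) i = 0.
Proof. by rewrite [LHS]ffunE. Qed.

Lemma dprodvBE (I : finType) (W : I -> vectType C) (f g : dprodv W) i :
  (f - g) i = f i - g i.
Proof. by rewrite [LHS]ffunE; congr (_ + _); rewrite [LHS]ffunE. Qed.

Lemma pres_linear Phi : linear (pres_fun Phi).
Proof.
move=> c f g; apply/ffunP => a; rewrite dprodvE; apply/lfunP => v.
rewrite add_lfunE scale_lfunE !pres_funE !dprodvE.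
do ![rewrite add_lfunE|rewrite scale_lfunE].
by rewrite !mulmxDr -!scalemxAr scalerBr opprD addrACA.
Qed.

HB.instance Definition _ Phi :=
  GRing.isLinear.Build C _ _ _ (pres_fun Phi) (@pres_linear Phi).

Definition pres Phi : 'Hom(pres_dom, pres_cod) := linfun (pres_fun Phi).

Lemma pres_ker Phi phi : phi \in lker (pres Phi) <-> forall a v,
  Jmx Phi (tgtJ a) *m phi (tgtJ a) (rmap X (a : qarr (quiverJ hp hq)) v) =
  Jmx Phi (srcJ hp hq a) *m phi (srcJ hp hq a) v.
Proof.
rewrite memv_ker lfunE /=; split=> [/eqP H a v|H].
  apply/eqP; rewrite -subr_eq0 -pres_funE H.
  by rewrite dprodv0E zero_lfunE.
apply/eqP/ffunP => a; apply/lfunP => v; rewrite pres_funE H subrr.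
by rewrite dprodv0E zero_lfunE.
Qed.

Lemma dprodv_hom_affine (I : finType) (U W : I -> vectType C)
    (f g h : dprodv (fun i => 'Hom(U i, W i) : vectType C)) c i v :
  ((c *: (f - g) + h) i : 'Hom(_, _)) v =
  c *: (hap f i v - hap g i v) + hap h i v.
Proof. by rewrite dprodvE dprodvBE add_lfunE scale_lfunE add_lfunE opp_lfunE. Qed.

Lemma pres_affine phi c Phi Psi :
  pres (c *: Phi + Psi) phi = c *: (pres Phi phi - pres 0 phi) + pres Psi phi.
Proof.
have presE Phi' : pres Phi' phi = pres_fun Phi' phi by apply: lfunE.
have eq_aff (W : lmodType C) (x y z x' y' z' : W) : x = x' -> y = y' -> z = z' ->
  c *: (x' - y') + z' = c *: (x - y) + z by move=> -> -> ->.
apply: (etrans (presE _)); apply: etrans (eq_aff _ _ _ _ _ _ _ (presE Phi) (presE 0) (presE Psi)).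
apply/ffunP => a; apply/lfunP => v.
apply: etrans (esym (dprodv_hom_affine (pres_fun Phi phi) (pres_fun 0 phi) (pres_fun Psi phi) c v)).
apply: (etrans (pres_funE _ phi v)).
apply: etrans (eq_aff _ _ _ _ _ _ _ (pres_funE Phi phi v) (pres_funE 0 phi v) (pres_funE Psi phi v)).
rewrite (Jmx_affine (tgtJ a) c Phi Psi) (Jmx_affine (srcJ hp hq a) c Phi Psi).
rewrite !mulmxDl -!scalemxAl !mulmxBl opprD addrACA -scalerBr; congr (c *: _ + _).
by rewrite !opprD !opprK addrACA.
Qed.

Lemma pres_dim_le Phi x : is_frame Phi x ->
  (\dim (lker (pres Phi)) <= \dim (rep_hom X (point_obj hp hq x)))%N.
Proof.
move=> Px; have JP := Jmx_space Px.
pose f (phi : pres_dom) : dprodv (fun u => 'Hom(X u, point_rep hp hq x u) : vectType C) :=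
  [ffun u : vertexJ p q => (linfun (vsproj (point_space x u)) \o (lmul (Jmx Phi u) \o phi u))%VF].
have fE phi u v : vsval ((f phi u : 'Hom(_, _)) v) = Jmx Phi u *m phi u v.
  rewrite ffunE; do ![rewrite lfunE /=]; rewrite vsprojK // -(JP u).1.
  by apply/mem_im_mx; exists (phi u v).
apply: (@dim_le_inj _ _ _ f).
- move=> c g h; apply/ffunP => u; rewrite dprodvE; apply/lfunP => v; apply: val_inj.
  rewrite add_lfunE scale_lfunE /= fE dprodvE.
  rewrite -[RHS]/(vsval (c *: (f g u : 'Hom(_, _)) v + (f h u : 'Hom(_, _)) v)).
  by rewrite linearP /= !fE add_lfunE scale_lfunE mulmxDr scalemxAr.
- move=> phi /pres_ker phiK; apply/rep_homP => a; apply/lfunP => v; apply: val_inj.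
  by rewrite !comp_lfunE /= (@point_repE _ _ _ _ hp hq x a) !fE phiK.
- move=> phi _ f0; apply/ffunP => u; rewrite dprodv0E; apply/lfunP => v; rewrite zero_lfunE.
  have [B BJ] := left_inverse (JP u).2.
  rewrite -[LHS]mul1mx -BJ -mulmxA -fE f0 dprodv0E zero_lfunE.
  by rewrite !linear0.
Qed.

(** Stated for a translate [y] of [x0], so that the constancy of Hom along the orbit needs no
    separate proof. *)
Lemma pres_dim_ge Phi s x0 y : is_frame Phi y -> blk s \in unitmx ->
  (forall u v, v \in point_space x0 u -> blk s *m v \in point_space y u) ->
  (\dim (rep_hom X (point_obj hp hq x0)) <= \dim (lker (pres Phi)))%N.
Proof.
move=> Py Us sxy; have JP := Jmx_space Py.
pose B u := sval (boolp.cid (left_inverse (JP u).2)).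
have BJ u : B u *m Jmx Phi u = 1%:M := svalP (boolp.cid (left_inverse (JP u).2)).
pose f (phi : dprodv (fun u => 'Hom(X u, point_rep hp hq x0 u) : vectType C)) : pres_dom :=
  [ffun u : vertexJ p q => (lmul (B u *m blk s) \o (linfun vsval \o phi u))%VF].
have fE phi u v : (f phi u : 'Hom(_, _)) v = B u *m (blk s *m vsval (hap phi u v)).
  by rewrite ffunE; do ![rewrite lfunE /=]; rewrite mulmxA.
have fJ phi u v : Jmx Phi u *m (f phi u : 'Hom(_, _)) v = blk s *m vsval (hap phi u v).
  rewrite fE left_inverse_im // (JP u).1; apply: sxy; exact: subvsP.
apply: (@dim_le_inj _ _ _ f).
- move=> c g h; apply/ffunP => u; rewrite dprodvE; apply/lfunP => v.
  rewrite add_lfunE scale_lfunE !fE dprodvE add_lfunE scale_lfunE.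
  by rewrite (linearP (@vsval _ _ _)) !mulmxDr -!scalemxAr.
- move=> phi /rep_homP phiH; apply/pres_ker => a v; rewrite !fJ; congr (_ *m _).
  have /lfunP/(_ v) := phiH a; rewrite !comp_lfunE => ->.
  exact: (@point_repE _ _ _ _ hp hq x0 a).
- move=> phi _ f0; apply/ffunP => u; rewrite dprodv0E; apply/lfunP => v; rewrite zero_lfunE.
  apply: val_inj; have := fJ phi u v; rewrite f0 dprodv0E zero_lfunE mulmx0 => /esym.
  move/(congr1 (mulmx (invmx (blk s)))); rewrite mulKmx // mulmx0 => e.
  by rewrite [LHS]e -[RHS]/(vsval 0) linear0.
Qed.

Theorem hom_semicontinuous x0 Phi0 x Phi : is_frame Phi0 x0 -> is_frame Phi x ->
  closure (Korbit x0) x ->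
  (\dim (rep_hom X (point_obj hp hq x0)) <= \dim (rep_hom X (point_obj hp hq x)))%N.
Proof.
move=> P0 Px /(closure_KorbitP P0 Px) clx; rewrite leqNgt; apply/negP => lt.
(* If Hom were smaller at [x], some minor would be nonzero there while vanishing on all frames of
   the orbit. *)
have [F pF [F0 HF]] := rank_minor pres_affine (leq_ltn_trans (pres_dim_le Px) lt).
case/negP: F0; apply/eqP; apply: clx => // s b1 b2 z Us bor Ub; apply: HF.
have [y _ Py] := is_frame_act P0 Us.
apply: (@pres_dim_ge _ s x0 y (is_frameM Py bor Ub)).
  by rewrite blk_unit; apply/andP.
move=> u v; rewrite -(Jmx_space P0 u).1 -(Jmx_space Py u).1 => /mem_im_mx[c ->].
apply/mem_im_mx; have [eu|/eqP nu] := eqVneq u vD; last by exists c; rewrite Jmx_blk ?mulmxA.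
by rewrite eu in c *; exists (blk s *m c); rewrite /= !mul1mx.
Qed.

End HomSemicontinuity.

(** * Indecomposability from scalar endomorphisms *)

Section IndecomposableCriterion.
Variables (p q : nat) (hp : (0 < p)%N) (hq : (0 < q)%N) (K : fieldType).
Implicit Types X Y Z : objJ hp hq K.

Lemma rep_zeroP (X : rep K (quiverJ hp hq)) : rep_zero X <-> forall u (v : X u), v = 0.
Proof.
split=> X0 u; last by apply/eqP; rewrite dimv_eq0 -subv0; apply/subvP => v _; rewrite (X0 u v) mem0v.
by move=> v; apply/eqP; rewrite -memv0; have /eqP := X0 u; rewrite dimv_eq0 => /eqP <-; apply: memvf.
Qed.

(* Indecomposability through idempotents: the projection onto a summand of [X] is scalar. *)
Lemma scalar_indecomposable X : ~ rep_zero X ->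
  (forall phi, phi \in rep_hom X X -> exists c, forall u v, hap phi u v = c *: v) ->
  indecomposableJ X.
Proof.
move=> nX scal; split=> // Y Z [phi /rep_homP phiH [psi /rep_homP psiH inv]].
have psi_phi u v : hap psi u (hap phi u v) = v.
  by have /lfunP/(_ v) := (inv u).1; rewrite comp_lfunE id_lfunE.
have phi_psi u v : hap phi u (hap psi u v) = v.
  by have /lfunP/(_ v) := (inv u).2; rewrite comp_lfunE id_lfunE.
pose pr u (v : rep_sum Y Z u) : rep_sum Y Z u := (v.1, 0).
have pr_lin u : linear (@pr u).
  by move=> a v w; rewrite /pr -[RHS]/(a *: v.1 + w.1, a *: 0 + 0) scaler0 addr0.
have [prL prLE] : exists prL : forall u, 'Hom(rep_sum Y Z u, rep_sum Y Z u),
    forall u v, prL u v = pr u v.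
  pose F u := GRing.isLinear.Build K _ _ _ (@pr u) (@pr_lin u).
  pose pr' u : {linear _ -> _} := HB.pack (@pr u) (F u).
  by exists (fun u => linfun (pr' u)) => u v; apply: (lfunE (pr' u)).
pose eps : dprodv (fun u => 'Hom(X u, X u) : vectType K) :=
  [ffun u : qvert (quiverJ hp hq) => (psi u \o (prL u \o phi u))%VF].
have epsE u v : hap eps u v = hap psi u (pr u (hap phi u v)).
  by rewrite ffunE !comp_lfunE prLE.
have [c cE] : exists c, forall u v, hap eps u v = c *: v.
  apply: scal; apply/rep_homP => a; apply/lfunP => v; rewrite !comp_lfunE !epsE.
  have /lfunP/(_ v) := phiH a; rewrite !comp_lfunE => ->.
  have /lfunP/(_ (pr _ (hap phi (qsrc a) v))) := psiH a; rewrite !comp_lfunE => <-.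
  congr (hap psi _ _); rewrite /pr.
  by case: (hap phi (qsrc a) v) => y z; rewrite !rep_sumE /= linear0.
have prE u v : pr u v = c *: v.
  by rewrite -[v in LHS](phi_psi u) -[LHS](phi_psi u) -epsE cE linearZ /= phi_psi.
have c01 : (c == 0) || (c == 1).
  have [u [v v0]] : exists u (v : X u), v <> 0.
    apply: boolp.contrapT => no; apply: nX; apply/rep_zeroP => u v.
    by apply: boolp.contrapT => v0; apply: no; exists u, v.
  (* The projection is idempotent, so c^2 = c; the value 0 forces [Y] to vanish, the value 1 forces
     [Z] to vanish. *)
  have := prE u (pr u (hap phi u v)).
  rewrite {1}/pr /= -/(pr u _) !prE scalerA => /(congr1 (hap psi u)).
  rewrite !linearZ /= psi_phi => /eqP; rewrite -subr_eq0 -scalerBl scaler_eq0.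
  move/eqP: v0 => /negbTE ->; rewrite orbF -{1}[c]mulr1 -mulrBr mulf_eq0.
  by rewrite [1 - c == 0]subr_eq0 [1 == c]eq_sym.
case/orP: c01 => /eqP c0; [left|right]; apply/rep_zeroP => u v.
  by have := prE u (v, 0); rewrite c0 scale0r => -[].
by have := prE u (0, v); rewrite c0 scale1r => -[].
Qed.

End IndecomposableCriterion.

(** * Representations given by subspaces of V *)

Section SubspaceRepresentations.
Variables (R : realType) (p q : nat) (hp : (0 < p)%N) (hq : (0 < q)%N).
Local Notation C := (R[i])%C.
Local Notation V := 'cV[C]_(p + q).
Local Notation Q := (quiverJ hp hq).
Implicit Types U : vertexJ p q -> {vspace V}.

(** [point_rep x] is the instance for [point_space x]; here the space at [vD] may be smaller than V,
    as the small objects require. *)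
Definition sub_rep U : rep C Q :=
  @Rep C Q (fun v => subvs_of (U v)) (fun a => linfun (vsproj (U (tgtJ a)) \o vsval)).

Definition sub_incl U : Prop := forall a, (U (srcJ hp hq a) <= U (tgtJ a))%VS.

Lemma sub_repE U a u : sub_incl U -> vsval (rmap (sub_rep U) a u) = vsval u.
Proof.
move=> inc; rewrite lfunE /= vsprojK //; apply: subvP (inc a) _ _; exact: subvsP.
Qed.

Lemma mem_limg_sub U a (y : subvs_of (U (tgtJ a))) : sub_incl U ->
  (y \in limg (rmap (sub_rep U) a)) = (vsval y \in U (srcJ hp hq a)).
Proof.
move=> inc; apply/memv_imgP/idP => [[u _ ->]|yP]; first by rewrite sub_repE // subvsP.
by exists (vsproj _ (vsval y)); rewrite ?memvf //; apply/val_inj;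
  rewrite /= sub_repE // vsprojK.
Qed.

Lemma sub_rep_in_J U : sub_incl U ->
  (U vD <= U (vL (ord_last hp)) + U (vM (ord_last hq)))%VS ->
  (U (vL (ord_last hp)) :&: U (vM (ord_last hq)))%VS = 0%VS -> in_J (sub_rep U).
Proof.
move=> inc sumU capU; split.
- move=> a; apply/eqP; rewrite -subv0; apply/subvP => u.
  rewrite memv_ker memv0 => /eqP u0; apply/eqP/val_inj.
  by rewrite /= -[LHS](sub_repE (a := a) _ inc) u0 !linear0.
- apply/vspaceP => y; rewrite memvf.
  have /memv_addP[v1 v1U [v2 v2U e]] := subvP sumU _ (subvsP y).
  have i1 := subvP (inc aalpha) _ v1U; have i2 := subvP (inc abeta) _ v2U.
  have -> : y = vsproj (U vD) v1 + vsproj (U vD) v2.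
    apply/val_inj; rewrite -[RHS]/(vsval (_ + _)) linearD /= !vsprojK //.
  apply: memv_add; first by rewrite (@mem_limg_sub U aalpha _ inc) /= vsprojK.
  by rewrite (@mem_limg_sub U abeta _ inc) /= vsprojK.
- apply/eqP; rewrite -subv0; apply/subvP => y; rewrite memv_cap.
  rewrite (@mem_limg_sub U aalpha _ inc) (@mem_limg_sub U abeta _ inc) /= -memv_cap capU.
  by rewrite !memv0 => /eqP y0; apply/eqP/val_inj; rewrite [LHS]y0 -[RHS]/(vsval 0) linear0.
Qed.

Section Hom.
Variables (U U' : vertexJ p q -> {vspace V}) (inc : sub_incl U) (inc' : sub_incl U').
Variable phi : dprodv (fun u => 'Hom(sub_rep U u, sub_rep U' u) : vectType C).
Hypothesis phiH : phi \in rep_hom (sub_rep U) (sub_rep U').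

Definition hom_top (v : V) : V := vsval (hap phi vD (vsproj (U vD) v)).

Lemma hom_top_linear : linear hom_top.
Proof. by move=> a v w; rewrite /hom_top !linearP. Qed.

HB.instance Definition _ := GRing.isLinear.Build C _ _ _ hom_top hom_top_linear.

Lemma hom_step a v : vsval (hap phi (srcJ hp hq a) v) =
  vsval (hap phi (tgtJ a) (vsproj (U (tgtJ a)) (vsval v))).
Proof.
have /rep_homP/(_ a)/lfunP/(_ v) := phiH; rewrite !comp_lfunE => /(congr1 vsval).
rewrite sub_repE // => <-; congr (vsval (hap phi _ _)).
by apply: val_inj; rewrite /= sub_repE // vsprojK //; apply: subvP (inc a) _ _; apply: subvsP.
Qed.

(** Every vertex reaches [vD] through inclusions, so a morphism is the restriction of its component
    at [vD]. The induction runs along each branch from its end. *)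
Lemma hom_topE u v : vsval (hap phi u v) = hom_top (vsval v).
Proof.
have via a : (forall w, vsval (hap phi (tgtJ a) w) = hom_top (vsval w)) ->
    forall w, vsval (hap phi (srcJ hp hq a) w) = hom_top (vsval w).
  move=> H w; rewrite hom_step H vsprojK //; apply: subvP (inc a) _ _; exact: subvsP.
have top w : vsval (hap phi vD w) = hom_top (vsval w).
  by rewrite /hom_top vsvalK.
have L d : forall k : 'I_p, (p - k < d)%N -> forall w,
    vsval (hap phi (vL k) w) = hom_top (vsval w).
  elim: d => // d IH k dk; have [kp|kp] := boolP (k < p.-1)%N.
    have -> : k = ord_here (Ordinal kp) by apply: val_inj.
    by apply: (via (aL (Ordinal kp))); apply: IH => /=; lia.
  have -> : k = ord_last hp.
    by apply: val_inj => /=; have := ltn_ord k; lia.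
  exact: (via aalpha).
have M d : forall k : 'I_q, (q - k < d)%N -> forall w,
    vsval (hap phi (vM k) w) = hom_top (vsval w).
  elim: d => // d IH k dk; have [kq|kq] := boolP (k < q.-1)%N.
    have -> : k = ord_here (Ordinal kq) by apply: val_inj.
    by apply: (via (aM (Ordinal kq))); apply: IH => /=; lia.
  have -> : k = ord_last hq.
    by apply: val_inj => /=; have := ltn_ord k; lia.
  exact: (via abeta).
case: u v => [|k|k|].
- exact: (via aC).
- exact: (L _ k (ltnSn _)).
- exact: (M _ k (ltnSn _)).
- exact: top.
Qed.

Lemma hom_top_in u v : v \in U u -> hom_top v \in U' u.
Proof. by move=> vU; rewrite -[v](vsprojK vU) -hom_topE subvsP. Qed.

End Hom.

Lemma restrict_hom U U' (Psi : 'M[C]_(p + q)) : sub_incl U -> sub_incl U' ->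
  (forall u v, v \in U u -> Psi *m v \in U' u) ->
  [ffun u : qvert Q => (linfun (vsproj (U' u)) \o (linfun (mulmx Psi) \o linfun vsval))%VF
    : 'Hom(sub_rep U u, sub_rep U' u)] \in rep_hom (sub_rep U) (sub_rep U').
Proof.
move=> inc inc' PU; set phi := [ffun u => _].
have phiE u v : vsval (hap phi u v) = Psi *m vsval v.
  rewrite ffunE; do ![rewrite lfunE /=]; rewrite vsprojK //; apply: PU; exact: subvsP.
apply/rep_homP => a; apply/lfunP => v; apply: val_inj; rewrite !comp_lfunE /=.
by rewrite sub_repE // !phiE sub_repE.
Qed.

End SubspaceRepresentations.

(** * Small indecomposable objects *)

Section ElementaryObjects.
Variables (R : realType) (p q : nat) (hp : (0 < p)%N) (hq : (0 < q)%N).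
Variables (k l : nat) (kp : (k <= p)%N) (lq : (l <= q)%N) (kl0 : (0 < k)%N || (0 < l)%N).
Local Notation C := (R[i])%C.
Local Notation V := 'cV[C]_(p + q).

Definition eplus : V := col_mx (ebasis R p k) 0.
Definition eminus : V := col_mx 0 (ebasis R q l).

(* The basis vectors are numbered from 1, and [k = 0] (or [l = 0]) makes [eplus] (or [eminus])
   vanish; [elem_space] is then a representation of smaller dimension. *)
Definition elem_space (u : vertexJ p q) : {vspace V} :=
  match u with
  | vC => <[eplus + eminus]>
  | vL i => if (k <= i.+1)%N then <[eplus]> else 0
  | vM j => if (l <= j.+1)%N then <[eminus]> else 0
  | vD => <[eplus]> + <[eminus]>
  end%VS.

Lemma elem_incl : sub_incl hp hq elem_space.
Proof.
case=> [|i||j|] /=.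
- by rewrite -memvE memv_add // memv_line.
- case: ifP => [ki|_]; last exact: sub0v.
  by rewrite (leqW ki).
- by case: ifP => _; [apply: addvSl|apply: sub0v].
- case: ifP => [ki|_]; last exact: sub0v.
  by rewrite (leqW ki).
- by case: ifP => _; [apply: addvSr|apply: sub0v].
Qed.

Lemma eplus_dsub : dsubmx eplus = 0. Proof. by rewrite col_mxKd. Qed.
Lemma eminus_usub : usubmx eminus = 0. Proof. by rewrite col_mxKu. Qed.

Lemma elem_in_J : in_J (sub_rep hp hq elem_space).
Proof.
apply: sub_rep_in_J elem_incl _ _ => /=; rewrite !prednK // kp lq ?subvv //.
apply/eqP; rewrite -subv0; apply/subvP => v; rewrite memv_cap => /andP[].
case/vlineP => a -> /vlineP[b] e; rewrite memv0 -[_ *: _]vsubmxK.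
have -> : usubmx (a *: eplus) = 0 by rewrite e linearZ /= eminus_usub scaler0.
by rewrite linearZ /= eplus_dsub scaler0 col_mx0.
Qed.

Definition elem_obj : objJ hp hq C := ObjJ elem_in_J.

Section Target.
Variables (U' : vertexJ p q -> {vspace V}) (inc' : sub_incl hp hq U').
Hypothesis UL : forall i : 'I_p, (U' (vL i) <= Vplus R p q)%VS.
Hypothesis UM : forall j : 'I_q, (U' (vM j) <= Vminus R p q)%VS.
Variable phi : dprodv (fun u => 'Hom(sub_rep hp hq elem_space u, sub_rep hp hq U' u) : vectType C).
Hypothesis phiH : phi \in rep_hom (sub_rep hp hq elem_space) (sub_rep hp hq U').

Lemma hom_eplus (i : 'I_p) : (k <= i.+1)%N -> hom_top phi eplus \in U' (vL i).
Proof. by move=> ki; apply: (hom_top_in elem_incl inc' phiH); rewrite /= ki memv_line. Qed.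

Lemma hom_eminus (j : 'I_q) : (l <= j.+1)%N -> hom_top phi eminus \in U' (vM j).
Proof. by move=> lj; apply: (hom_top_in elem_incl inc' phiH); rewrite /= lj memv_line. Qed.

Lemma hom_elem_split : usubmx (hom_top phi eminus) = 0 /\ dsubmx (hom_top phi eplus) = 0.
Proof.
have h1 := subvP (UL (ord_last hp)) _ (@hom_eplus (ord_last hp) _).
have h2 := subvP (UM (ord_last hq)) _ (@hom_eminus (ord_last hq) _).
split; apply/eqP.
  by rewrite -memVminus h2 //= prednK.
by rewrite -memVplus h1 //= prednK.
Qed.

(** The images of [eplus] and [eminus] lie in V^+ and V^-, so they are the two components of the
    image of their sum; together they determine the morphism. *)
Lemma hom_elem_inj : hom_top phi (eplus + eminus) = 0 -> phi = 0.
Proof.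
move=> e0; have [m0 p0] := hom_elem_split.
have e0' : hom_top phi eplus + hom_top phi eminus = 0 by rewrite -linearD.
have pz : hom_top phi eplus = 0.
  rewrite -[LHS]vsubmxK p0; have /(congr1 usubmx) := e0'.
  by rewrite linearD /= m0 addr0 linear0 => ->; rewrite col_mx0.
have mz : hom_top phi eminus = 0 by rewrite pz add0r in e0'.
have top0 v : v \in elem_space vD -> hom_top phi v = 0.
  case/memv_addP => v1 /vlineP[a ->] [v2 /vlineP[b ->] ->].
  by rewrite linearD !linearZ /= pz mz !scaler0 addr0.
apply/ffunP => u; rewrite dprodv0E; apply/lfunP => v; rewrite zero_lfunE; apply: val_inj.
rewrite -[RHS]/(vsval 0) linear0 -[LHS]/(vsval (hap phi u v)).
rewrite (hom_topE elem_incl inc' phiH); apply: top0.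
have toD w : vsval (w : subvs_of (elem_space u)) \in elem_space vD; last exact: toD.
have := subvsP w; move: (vsval w) => x {w}; case: u {v} => [|i|j|] //=.
- exact: (subvP (elem_incl aC)).
- by case: ifP => _; [apply: subvP (addvSl _ _) _|rewrite memv0 => /eqP ->; apply: mem0v].
- by case: ifP => _; [apply: subvP (addvSr _ _) _|rewrite memv0 => /eqP ->; apply: mem0v].
Qed.

End Target.

Lemma elem_neq0 : eplus + eminus != 0.
Proof.
apply/eqP => e0; have := congr1 usubmx e0; have := congr1 dsubmx e0.
rewrite !linearD /= /eplus /eminus !col_mxKu !col_mxKd !linear0 add0r addr0.
move=> eq0 ep0; case/orP: kl0 => [k0|l0].
  have kp' : (k.-1 < p)%N by lia.
  have /colP/(_ (Ordinal kp')) := ep0; rewrite !mxE /= prednK // eqxx => /eqP.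
  by rewrite oner_eq0.
have lq' : (l.-1 < q)%N by lia.
have /colP/(_ (Ordinal lq')) := eq0; rewrite !mxE /= prednK // eqxx => /eqP.
by rewrite oner_eq0.
Qed.

(** An endomorphism preserves the line at [vC], hence multiplies its generator by some c; minus c
    times the identity, it kills the generator and so is 0. *)
Lemma elem_indecomposable : indecomposableJ elem_obj.
Proof.
have gC : eplus + eminus \in elem_space vC by rewrite memv_line.
apply: scalar_indecomposable.
  move/rep_zeroP/(_ (vC : qvert (quiverJ hp hq)) (vsproj _ (eplus + eminus))) => g0.
  have := vsprojK gC; rewrite g0 linear0 => /esym/eqP.
  by rewrite (negbTE elem_neq0).
move=> phi phiH; have := hom_top_in elem_incl elem_incl phiH gC.
case/vlineP => c cE; exists c.
pose idh : dprodv (fun u => 'Hom(elem_obj u, elem_obj u) : vectType C) :=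
  [ffun u : qvert (quiverJ hp hq) => \1%VF].
have idH : idh \in rep_hom elem_obj elem_obj.
  by apply/rep_homP => a; apply/lfunP => v; rewrite !comp_lfunE !ffunE !id_lfunE.
have UL i : (elem_space (vL i) <= Vplus R p q)%VS.
  by rewrite /=; case: ifP => _; rewrite ?sub0v // -memvE memVplus eplus_dsub.
have UM j : (elem_space (vM j) <= Vminus R p q)%VS.
  by rewrite /=; case: ifP => _; rewrite ?sub0v // -memvE memVminus eminus_usub.
have : phi - c *: idh = 0.
  apply: (hom_elem_inj elem_incl UL UM); first by rewrite rpredB // rpredZ.
  rewrite /hom_top dprodvBE add_lfunE opp_lfunE linearB /= -/(hom_top phi _) cE.
  have -> : (c *: idh) vD = c *: idh vD by rewrite [LHS]ffunE.
  rewrite scale_lfunE ffunE id_lfunE linearZ /= vsprojK.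
    by rewrite scalerN subrr.
  exact: (subvP (elem_incl aC)).
move=> e u v; have -> : phi = c *: idh + 0 by rewrite -e addrC subrK.
by rewrite addr0 [in LHS]ffunE scale_lfunE ffunE id_lfunE.
Qed.

End ElementaryObjects.

(** * Rank numbers as dimensions of Hom *)

Section HomDimensions.
Variables (R : realType) (p q r : nat) (hp : (0 < p)%N) (hq : (0 < q)%N).
Local Notation C := (R[i])%C.
Local Notation V := 'cV[C]_(p + q).

Lemma dim_span_cols m n (A : 'M[C]_(m, n)) (S : pred 'I_n) : \rank A = n ->
  \dim <<[seq col j A | j : 'I_n <- enum 'I_n & S j]>> = #|S|.
Proof.
move=> rA; have frA : free [seq col j A | j <- enum 'I_n].
  pose X : n.-tuple 'cV[C]_m := [tuple col j A | j < n].
  have -> : [seq col j A | j <- enum 'I_n] = X by [].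
  apply/freeP => c c0 i.
  have E : A *m (\col_i c i) = 0.
    rewrite -c0 mulmx_sum_col; apply: eq_bigr => j _.
    by rewrite -tnth_nth tnth_mktuple mxE.
  by have /colP/(_ i) := inj_rank rA E; rewrite !mxE.
have sub : subseq [seq col j A | j : 'I_n <- enum 'I_n & S j] [seq col j A | j <- enum 'I_n].
  exact/map_subseq/filter_subseq.
have : free [seq col j A | j : 'I_n <- enum 'I_n & S j].
  by rewrite (subseq_uniqP (free_uniq frA) sub) filter_free.
by move/eqnP => ->; rewrite size_map enumT cardE.
Qed.

Lemma ebasis_norm m k : (0 < k <= m)%N -> (ebasis R m k)^T *m ebasis R m k = 1%:M.
Proof.
case: k => // k /= km; rewrite (ebasisS R (Ordinal km)) trmx_delta mul_delta_mx.
by apply/matrixP => i j; rewrite !ord1 !mxE.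
Qed.

Variables (P : config r) (vP : valid p q P) (k l : nat) (kp : (k <= p)%N) (lq : (l <= q)%N).

Definition rk_space : {vspace V} :=
  <<[seq col c (cmx p q C P) | c : 'I_r <- enum 'I_r &
     ((P c).1 < k.+1)%N && ((P c).2 < l.+1)%N]>>%VS.

Lemma dim_rk_space : \dim rk_space = srk P k.+1 l.+1.
Proof.
rewrite /rk_space dim_span_cols ?cmx_rank // -sum1_card /srk big_mkcond /=.
by apply: eq_bigr => c _; rewrite unfold_in; case: (_ && _).
Qed.

(** A vector of the image of omega has each of its coefficients as a coordinate, so bounding its
    support kills the coefficients of all columns outside the rectangle. *)
Lemma mem_rk_space v : v \in rk_space <-> [/\ v \in im_mx (cmx p q C P),
  forall i : 'I_p, (k <= i)%N -> usubmx v i 0 = 0 &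
  forall j : 'I_q, (l <= j)%N -> dsubmx v j 0 = 0].
Proof.
split=> [/mem_span_cols[y y0 ->]|[/mem_im_mx[y ->] v1 v2]].
  split; first by apply/mem_im_mx; exists y.
    move=> i ki; rewrite /cmx mul_col_mx col_mxKu mxE big1 // => c _; rewrite mxE.
    case: eqP => [e|_]; last by rewrite mul0r.
    by rewrite y0 ?mulr0 // -e ltnS ltnNge ki.
  move=> j lj; rewrite /cmx mul_col_mx col_mxKd mxE big1 // => c _; rewrite mxE.
  case: eqP => [e|_]; last by rewrite mul0r.
  by rewrite y0 ?mulr0 // -e andbC ltnS ltnNge lj.
apply/mem_span_cols; exists y => // c; rewrite negb_and -!leqNgt => /orP[kx|ly].
  have xp : ((P c).1.-1 < p)%N by have := valid_le1 vP c; lia.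
  rewrite -(@cmx_mul_plus _ _ _ _ _ _ y c (Ordinal xp) 0 vP); last by rewrite /= prednK //; lia.
  by have := v1 (Ordinal xp); rewrite mxE; apply => /=; lia.
have yq : ((P c).2.-1 < q)%N by have := valid_le2 vP c; lia.
rewrite -(@cmx_mul_minus _ _ _ _ _ _ y c (Ordinal yq) 0 vP); last by rewrite /= prednK //; lia.
by have := v2 (Ordinal yq); rewrite mxE; apply => /=; lia.
Qed.

Variables (x : flagGr R p q r) (Px : is_frame (wframe (cmx p q C P)) x).

Let xspace : [/\ forall i : 'I_p, flag_plus x i = span_first (basis_plus R p q) i,
  forall j : 'I_q, flag_minus x j = span_first (basis_minus R p q) j
  & grass x = im_mx (cmx p q C P)].
Proof. by have /(is_frame_mk x)[+ _] := erefl (wframe (cmx p q C P)); apply. Qed.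

Lemma mem_flag_plus (i : 'I_p) v : v \in flag_plus x i <->
  dsubmx v = 0 /\ forall i' : 'I_p, (i < i')%N -> usubmx v i' 0 = 0.
Proof.
have [-> _ _] := xspace; apply: iff_trans (mem_span_first _ _ _) _.
split=> [[c c0 ->]|[v2 v1]].
  by rewrite /basis_plus mul_col_mx mul1mx mul0mx col_mxKu col_mxKd.
exists (usubmx v) => //.
by rewrite /basis_plus mul_col_mx mul1mx mul0mx -{1}[v]vsubmxK v2.
Qed.

Lemma mem_flag_minus (j : 'I_q) v : v \in flag_minus x j <->
  usubmx v = 0 /\ forall j' : 'I_q, (j < j')%N -> dsubmx v j' 0 = 0.
Proof.
have [_ -> _] := xspace; apply: iff_trans (mem_span_first _ _ _) _.
split=> [[c c0 ->]|[v2 v1]].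
  by rewrite /basis_minus mul_col_mx mul1mx mul0mx col_mxKu col_mxKd.
exists (dsubmx v) => //.
by rewrite /basis_minus mul_col_mx mul1mx mul0mx -{1}[v]vsubmxK v2.
Qed.

Local Notation ep := (eplus R p q k).
Local Notation em := (eminus R p q l).
Local Notation I := (elem_obj R hp hq kp lq).

(** Evaluation at [eplus + eminus] is injective; the value lies in the Grassmannian member, and its
    two components in the members of dimensions k and l of the flags. *)
Lemma dim_hom_elem_le :
  (\dim (rep_hom I (point_obj hp hq x)) <= srk P k.+1 l.+1)%N.
Proof.
have inc := @elem_incl R p q hp hq k l; have inc' := @point_incl R p q r hp hq x.
have UL i : (point_space x (vL i) <= Vplus R p q)%VS.
  by apply/subvP => v /mem_flag_plus[v0 _]; rewrite memVplus v0.
have UM j : (point_space x (vM j) <= Vminus R p q)%VS.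
  by apply/subvP => v /mem_flag_minus[v0 _]; rewrite memVminus v0.
rewrite -dim_rk_space; apply: (@dim_le_inj _ _ _ (fun phi => hom_top phi (ep + em))).
- by move=> a phi psi; rewrite /hom_top dprodvE add_lfunE scale_lfunE linearP.
- move=> phi phiH; have [m0 p0] := hom_elem_split kp lq inc' UL UM phiH.
  apply/mem_rk_space; split.
  + have [_ _ <-] := xspace; apply: (hom_top_in inc inc' phiH (u := vC)).
    exact: memv_line.
  + move=> i ki; rewrite !linearD /= m0 addr0; case: (posnP k) => [k0|k_gt0].
      have -> : ep = 0 by rewrite /eplus k0 ebasis0 col_mx0.
      by rewrite !linear0 mxE.
    have kp' : (k.-1 < p)%N by lia.
    have [|_ H] := (mem_flag_plus (Ordinal kp') _).1 (hom_eplus inc' phiH (i := Ordinal kp') _).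
      by rewrite /= prednK.
    by apply: H => /=; lia.
  + move=> j lj; rewrite !linearD /= p0 add0r; case: (posnP l) => [l0|l_gt0].
      have -> : em = 0 by rewrite /eminus l0 ebasis0 col_mx0.
      by rewrite !linear0 mxE.
    have lq' : (l.-1 < q)%N by lia.
    have [|_ H] := (mem_flag_minus (Ordinal lq') _).1 (hom_eminus inc' phiH (j := Ordinal lq') _).
      by rewrite /= prednK.
    by apply: H => /=; lia.
- by move=> phi phiH; apply: (hom_elem_inj kp lq inc' UL UM phiH).
Qed.

Lemma dim_hom_elem_ge :
  (srk P k.+1 l.+1 <= \dim (rep_hom I (point_obj hp hq x)))%N.
Proof.
have inc := @elem_incl R p q hp hq k l; have inc' := @point_incl R p q r hp hq x.
(* The inverse of evaluation: w_+ ep^T + w_- em^T sends [ep] and [em] to the two components of w.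
   The vectors are orthonormal unless k or l is 0, in which case the corresponding component of w is
   0 too. *)
pose Psi (w : V) := blk (1%:M, 0) *m w *m ep^T + blk (0, 1%:M) *m w *m em^T.
have b1 w : blk (1%:M, 0) *m w = col_mx (usubmx w) 0 :> V.
  by rewrite -[w in LHS]vsubmxK mul_block_col !mul0mx mul1mx !addr0.
have b2 w : blk (0, 1%:M) *m w = col_mx 0 (dsubmx w) :> V.
  by rewrite -[w in LHS]vsubmxK mul_block_col !mul0mx mul1mx !add0r.
have Psi_lin a v w : Psi (a *: v + w) = a *: Psi v + Psi w.
  by rewrite /Psi !mulmxDr !mulmxDl -!scalemxAr -!scalemxAl scalerDr addrACA.
have ep_em : ep^T *m em = 0.
  by rewrite /eplus /eminus tr_col_mx mul_row_col mulmx0 trmx0 mul0mx addr0.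
have em_ep : em^T *m ep = 0.
  by rewrite /eplus /eminus tr_col_mx mul_row_col mulmx0 trmx0 mul0mx addr0.
have ep0 w : w \in rk_space -> Psi w *m ep = col_mx (usubmx w) 0.
  case/mem_rk_space => _ w1 _; rewrite /Psi b1 b2 mulmxDl -!mulmxA em_ep mulmx0 addr0.
  rewrite /eplus tr_col_mx mul_row_col mulmx0 addr0; case: (posnP k) => [k0|k_gt0].
    have -> : usubmx w = 0 by apply/colP => i; rewrite w1 ?k0 // mxE.
    by rewrite col_mx0 mul0mx.
  by rewrite ebasis_norm ?k_gt0 // mulmx1.
have em0 w : w \in rk_space -> Psi w *m em = col_mx 0 (dsubmx w).
  case/mem_rk_space => _ _ w2; rewrite /Psi b1 b2 mulmxDl -!mulmxA ep_em mulmx0 add0r.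
  rewrite /eminus tr_col_mx mul_row_col mulmx0 add0r; case: (posnP l) => [l0|l_gt0].
    have -> : dsubmx w = 0 by apply/colP => i; rewrite w2 ?l0 // mxE.
    by rewrite col_mx0 mul0mx.
  by rewrite ebasis_norm ?l_gt0 // mulmx1.
rewrite -dim_rk_space.
pose f w : dprodv (fun u => 'Hom(I u, point_obj hp hq x u) : vectType C) :=
 [ffun u : qvert (quiverJ hp hq) => (linfun (vsproj (point_space x u)) \o
   (linfun (mulmx (Psi w)) \o linfun vsval))%VF
   : 'Hom(sub_rep hp hq (elem_space R k l) u, point_rep hp hq x u)].
have fE w u v : (f w u : 'Hom(_, _)) v = vsproj (point_space x u) (Psi w *m vsval v).
  by rewrite ffunE; do ![rewrite lfunE /=].
have PsiU w u v : w \in rk_space -> v \in elem_space R k l u -> Psi w *m v \in point_space x u.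
  move=> wS; have [wW w1 w2] := (mem_rk_space w).1 wS.
  case: u => [|i|j|] /=.
  - case/vlineP => a ->; rewrite -scalemxAr memvZ // mulmxDr ep0 // em0 //.
    by rewrite add_col_mx addr0 add0r vsubmxK; have [_ _ ->] := xspace.
  - case: ifP => [ki /vlineP[a ->]|_]; last by rewrite memv0 => /eqP ->; rewrite mulmx0 mem0v.
    rewrite -scalemxAr memvZ // ep0 //; apply/mem_flag_plus; rewrite col_mxKu col_mxKd.
    by split=> // i' ii'; apply: w1; lia.
  - case: ifP => [ki /vlineP[a ->]|_]; last by rewrite memv0 => /eqP ->; rewrite mulmx0 mem0v.
    rewrite -scalemxAr memvZ // em0 //; apply/mem_flag_minus; rewrite col_mxKu col_mxKd.
    by split=> // i' ii'; apply: w2; lia.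
  - by move=> _; apply: memvf.
apply: (@dim_le_inj _ _ _ f).
- move=> a v w; apply/ffunP => u; rewrite dprodvE; apply/lfunP => y.
  rewrite add_lfunE scale_lfunE [LHS]fE [X in _ = _ *: X + _]fE [X in _ = _ + X]fE.
  rewrite Psi_lin mulmxDl -scalemxAl.
  exact: (linearP (vsproj (point_space x u))).
- by move=> w wS; apply: (restrict_hom inc inc') => u v; apply: PsiU.
- move=> w wS f0; have gD := subvP (inc aC) _ (memv_line (ep + em)).
  have := fE w vD (vsproj _ (ep + em)); rewrite f0 dprodv0E zero_lfunE vsprojK //.
  rewrite mulmxDr ep0 // em0 // add_col_mx addr0 add0r vsubmxK => /(congr1 vsval).
  by rewrite vsprojK ?memvf // linear0.
Qed.

Theorem dim_hom_elem : \dim (rep_hom I (point_obj hp hq x)) = srk P k.+1 l.+1.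
Proof. by apply/eqP; rewrite eqn_leq dim_hom_elem_le dim_hom_elem_ge. Qed.

End HomDimensions.

(** * Closure order and classification of the orbits *)

Section OrbitClosures.
Variables (R : realType) (p q r : nat) (hp : (0 < p)%N) (hq : (0 < q)%N).
Local Notation C := (R[i])%C.
Implicit Types (P Q : config r) (w : param R p q r).

(** Applied to unit squares, inclusion-exclusion counts the columns of each type, so the two lists
    of columns agree up to order. *)
Lemma srk_eq_perm P Q : valid p q P -> valid p q Q ->
  (forall k l, (k <= p.+1)%N -> (l <= q.+1)%N -> srk P k l = srk Q k l) ->
  exists s : 'S_r, forall c, P c = Q (s c).
Proof.
move=> vP vQ PQ; pose t X : r.-tuple (nat * nat) := [tuple X c | c < r].
have cnt X a b : count_mem (a, b) (t X) = rect X a a.+1 b b.+1.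
  rewrite /t /= count_map -sum1_count big_mkcond enumT -[LHS]/(\sum_c _)%N.
  apply: eq_bigr => c _ /=; case: (X c) => x y /=; rewrite xpair_eqE.
  have <- : (x == a) && (y == b) = [&& a <= x, x < a.+1, b <= y & y < b.+1]%N by lia.
  by case: (_ && _).
have /tuple_permP[s sE] : perm_eq (t P) (t Q).
  apply/allP => -[a b] /=; rewrite mem_cat => ab; rewrite !cnt; apply/eqP.
  have [ap bq] : (a <= p)%N /\ (b <= q)%N.
    case/orP: ab => /mapP[c _ e].
      by have := valid_le1 vP c; have := valid_le2 vP c; rewrite -e.
    by have := valid_le1 vQ c; have := valid_le2 vQ c; rewrite -e.
  have := rectE P (leqnSn a) (leqnSn b); have := rectE Q (leqnSn a) (leqnSn b).
  by rewrite !PQ //; lia.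
exists s => c; have := congr1 (fun t' => nth (0, 0)%N t' c) sE.
rewrite -!tnth_nth => e.
by rewrite -[LHS](tnth_mktuple P) e !tnth_mktuple.
Qed.

Lemma srk_eq_point w w' P Q : valid p q P -> valid p q Q ->
  val w = cmx p q C P -> val w' = cmx p q C Q ->
  (forall k l, (k <= p.+1)%N -> (l <= q.+1)%N -> srk P k l = srk Q k l) -> col_equiv w w'.
Proof.
move=> vP vQ wP wQ PQ; have [s sE] := srk_eq_perm vQ vP (fun k l kp lq => esym (PQ k l kp lq)).
apply/existsP; exists s; rewrite wP wQ; apply/eqP/matrixP => i c; rewrite !cmxE !mxE.
by rewrite sE.
Qed.

Lemma srk_hom_le w w' P Q : valid p q P -> valid p q Q ->
  val w = cmx p q C P -> val w' = cmx p q C Q ->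
  (forall X : objJ hp hq C, indecomposableJ X ->
    (\dim (rep_hom X (point_obj hp hq (param_point w')))
       <= \dim (rep_hom X (point_obj hp hq (param_point w))))%N) ->
  forall k l, (k <= p.+1)%N -> (l <= q.+1)%N -> (srk Q k l <= srk P k l)%N.
Proof.
move=> vP vQ wP wQ H [|k] l kp lq; first by rewrite {1}/srk big1.
case: l lq => [|l] lq; first by rewrite {1}/srk big1 // => c _; rewrite andbF.
have [kl0|] := boolP ((0 < k)%N || (0 < l)%N).
  have h := H (elem_obj R hp hq kp lq) (elem_indecomposable R hp hq kp lq kl0).
  have eQ := dim_hom_elem hp hq vQ kp lq (param_point_cmx wQ).
  have eP := dim_hom_elem hp hq vP kp lq (param_point_cmx wP).
  exact: leq_trans (eq_leq (esym eQ)) (leq_trans h (eq_leq eP)).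
(* There is no object for k = l = 0, but then [srk Q] counts columns without entries, and a valid
   configuration has none. *)
rewrite negb_or -!leqNgt !leqn0 => /andP[/eqP -> /eqP ->].
rewrite {1}/srk big1 // => c _; have := valid_neq0 vQ c; lia.
Qed.

(** Induction on the sum of the differences of rank numbers: a move of [Q] towards [P] lowers it,
    and closures compose since an orbit closure contains the closures of its orbits. *)
Theorem closure_of_srk P Q w w' : valid p q P -> valid p q Q ->
  val w = cmx p q C P -> val w' = cmx p q C Q ->
  (forall k l, (k <= p.+1)%N -> (l <= q.+1)%N -> (srk Q k l <= srk P k l)%N) ->
  closure (Korbit (param_point w')) (param_point w).
Proof.
move=> vP vQ wP wQ QP.
have [n] := ubnP (\sum_(k < p.+2) \sum_(l < q.+2) (srk P k l - srk Q k l)).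
elim: n Q w' vQ wQ QP => // n IH Q w' vQ wQ QP ltn.
have [ex|no] := boolp.pselect (exists k l,
    [/\ (k <= p.+1)%N, (l <= q.+1)%N & (srk Q k l < srk P k l)%N]); last first.
  have -> : param_point w = param_point w'.
    apply/param_point_col_equiv/(srk_eq_point vP vQ wP wQ) => k l kp lq.
    have := QP k l kp lq; rewrite leq_eqVlt => /orP[/eqP //|lt].
    by case: no; exists k, l.
  apply: subset_closure; exact: (Korbit_refl (param_point_frame w')).
have [Q' [mv vQ' QQ' Q'P [k0 [l0 [k0p l0q lt0]]]]] := move_exists vQ vP QP ex.
pose w2 := param_of R vQ'; have w2E : val w2 = cmx p q C Q' by [].
have cl2 := move_closure mv vQ (param_point_cmx wQ) (param_point_cmx w2E).
have sub := Korbit_sub_closure (param_point_cmx wQ) (param_point_cmx w2E) cl2.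
apply: (@closed_closure _ (Korbit (param_point w'))); apply: (closureS sub).
apply: (IH Q' w2 vQ' w2E Q'P).
move: ltn; rewrite ltnS; apply: leq_trans.
have k0p' : (k0 < p.+2)%N by []. have l0q' : (l0 < q.+2)%N by [].
rewrite (bigD1 (Ordinal k0p')) //= [in leqRHS](bigD1 (Ordinal k0p')) //=.
rewrite -addSn leq_add //; last first.
  by apply: leq_sum => k _; apply: leq_sum => l _; apply/leq_sub2l/QQ'.
rewrite (bigD1 (Ordinal l0q')) //= [in leqRHS](bigD1 (Ordinal l0q')) //=.
rewrite -addSn leq_add //; last by apply: leq_sum => l _; apply/leq_sub2l/QQ'.
by have := Q'P k0 l0 k0p l0q; have := QQ' k0 l0; lia.
Qed.

Theorem closure_hom_order w w' :
  Korbit (param_point w) `<=` closure (Korbit (param_point w')) <->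
  forall X : objJ hp hq C, indecomposableJ X ->
    (\dim (rep_hom X (point_obj hp hq (param_point w')))
       <= \dim (rep_hom X (point_obj hp hq (param_point w))))%N.
Proof.
split=> [sub X _|H].
  apply: (hom_semicontinuous X (param_point_frame w') (param_point_frame w)).
  by apply: sub; apply: (Korbit_refl (param_point_frame w)).
have [P vP wP] := param_config w; have [Q vQ wQ] := param_config w'.
apply: (Korbit_sub_closure (param_point_frame w') (param_point_frame w)).
exact: (closure_of_srk vP vQ wP wQ (srk_hom_le vP vQ wP wQ H)).
Qed.

Theorem orbit_bar_bij : set_bij [set: param_bar R p q r]
  (range (fun x : flagGr R p q r => Korbit x)) (@orbit_bar R p q r).
Proof.
split.
- by move=> c _; exists (param_point (repr c)).
- move=> c c' _ _ e; rewrite -[c]reprK -[c']reprK; apply/eqmodP.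
  have [P vP wP] := param_config (repr c); have [Q vQ wQ] := param_config (repr c').
  have e' : Korbit (param_point (repr c)) = Korbit (param_point (repr c')) by [].
  (* Equal orbits lie in the closure of each other, which gives the inequalities of rank numbers in
     both directions. *)
  have h1 := (closure_hom_order (repr c) (repr c')).1; rewrite e' in h1.
  have h2 := (closure_hom_order (repr c') (repr c)).1; rewrite e' in h2.
  have le1 := srk_hom_le vP vQ wP wQ (h1 (@subset_closure _ _)).
  have le2 := srk_hom_le vQ vP wQ wP (h2 (@subset_closure _ _)).
  apply: (srk_eq_point vP vQ wP wQ) => k l kp lq.
  by apply/eqP; rewrite eqn_leq le1 ?le2.
- move=> S [x _ <-]; have [P vP Px] := exists_param x.
  pose w := param_of R vP; pose c : param_bar R p q r := (\pi w)%qT.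
  exists c => //; rewrite /orbit_bar.
  have -> : param_point (repr c) = param_point w.
    by apply: param_point_col_equiv; apply/eqmodP; rewrite reprK.
  have Pw := param_point_frame w.
  exact/esym/(Korbit_eq Pw)/(Px _ (param_point_cmx (w := w) erefl)).
Qed.

End OrbitClosures.

(** * Irreducibility through polynomial curves *)

Section LinesAndIrreducibility.
Variable R : realType.
Local Notation C := (R[i])%C.

Lemma upoly_witness (F G : C -> C) t1 t2 : upoly F -> upoly G -> F t1 != 0 -> G t2 != 0 ->
  exists t, F t != 0 /\ G t != 0.
Proof.
move=> pF pG F1 G2; apply: boolp.contrapT => no; case/negP: F1; apply/eqP.
apply: (upoly_mul_eq0 pF pG G2) => t; apply/eqP; rewrite mulf_eq0; apply: boolp.contrapT => /negP.
by rewrite negb_or => /andP[Ft Gt]; apply: no; exists t.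
Qed.

Lemma upoly_line m n (X Y : 'M[C]_(m, n)) i j : upoly (fun t => (X + t *: Y) i j).
Proof. by apply: fa_ext (upoly_affine (X i j) (Y i j)) _ => t; rewrite !mxE. Qed.

Lemma upoly_det_line n (X Y : 'M[C]_n) : upoly (fun t => \det (X + t *: Y)).
Proof. by apply: (fa_det upoly_funalg) => i j; apply: upoly_line. Qed.

Lemma upoly_line_blk p q m (s t : 'M[C]_p * 'M[C]_q) (Y : 'M[C]_(p + q, m)) i j :
  upoly (fun c => (blk (s + c *: t) *m Y) i j).
Proof.
apply: (fa_mulmx upoly_funalg) => k l; last exact: (fa_const upoly_funalg).
by apply: (fa_ext (upoly_line (blk s) (blk t) k l)) => c; rewrite [in RHS]linearD [in RHS]linearZ.
Qed.

Lemma upoly_det_line_blk p q (s t : 'M[C]_p * 'M[C]_q) : upoly (fun c => \det (blk (s + c *: t))).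
Proof.
apply: (fa_ext (upoly_det_line (blk s) (blk t))) => c.
by rewrite [in RHS]linearD [in RHS]linearZ.
Qed.

(** The curve may leave [Y] at the zeros of [del]: this suits sets defined by an invertibility
    condition, where [del] is a determinant. *)
Definition line_connected m n (Y : set 'M[C]_(m, n)) : Prop :=
  forall x y, Y x -> Y y -> exists (g : C -> 'M[C]_(m, n)) (del : C -> C),
    [/\ forall i j, upoly (fun t => g t i j), upoly del, g 0 = x, g 1 = y
      & del 0 != 0 /\ forall t, del t != 0 -> Y (g t)].

(** On a curve joining a point where [F] is nonzero to one where [G] is nonzero, some parameter
    avoids the zeros of [F], [G] and [del] together. *)
Lemma line_connected_irr m n (Y : set 'M[C]_(m, n)) : line_connected Y -> irr Y.
Proof.
move=> lcY F G pF pG FG.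
have [FY|/boolp.existsNP[x /boolp.not_implyP[Yx /eqP Fx]]] :=
  boolp.pselect (forall x, Y x -> F x = 0); first by left.
right => y Yy; apply/eqP; apply: boolp.contrapT => /negP Gy.
have [g [del [pg pdel g0 g1 [del0 Yg]]]] := lcY x y Yx Yy.
have pFg := mpolyf_comp upoly_funalg pF pg; have pGg := mpolyf_comp upoly_funalg pG pg.
have pFGg := fa_mul upoly_funalg pFg pGg.
have [t [FGt delt]] : exists t, F (g t) * G (g t) != 0 /\ del t != 0.
  have Fg0 : F (g 0) != 0 by rewrite g0.
  have Gg1 : G (g 1) != 0 by rewrite g1.
  have [t [Ft Gt]] := upoly_witness pFg pGg Fg0 Gg1.
  exact: upoly_witness pFGg pdel (mulf_neq0 Ft Gt) del0.
by rewrite FG ?eqxx // in FGt; apply: Yg.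
Qed.

End LinesAndIrreducibility.

(** * The fibre of frames over a point *)

Section FrameAlgebra.
Variables (R : realType) (p q r : nat).
Local Notation C := (R[i])%C.
Local Notation frame := 'M[C]_(p + q, p + (q + r)).

Definition triple : vectType C := ('M[C]_p * 'M[C]_q * 'M[C]_r)%type.
Definition bd (t : triple) : 'M[C]_(p + (q + r)) := bdiag t.1.1 t.1.2 t.2.

Lemma bd_linear : linear bd.
Proof.
by move=> a s t; rewrite /bd /bdiag !scale_block_mx !add_block_mx !scaler0 !addr0.
Qed.

HB.instance Definition _ := GRing.isLinear.Build C _ _ _ bd bd_linear.

Definition lower_part m (A : 'M[C]_m) : 'M[C]_m := \matrix_(i, j) (if (j < i)%N then A i j else 0).

Lemma lower_part_linear m : linear (@lower_part m).
Proof.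
move=> a A B; apply/matrixP => i j; rewrite !mxE.
by case: ifP; rewrite // mulr0 addr0.
Qed.

Lemma lower_part0 m (A : 'M[C]_m) : lower_part A = 0 <-> upper A.
Proof.
split=> [A0 i j ji|uA]; first by have /matrixP/(_ i j) := A0; rewrite !mxE ji.
by apply/matrixP => i j; rewrite !mxE; case: ifP => // /uA.
Qed.

Definition triple_lower (t : triple) : triple := (lower_part t.1.1, lower_part t.1.2, 0).

Lemma triple_lower_linear : linear triple_lower.
Proof.
move=> a s t; rewrite /triple_lower !lower_part_linear.
by rewrite -[RHS]/(_, _, a *: 0 + 0) scaler0 addr0.
Qed.

HB.instance Definition _ := GRing.isLinear.Build C _ _ _ triple_lower triple_lower_linear.

(** The group of changes of frame is the set of units of this algebra, which replaces it by a linear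
    space. *)
Definition Gvs : {vspace triple} := lker (linfun triple_lower).

Lemma mem_Gvs t : t \in Gvs <-> in_bor t.1.1 t.1.2.
Proof.
rewrite memv_ker lfunE /=; split=> [/eqP[/lower_part0 ? /lower_part0 ?]|[u1 u2]] //.
by rewrite /triple_lower ((lower_part0 _).2 u1) ((lower_part0 _).2 u2).
Qed.

Definition one3 : triple := (1%:M, 1%:M, 1%:M).

Lemma one3_in : one3 \in Gvs.
Proof. by apply/mem_Gvs; split; apply: upper1. Qed.

Lemma bd_one : bd one3 = 1%:M.
Proof. exact: bdiag1. Qed.

Lemma bdM_in s t : s \in Gvs -> t \in Gvs -> exists2 u, u \in Gvs & bd u = bd s *m bd t.
Proof.
move=> /mem_Gvs[s1 s2] /mem_Gvs[t1 t2].
exists (s.1.1 *m t.1.1, s.1.2 *m t.1.2, s.2 *m t.2); last by rewrite /bd bdiagM.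
by apply/mem_Gvs; split; apply: upperM.
Qed.

Lemma bdV_in t : t \in Gvs -> bd t \in unitmx -> exists u, [/\ u \in Gvs, bd u \in unitmx,
  bd t *m bd u = 1%:M & bd u *m bd t = 1%:M].
Proof.
move=> /mem_Gvs[t1 t2]; rewrite bdiag_unit => /and3P[U1 U2 U3].
exists (invmx t.1.1, invmx t.1.2, invmx t.2); split.
- by apply/mem_Gvs; split; apply: upper_inv.
- by rewrite bdiag_unit !unitmx_inv U1 U2.
- by rewrite /bd bdiagM /= !mulmxV // bdiag1.
- by rewrite /bd bdiagM /= !mulVmx // bdiag1.
Qed.

Lemma is_frame_bd Phi x t : is_frame Phi x -> t \in Gvs -> bd t \in unitmx ->
  is_frame (Phi *m bd t) x.
Proof. by move=> Px /mem_Gvs tG Ut; apply: is_frameM. Qed.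

Lemma is_frame_bd_trans Phi Psi x : is_frame Phi x -> is_frame Psi x ->
  exists t, [/\ t \in Gvs, bd t \in unitmx & Psi = Phi *m bd t].
Proof.
move=> Px Qx; have [b1 [b2 [z [bor Ub E]]]] := is_frame_trans Px Qx.
by exists (b1, b2, z); split=> //; apply/mem_Gvs.
Qed.

(** Holds for singular [t] as well, so [fiber_map] is injective and a change of frame depends
    linearly on the resulting frame. *)
Lemma frame_bd_inj Phi x t : is_frame Phi x -> Phi *m bd t = 0 -> t = 0.
Proof.
move=> Px; have [A [B [M [-> UA UB rM]]]] := is_frame_mkframe Px.
rewrite mkframe_bdiag.
have -> : 0 = mkframe 0 0 0 :> frame by rewrite /mkframe !col_mx0 !row_mx0.
case/mkframe_inj => A0 B0 M0; case: t A0 B0 M0 => [[t1 t2] t3] /= A0 B0 M0.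
have -> : t1 = 0 by rewrite -(mulKmx UA t1) A0 mulmx0.
have -> : t2 = 0 by rewrite -(mulKmx UB t2) B0 mulmx0.
have [B' E] := left_inverse rM.
by have -> : t3 = 0 by rewrite -[t3]mul1mx -E -mulmxA M0 mulmx0.
Qed.

Definition fiber_map (Phi : frame) : 'Hom(triple, frame) :=
  linfun (mulmx Phi \o bd).

Lemma fiber_mapE Phi t : fiber_map Phi t = Phi *m bd t.
Proof. by rewrite lfunE. Qed.

Lemma fiber_map_ker Phi x : is_frame Phi x -> lker (fiber_map Phi) == 0%VS.
Proof.
move=> Px; rewrite -subv0; apply/subvP => t; rewrite memv_ker fiber_mapE => /eqP.
by move/(frame_bd_inj Px) ->; rewrite mem0v.
Qed.

(* As [i] grows, a maximal chain of irreducible subsets of the fibre of all frames of a point. *)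
Definition pfib (Phi : frame) (i : nat) : set frame :=
  [set Psi | exists t, [/\ t \in Gvs, bd t \in unitmx, Psi = Phi *m bd t &
     forall j : 'I_(\dim Gvs), (i <= j)%N -> coord (vbasis Gvs) j (t - one3) = 0]].

Lemma pfib_line Phi i : line_connected (pfib Phi i).
Proof.
move=> X Y [s [sG Us -> s0]] [t [tG Ut -> t0]].
exists (fun a => Phi *m bd (s + a *: (t - s))), (fun a => \det (bd (s + a *: (t - s)))).
have E a : bd (s + a *: (t - s)) = bd s + a *: bd (t - s) by rewrite linearD linearZ.
split.
- move=> k l; apply: (fa_mulmx upoly_funalg) => a b; first exact: (fa_const upoly_funalg).
  apply: (fa_ext (upoly_line (bd s) (bd (t - s)) a b)) => c.
  by rewrite E.
- by apply: (fa_ext (upoly_det_line (bd s) (bd (t - s)))) => c; rewrite E.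
- by rewrite scale0r addr0.
- by rewrite scale1r addrC subrK.
split=> [|a]; first by rewrite scale0r addr0 -unitfE -unitmxE.
rewrite -unitfE -unitmxE => Ua; exists (s + a *: (t - s)); split=> //.
  by rewrite rpredD // rpredZ // rpredB.
move=> j ij; rewrite addrAC linearD linearZ /= s0 // add0r.
have -> : t - s = (t - one3) - (s - one3) by rewrite opprB addrA subrK.
by rewrite linearB /= s0 // t0 // subrr mulr0.
Qed.

Lemma pfib_full Phi Psi x : is_frame Phi x ->
  pfib Phi (\dim Gvs) Psi <-> is_frame Psi x.
Proof.
move=> Px; split=> [[t [tG Ut -> _]]|Qx]; first exact: is_frame_bd.
have [t [tG Ut ->]] := is_frame_bd_trans Px Qx; exists t; split=> // j.
by rewrite leqNgt ltn_ord.
Qed.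

Lemma frames_irr x : irr [set Phi : frame | is_frame Phi x].
Proof.
have [[Phi Px]|no] := boolp.pselect (exists Phi : frame, is_frame Phi x); last first.
  by move=> F G _ _ _; left=> Phi Px; case: no; exists Phi.
have -> : [set Phi : frame | is_frame Phi x] = pfib Phi (\dim Gvs).
  by apply/seteqP; split=> Psi /= H; apply/(pfib_full _ Px).
exact/line_connected_irr/pfib_line.
Qed.

Lemma pfib_step Phi x i : is_frame Phi x -> (i < \dim Gvs)%N ->
  pfib Phi i `<=` pfib Phi i.+1 /\ exists F,
    [/\ mpolyf F, forall X, pfib Phi i X -> F X = 0 & exists2 X, pfib Phi i.+1 X & F X != 0].
Proof.
move=> Px iG; split.
  by move=> X [t [tG Ut -> t0]]; exists t; split=> // j ij; apply: t0; apply: ltnW.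
pose i0 := Ordinal iG; pose f := fiber_map Phi.
have fK := lker0_lfunK (fiber_map_ker Px).
exists (fun X => coord (vbasis Gvs) i0 ((f^-1)%VF X - one3)); split.
- apply: (fa_ext (F := fun X => coord (vbasis Gvs) i0 ((f^-1)%VF X) - coord (vbasis Gvs) i0 one3)).
    apply: (fa_add mpolyf_funalg); last exact: (fa_const mpolyf_funalg).
    exact: (mpolyf_linear (coord (vbasis Gvs) i0 \o (f^-1)%VF)).
  by move=> X; rewrite linearB.
- by move=> X [t [tG Ut -> t0]]; rewrite -fiber_mapE fK t0.
(* All but finitely many c keep 1 + c v invertible; the separating coordinate takes the value c. *)
have [c [c0 Uc]] : exists c : C, c != 0 /\ \det (bd (one3 + c *: (vbasis Gvs)`_i)) != 0.
  apply: (upoly_witness (t1 := 1) (t2 := 0) (upolyX _)).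
  - apply: (fa_ext (upoly_det_line (bd one3) (bd (vbasis Gvs)`_i))) => c.
    by rewrite linearD linearZ.
  - exact: oner_neq0.
  - by rewrite scale0r addr0 bd_one det1 oner_neq0.
have vG : (vbasis Gvs)`_i \in Gvs by apply: (mem_vbasis i0).
have cE (j : 'I_(\dim Gvs)) : coord (vbasis Gvs) j (vbasis Gvs)`_i = (j == i :> nat)%:R.
  exact: (coord_vbasis_nth j i0).
exists (Phi *m bd (one3 + c *: (vbasis Gvs)`_i)).
  exists (one3 + c *: (vbasis Gvs)`_i); split=> //.
  - by rewrite rpredD ?one3_in // rpredZ.
  - move=> j ij; rewrite addrC addKr linearZ /= cE; case: eqP => [e|_]; last by rewrite mulr0.
    by rewrite e ltnn in ij.
by rewrite -fiber_mapE fK addrC addKr linearZ /= cE eqxx mulr1.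
Qed.

End FrameAlgebra.

(** * Upper bound for chains in an orbit *)

Section OrbitAlgebra.
Variables (R : realType) (p q r : nat).
Local Notation C := (R[i])%C.
Local Notation frame := 'M[C]_(p + q, p + (q + r)).
Local Notation Gvs := (Gvs R p q r).

Definition pairT : vectType C := ('M[C]_p * 'M[C]_q)%type.
Definition one2 : pairT := (1%:M, 1%:M).
Definition mul2 (s t : pairT) : pairT := (s.1 *m t.1, s.2 *m t.2).

Lemma blk_mul2 s t : blk (mul2 s t) = blk s *m blk t.
Proof. by rewrite blkM. Qed.

Lemma mul2_linear s : linear (mul2 s).
Proof.
move=> a t u; rewrite /mul2 -[RHS]/(a *: (s.1 *m t.1) + s.1 *m u.1, a *: (s.2 *m t.2) + s.2 *m u.2).
by rewrite !mulmxDr -!scalemxAr.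
Qed.

HB.instance Definition _ s := GRing.isLinear.Build C _ _ _ (mul2 s) (mul2_linear s).

Lemma mul2_linear_l u : linear (mul2^~ u).
Proof.
move=> a s t; rewrite /mul2 -[RHS]/(a *: (s.1 *m u.1) + t.1 *m u.1, a *: (s.2 *m u.2) + t.2 *m u.2).
by rewrite !mulmxDl -!scalemxAl.
Qed.

Lemma mul21 s : mul2 one2 s = s.
Proof. by case: s => a b; rewrite /mul2 /= !mul1mx. Qed.

Definition lact (Phi : frame) : 'Hom(pairT, frame) := linfun (mulmxr Phi \o @blk C p q).

Lemma lactE Phi s : lact Phi s = blk s *m Phi.
Proof. by rewrite lfunE. Qed.

Variables (M : 'M[C]_(p + q, r)) (rM : \rank M = r).
Local Notation Phi0 := (wframe M).

Lemma wframe_point : exists x, is_frame Phi0 x.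
Proof. by apply: mkframe_point; rewrite ?unitmx1. Qed.

Lemma lact_ker : lker (lact Phi0) == 0%VS.
Proof.
rewrite -subv0; apply/subvP => s; rewrite memv_ker lactE blk_mkframe memv0.
have -> : 0 = mkframe 0 0 0 :> frame by rewrite /mkframe !col_mx0 !row_mx0.
by case/eqP/mkframe_inj; rewrite !mulmx1; case: s => a b /= -> ->.
Qed.

(** The pairs carrying both flags and the subspace into themselves. Expressed with frames, the
    condition is linear, and the units form the stabilizer in [K]. *)
Definition Aend : {vspace pairT} := (lact Phi0 @^-1: (fiber_map Phi0 @: Gvs))%VS.
Definition S0 : {vspace pairT} := (Aend^C)%VS.

Lemma mem_Aend s : s \in Aend <-> exists2 t, t \in Gvs & blk s *m Phi0 = Phi0 *m bd t.
Proof.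
rewrite -memv_preim lactE; split=> [/memv_imgP[t tG]|[t tG E]].
  by rewrite fiber_mapE; exists t.
by apply/memv_imgP; exists t; rewrite ?fiber_mapE.
Qed.

Lemma one2_in : one2 \in Aend.
Proof.
by apply/mem_Aend; exists (one3 R p q r); rewrite ?one3_in // blk1 bd_one mulmx1 mul1mx.
Qed.

Lemma Aend_unit s : s \in Aend -> gunit s -> exists2 u, u \in Gvs & Phi0 = blk s *m (Phi0 *m bd u).
Proof.
case/mem_Aend => t tG E [U1 U2].
have [E1 E2 E3] : [/\ s.1 = t.1.1, s.2 = t.1.2 & blk s *m M = M *m t.2].
  move: E; rewrite /wframe blk_mkframe mkframe_bdiag !mulmx1 !mul1mx.
  by case/mkframe_inj.
have U3 : t.2 \in unitmx.
  by apply: (@unitmx_rankr _ _ _ M); rewrite -E3 rank_unitmul // blk_unit U1.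
have Ut : bd t \in unitmx by rewrite bdiag_unit -E1 -E2 U1 U2.
have [u [uG _ tu _]] := bdV_in tG Ut; exists u => //.
by rewrite mulmxA E -mulmxA tu mulmx1.
Qed.

Local Notation e := (\dim Aend).
Local Notation a := (vbasis Aend).

(* Cramer's rule: [h := hsol s] is the element of [Aend] such that [s * h] lies in
   [\det (Lmx s) *: (one2 + S0)]; hence [one2 + S0] is a slice of [K] modulo the stabilizer. *)
Definition Lmx (s : pairT) : 'M[C]_e := \matrix_(i, j) coord a i (projv Aend (mul2 s a`_j)).
Definition hsol (s : pairT) : pairT :=
  \sum_j (\adj (Lmx s) *m \col_i coord a i one2) j 0 *: a`_j.

Lemma hsol_in s : hsol s \in Aend.
Proof. by apply: rpred_sum => j _; apply/rpredZ/mem_vbasis. Qed.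

Lemma hsolE s : projv Aend (mul2 s (hsol s)) = \det (Lmx s) *: one2.
Proof.
set c := \adj (Lmx s) *m \col_i coord a i one2.
have -> : projv Aend (mul2 s (hsol s)) = \sum_i (Lmx s *m c) i 0 *: a`_i.
  rewrite linear_sum linear_sum /=.
  rewrite (eq_bigr (fun j => \sum_i (Lmx s i j * c j 0) *: a`_i)); last first.
    move=> j _; rewrite !linearZ /= {1}(coord_vbasis (memv_proj Aend (mul2 s a`_j))).
    by rewrite -/c scaler_sumr; apply: eq_bigr => i _; rewrite scalerA [X in _ = (X * _) *: _]mxE mulrC.
  rewrite exchange_big; apply: eq_bigr => i _ /=.
  by rewrite mxE scaler_suml.
rewrite /c mulmxA mul_mx_adj mul_scalar_mx {2}(coord_vbasis one2_in) scaler_sumr.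
by apply: eq_bigr => i _; rewrite !mxE scalerA.
Qed.

Lemma Lmx1 : Lmx one2 = 1%:M.
Proof.
by apply/matrixP => i j; rewrite !mxE mul21 projv_id ?mem_vbasis // coord_vbasis_nth.
Qed.

Lemma hsol1 : hsol one2 = one2.
Proof.
rewrite /hsol Lmx1 (_ : \adj 1%:M = 1%:M); last first.
  by rewrite -[LHS]mulmx1 mul_adj_mx det1.
rewrite mul1mx [RHS](coord_vbasis one2_in); apply: eq_bigr => j _.
by rewrite mxE.
Qed.

Lemma scaled_absorb n m (X X' H : 'M[C]_n) (Y : 'M[C]_(n, m)) (B T W : 'M[C]_m) c :
  X *m H = c *: X' -> Y = H *m (Y *m B) -> W = (c *: B) *m T ->
  X *m Y *m T = X' *m Y *m W.
Proof.
move=> XH YB ->; rewrite {1}YB (mulmxA X) XH.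
by rewrite -!scalemxAl -scalemxAr !mulmxA.
Qed.

(** For generic g, multiplication by a unit of [Aend] brings g into a multiple of 1 + S, and that
    unit is absorbed by a change of frame. An arbitrary g is reached along the line from the
    identity. *)
Lemma orbit_dense (F : frame -> C) : mpolyf F ->
  (forall s t, s \in S0 -> t \in Gvs -> F (blk (one2 + s) *m Phi0 *m bd t) = 0) ->
  forall g t, gunit g -> t \in Gvs -> F (blk g *m Phi0 *m bd t) = 0.
Proof.
move=> pF F0 g t Ug tG; pose l c : pairT := one2 + c *: (g - one2).
have pl i j : upoly (fun c => (blk (l c) *m Phi0) i j) by apply: upoly_line_blk.
have pL i j : upoly (fun c => Lmx (l c) i j).
  pose al := coord a i (projv Aend (mul2 one2 a`_j)).
  pose be := coord a i (projv Aend (mul2 (g - one2) a`_j)).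
  apply: (fa_ext (upoly_affine al be)) => c.
  have -> : l c = c *: (g - one2) + one2 by rewrite addrC.
  by rewrite mxE mul2_linear_l !linearP addrC.
have ph i j : upoly (fun c => blk (hsol (l c)) i j).
  apply: (@fa_ext _ _ (@upoly C) (fun c => \sum_k
     (\adj (Lmx (l c)) *m \col_i coord a i one2) k 0 * blk a`_k i j)).
    apply: (fa_sum upoly_funalg) => k; apply: (fa_mul upoly_funalg).
      apply: (fa_mulmx upoly_funalg) => i' j'; first exact: (fa_adj upoly_funalg).
      exact: (fa_const upoly_funalg).
    exact: (fa_const upoly_funalg).
  move=> c; rewrite linear_sum summxE; apply: eq_bigr => k _.
  by rewrite linearZ [RHS]mxE.
pose G c := F (blk (l c) *m Phi0 *m bd t).
(* The genericity condition: the linear system is solvable and its solution is a unit. It holds at c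
   = 0, the identity. *)
pose D c := \det (Lmx (l c)) * \det (blk (hsol (l c))).
have pG : upoly G.
  apply: (mpolyf_comp upoly_funalg pF) => i j.
  apply: (fa_mulmx upoly_funalg) => i' j'; last exact: (fa_const upoly_funalg).
  exact: pl.
have pD : upoly D.
  by apply: (fa_mul upoly_funalg); apply: (fa_det upoly_funalg).
have l0 : l 0 = one2 by rewrite /l scale0r addr0.
have l1 : l 1 = g by rewrite /l scale1r addrC subrK.
have D0 : D 0 != 0 by rewrite /D l0 Lmx1 hsol1 blk1 !det1 mulr1 oner_neq0.
suff GD c : G c * D c = 0 by have := upoly_mul_eq0 pG pD D0 GD 1; rewrite /G l1.
have [->|] := eqVneq (D c) 0; first by rewrite mulr0.
rewrite mulf_eq0 negb_or => /andP[Dc Uh]; suff -> : G c = 0 by rewrite mul0r.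
have gh : gunit (hsol (l c)).
  by move: Uh; rewrite -unitfE -unitmxE blk_unit => /andP.
have [u uG Eu] := Aend_unit (hsol_in _) gh.
(* By [hsolE] the subtracted term is the [Aend]-part of the product, so what remains lies in the
   complement. *)
pose sg := (\det (Lmx (l c)))^-1 *: (mul2 (l c) (hsol (l c)) - \det (Lmx (l c)) *: one2).
have sS : sg \in S0 by rewrite rpredZ // -hsolE memv_projC.
have Es : mul2 (l c) (hsol (l c)) = \det (Lmx (l c)) *: (one2 + sg).
  by rewrite scalerDr /sg scalerA mulfV // scale1r addrC subrK.
have [v vG Ev] := bdM_in (rpredZ (\det (Lmx (l c))) uG) tG.
rewrite /G; suff -> : blk (l c) *m Phi0 *m bd t = blk (one2 + sg) *m Phi0 *m bd v by apply: F0.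
have eB : blk (\det (Lmx (l c)) *: (one2 + sg)) = \det (Lmx (l c)) *: blk (one2 + sg).
  by rewrite [LHS]linearZ.
have eD : bd (\det (Lmx (l c)) *: u) = \det (Lmx (l c)) *: bd u by rewrite [LHS]linearZ.
have e2 : blk (l c) *m blk (hsol (l c)) = \det (Lmx (l c)) *: blk (one2 + sg).
  by rewrite -blk_mul2 Es eB.
have e3 : bd v = (\det (Lmx (l c)) *: bd u) *m bd t by rewrite Ev eD.
exact: scaled_absorb e2 Eu e3.
Qed.

Local Notation d := (\dim S0).
Local Notation k := (\dim Gvs).

(** A polynomial map from affine space of dimension d + k whose image, by [orbit_dense], meets the
    zeros of no more polynomials than the frames of the orbit require. *)
Definition param_map (v : 'rV[C]_(d + k)) : frame :=
  blk (one2 + \sum_i v 0 (lshift k i) *: (vbasis S0)`_i) *m Phi0 *m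
  bd (\sum_j v 0 (rshift d j) *: (vbasis Gvs)`_j).

Lemma mpolyf_param i j : mpolyf (fun v => param_map v i j).
Proof.
have fa := @mpolyf_funalg C 1 (d + k); have fac := fa_const fa.
apply: (fa_mulmx fa) => a b; first apply: (fa_mulmx fa) => {}a {}b //.
  apply: (fa_ext (F := fun v : 'rV_(d + k) => blk one2 a b +
      \sum_i v 0 (lshift k i) * blk (vbasis S0)`_i a b)).
    apply: (fa_add fa) => //; apply: (fa_sum fa) => l; apply: (fa_mul fa) => //.
    exact: mpolyf_entry.
  move=> v; rewrite linearD linear_sum [RHS]mxE summxE; congr (_ + _).
  by apply: eq_bigr => l _; rewrite linearZ [RHS]mxE.
apply: (fa_ext (F := fun v : 'rV_(d + k) => \sum_j v 0 (rshift d j) * bd (vbasis Gvs)`_j a b)).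
  by apply: (fa_sum fa) => l; apply: (fa_mul fa) => //; apply: mpolyf_entry.
move=> v; rewrite linear_sum summxE; apply: eq_bigr => l _.
by rewrite linearZ [RHS]mxE.
Qed.

Lemma param_map_onto s t : s \in S0 -> t \in Gvs ->
  exists v, param_map v = blk (one2 + s) *m Phi0 *m bd t.
Proof.
move=> sS tG.
set v : 'rV_(d + k) := row_mx (\row_i coord (vbasis S0) i s) (\row_j coord (vbasis Gvs) j t).
have e1 : \sum_i v 0 (lshift k i) *: (vbasis S0)`_i = s.
  by rewrite [RHS](coord_vbasis sS); apply: eq_bigr => i _; rewrite row_mxEl mxE.
have e2 : \sum_j v 0 (rshift d j) *: (vbasis Gvs)`_j = t.
  by rewrite [RHS](coord_vbasis tG); apply: eq_bigr => i _; rewrite row_mxEr mxE.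
by exists v; rewrite /param_map e1 e2.
Qed.

Variables (x0 : flagGr R p q r) (P0 : is_frame Phi0 x0).

Theorem krull_upper m Z : irreducible_chain (Korbit x0) m Z -> (m <= d)%N.
Proof.
case=> irrZ ltZ; rewrite -(leq_add2r k) addnC.
have ZO i y : (i <= m)%N -> Z i y -> Korbit x0 y.
  by move=> im; have [_ [F _ ->]] := irrZ i im; case.
have frameO y : Korbit x0 y -> exists Phi : frame, is_frame Phi y.
  by case/(KorbitP _ P0) => s _ Py; exists (blk s *m Phi0).
have [[[z0 z0Z] _] _] := irrZ 0%N (leq0n m).
have [Phiz Pz] := frameO z0 (ZO 0%N z0 (leq0n m) z0Z).
pose FZ i := [set Phi : frame | exists2 y, Z i y & is_frame Phi y].
(* Index k carries the whole fibre over [z0], which takes the place of [FZ 0]; the lifted chain thus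
   has length k + m. *)
pose Y j := if (j <= k)%N then pfib Phiz j else FZ (j - k)%N.
have FZstep i : (i < m)%N -> FZ i `<=` FZ i.+1 /\ exists F,
    [/\ mpolyf F, forall X, FZ i X -> F X = 0 & exists2 X, FZ i.+1 X & F X != 0].
  move=> im; have [Zsub Zne] := ltZ i im; split; first by move=> X [y /Zsub]; exists y.
  have [_ [Cl clC ZE]] := irrZ i (ltnW im); have [FF pFF HFF] := closed_polysE clC.
  have [y /boolp.not_implyP[Zy nZy]] := (boolp.existsNP _).2 Zne.
  have [Phi Py] := frameO y (ZO i.+1 y im Zy).
  have /(HFF y Phi Py)/boolp.existsNP[F /boolp.not_implyP[FFF /eqP F1]] : ~ Cl y.
    by move=> Cy; apply: nZy; rewrite ZE; split=> //; apply: ZO Zy.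
  exists F; split; [exact: pFF| |by exists Phi => //; exists y].
  by move=> X [z]; rewrite ZE => -[_ Cz] Qz; apply: (HFF z X Qz).1.
apply: (@chain_bound _ _ _ (d + k) Y (k + m) param_map mpolyf_param).
- move=> j jm; rewrite /Y; case: leqP => [_|kj].
    exact/line_connected_irr/pfib_line.
  have im : (j - k <= m)%N by lia.
  (* Preimages of irreducible sets are irreducible because the fibres are: on each fibre [F] or [G]
     vanishes, so [Z i] is covered by the closed sets [V F] and [V G]. *)
  move: (j - k)%N im => i im F G pF pG FG.
  pose V (H : frame -> C) : set (flagGr R p q r) :=
    [set y | forall Phi, is_frame Phi y -> H Phi = 0].
  have VE H : Z i `<=` V H -> forall Phi, FZ i Phi -> H Phi = 0.
    by move=> ZV Phi [y /ZV Vy Py]; apply: Vy.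
  have [[_ irrZi] _] := irrZ i im.
  have [|ZF|ZG] := irrZi (V F) (V G) (closed_poly pF) (closed_poly pG).
  + move=> y Zy.
    have [Phi Py|F0|G0] := frames_irr pF pG (x := y); [|by left|by right].
    by apply: FG; exists y.
  + by left; apply: VE.
  + by right; apply: VE.
- exists Phiz; rewrite /Y leq0n; exists (one3 R p q r); split.
  + exact: one3_in.
  + by rewrite bd_one unitmx1.
  + by rewrite bd_one mulmx1.
  + by move=> j _; rewrite subrr linear0.
- move=> j jm; rewrite /Y; have [jk|kj|jk] := ltngtP j k.
  + exact: (pfib_step Pz).
  + by rewrite subSn ?(ltnW kj) //; apply: FZstep; lia.
  + have m0 : (0 < m)%N by lia.
    have [F01 [F [pF F0 F1]]] := FZstep 0%N m0.
    have pf0 X : pfib Phiz j X -> FZ 0%N X.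
      by rewrite jk => /(pfib_full _ Pz) Qz; exists z0.
    have -> : (j.+1 - k)%N = 1%N by lia.
    by split=> [X /pf0/F01 //|]; exists F; split=> // X /pf0/F0.
- move=> F pF F0 Phi.
  have FO Psi y : Korbit x0 y -> is_frame Psi y -> F Psi = 0.
    case/(KorbitP _ P0) => s Us Py Qy; have [t [tG _ ->]] := is_frame_bd_trans Py Qy.
    apply: orbit_dense => // s' t' sS t'G.
    by have [v <-] := param_map_onto sS t'G.
  rewrite /Y; case: leqP => [mk|kj [y Zy Py]].
    have -> : (k + m)%N = k by lia.
    by move/(pfib_full _ Pz) => Qz; apply: FO Qz; apply: ZO z0Z.
  by apply: FO Py; apply: ZO Zy; lia.
Qed.

End OrbitAlgebra.

(** * A chain of maximal length in an orbit *)

Section KrullLowerBound.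
Variables (R : realType) (p q r : nat) (M : 'M[R[i]%C]_(p + q, r)) (rM : \rank M = r).
Local Notation C := (R[i])%C.
Local Notation frame := 'M[C]_(p + q, p + (q + r)).
Local Notation Gvs := (Gvs R p q r).
Local Notation Phi0 := (wframe M).
Local Notation Aend := (Aend M).
Local Notation S0 := (S0 M).
Local Notation one2 := (one2 R p q).
Local Notation one3 := (one3 R p q r).
Local Notation d := (\dim S0).
Local Notation k := (\dim Gvs).
Local Notation g := (vbasis Gvs).

(** A linear map that recovers [t] from [Phi0 *m bd t] and kills the directions of [S0]; it exists
    because [S0] meets [Aend] only in 0. *)
Definition retract : 'Hom(frame, triple R p q r) :=
  ((fiber_map Phi0)^-1 \o daddv_pi (fiber_map Phi0 @: Gvs) (lact Phi0 @: S0))%VF.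

Lemma fiber_Phi0K : cancel (fiber_map Phi0) (fiber_map Phi0)^-1%VF.
Proof. by have [x Px] := wframe_point rM; apply/lker0_lfunK/(fiber_map_ker Px). Qed.

Lemma retract_disjoint : (fiber_map Phi0 @: Gvs :&: lact Phi0 @: S0)%VS = 0%VS.
Proof.
apply/eqP; rewrite -subv0; apply/subvP => X; rewrite memv_cap => /andP[].
case/memv_imgP => t tG -> /memv_imgP[s sS e].
have sA : s \in Aend by apply/mem_Aend; exists t; rewrite // -lactE -e fiber_mapE.
have : s \in (Aend :&: S0)%VS by rewrite memv_cap sA.
by rewrite capv_compl memv0 => /eqP s0; rewrite e s0 linear0 mem0v.
Qed.

Lemma retract_fiber t : t \in Gvs -> retract (Phi0 *m bd t) = t.
Proof.
move=> tG; rewrite comp_lfunE -fiber_mapE daddv_pi_id ?fiber_Phi0K //.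
  exact: retract_disjoint.
exact: memv_img.
Qed.

Lemma retract_lact s : s \in S0 -> retract (blk s *m Phi0) = 0.
Proof.
move=> sS; rewrite comp_lfunE -lactE; set X := lact Phi0 s.
have XS : X \in (lact Phi0 @: S0)%VS by apply: memv_img.
have := @daddv_pi_add _ _ _ _ X retract_disjoint (subvP (addvSr _ _) _ XS).
rewrite (daddv_pi_id _ XS) 1?capvC ?retract_disjoint //.
by move/(canRL (addrK _)); rewrite subrr => ->; rewrite linear0.
Qed.

(* Cramer's rule again: from a frame of a point of the slice, [bsol] and [Num] recover, up to
   the common factor [\det (Lp Phi)], the change of frame and the coordinates on [S0]. *)
Definition Lp (Phi : frame) : 'M[C]_k := \matrix_(i, j) coord g i (retract (Phi *m bd g`_j)).

Definition bsol (Phi : frame) : triple R p q r :=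
  \sum_j (\adj (Lp Phi) *m \col_i coord g i one3) j 0 *: g`_j.

Lemma bsolE Phi s t : s \in S0 -> t \in Gvs -> Phi *m bd t = blk (one2 + s) *m Phi0 ->
  bsol Phi = \det (Lp Phi) *: t.
Proof.
move=> sS tG E; set c := \col_j coord g j t.
have Lc : Lp Phi *m c = \col_i coord g i one3.
  have <- : retract (Phi *m bd t) = one3.
    have eB : blk (one2 + s) = 1%:M + blk s by rewrite [LHS]linearD /= blk1.
    rewrite E eB mulmxDl mul1mx [LHS]linearD [X in _ + X]retract_lact // addr0.
    by have := retract_fiber (one3_in R p q r); rewrite bd_one mulmx1.
  apply/colP => i; rewrite !mxE [in RHS](coord_vbasis tG) linear_sum mulmx_sumr linear_sum linear_sum.
  apply: eq_bigr => j _; rewrite !mxE mulrC.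
  by rewrite linearZ -scalemxAr !linearZ.
rewrite /bsol -Lc mulmxA mul_adj_mx mul_scalar_mx [in RHS](coord_vbasis tG) scaler_sumr.
by apply: eq_bigr => j _; rewrite !mxE scalerA.
Qed.

Definition slice_coord (i : 'I_d) (X : frame) : C :=
  coord (vbasis S0) i ((\1 - projv Aend)%VF ((lact Phi0)^-1%VF X)).

Definition Num (i : 'I_d) (Phi : frame) : C := slice_coord i (Phi *m bd (bsol Phi)).

(** [bsol] undoes the change of frame up to the determinant, leaving a multiple of (1 + s) Phi0;
    projecting away from [Aend] removes the 1. *)
Lemma NumE i Phi s t : s \in S0 -> t \in Gvs -> Phi *m bd t = blk (one2 + s) *m Phi0 ->
  Num i Phi = \det (Lp Phi) * coord (vbasis S0) i s.
Proof.
move=> sS tG E; rewrite /Num (bsolE sS tG E) linearZ /= -scalemxAr E /slice_coord.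
rewrite -lactE linearZ /= (lker0_lfunK (lact_ker M)) 2!linearZ /=.
congr (_ * coord _ _ _).
rewrite add_lfunE opp_lfunE id_lfunE linearD /= projv_id ?one2_in // opprD addrACA subrr add0r.
suff -> : projv Aend s = 0 by rewrite subr0.
by apply/eqP; rewrite -memv_ker lker_proj.
Qed.

Lemma mpolyf_Lp i j : mpolyf (fun Phi => Lp Phi i j).
Proof.
have fa := @mpolyf_funalg C (p + q) (p + (q + r)).
apply: (@fa_ext _ _ _ (fun Phi => coord g i (retract (Phi *m bd g`_j)))).
  exact: (mpolyf_mulr (bd g`_j) (mpolyf_linear (coord g i \o retract))).
by move=> Phi; rewrite mxE.
Qed.

Lemma mpolyf_Num i : mpolyf (Num i).
Proof.
have fa := @mpolyf_funalg C (p + q) (p + (q + r)); have fac := fa_const fa.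
have pl : mpolyf (slice_coord i).
  apply: (fa_ext (mpolyf_linear (coord (vbasis S0) i \o ((\1 - projv Aend) \o (lact Phi0)^-1)%VF))).
  by move=> X /=; rewrite comp_lfunE.
apply: (mpolyf_comp fa pl) => a b; apply: (fa_mulmx fa) => {}a {}b; first exact: mpolyf_entry.
apply: (@fa_ext _ _ _ (fun Phi => \sum_j
   (\adj (Lp Phi) *m \col_i coord g i one3) j 0 * bd g`_j a b)).
  apply: (fa_sum fa) => j; apply: (fa_mul fa) => //.
  apply: (fa_mulmx fa) => // i' j'; apply: (fa_adj fa) => *; exact: mpolyf_Lp.
move=> Phi; rewrite linear_sum summxE; apply: eq_bigr => j _.
by rewrite linearZ [RHS]mxE.
Qed.

Lemma Lp1 : Lp Phi0 = 1%:M.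
Proof.
by apply/matrixP => i j; rewrite !mxE retract_fiber ?mem_vbasis // coord_vbasis_nth.
Qed.

Variables (x0 : flagGr R p q r) (P0 : is_frame Phi0 x0).

(** Steps of a flag of [S0]: translates by 1 + s with s in the span of the first i basis vectors. *)
Definition slice (i : nat) : set (flagGr R p q r) :=
  [set y | exists s, [/\ s \in S0, gunit (one2 + s : pairT R p q),
     forall j : 'I_d, (i <= j)%N -> coord (vbasis S0) j s = 0
   & is_frame (blk (one2 + s) *m Phi0) y]].

Lemma slice_sub i : slice i `<=` Korbit x0.
Proof. by move=> y [s [_ Us _ Py]]; apply/(KorbitP _ P0); exists (one2 + s). Qed.

Lemma sliceS i : slice i `<=` slice i.+1.
Proof.
by move=> y [s [sS Us s0 Py]]; exists s; split=> // j ij; apply: s0; apply: ltnW.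
Qed.

(** Witnesses outside [Z1] and outside [Z2] are joined by a line in the slice; a generic point of it
    lies in neither set. *)
Lemma slice_irr i Z1 Z2 : closed Z1 -> closed Z2 -> slice i `<=` Z1 `|` Z2 ->
  slice i `<=` Z1 \/ slice i `<=` Z2.
Proof.
move=> cZ1 cZ2 sub; apply: boolp.contrapT => /boolp.not_orP[n1 n2].
have wit Z : closed Z -> ~ slice i `<=` Z -> exists s F, gunit (one2 + s : pairT R p q) /\ [/\ s \in S0,
    forall j : 'I_d, (i <= j)%N -> coord (vbasis S0) j s = 0,
    mpolyf F, F (blk (one2 + s) *m Phi0) != 0 &
    forall y Psi, Z y -> is_frame Psi y -> F Psi = 0].
  move=> cZ /boolp.existsNP[y /boolp.not_implyP[[s [sS Us s0 Py]] nZy]].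
  have [FF pFF HFF] := closed_polysE cZ.
  have /(HFF y _ Py)/boolp.existsNP[F /boolp.not_implyP[FFF /eqP F1]] := nZy.
  exists s, F; split=> //; split=> //; first exact: pFF.
  by move=> z Psi Zz Pz; apply: (HFF z Psi Pz).1.
have [s1 [F1 [U1 [s1S s10 pF1 F1n F1Z]]]] := wit Z1 cZ1 n1.
have [s2 [F2 [_ [s2S s20 pF2 F2n F2Z]]]] := wit Z2 cZ2 n2.
pose l c : pairT R p q := one2 + s1 + c *: (s2 - s1).
have pl a b : upoly (fun c => (blk (l c) *m Phi0) a b) by apply: upoly_line_blk.
have pG1 := mpolyf_comp upoly_funalg pF1 pl; have pG2 := mpolyf_comp upoly_funalg pF2 pl.
have G1 : F1 (blk (l 0) *m Phi0) != 0 by rewrite /l scale0r addr0.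
have G2 : F2 (blk (l 1) *m Phi0) != 0 by rewrite /l scale1r -addrA [s1 + _]addrC subrK.
have [c' [c1 c2]] := upoly_witness pG1 pG2 G1 G2.
have pD : upoly (fun c => \det (blk (l c))) by apply: upoly_det_line_blk.
have D0 : \det (blk (l 0)) != 0.
  rewrite /l scale0r addr0 -unitfE -unitmxE blk_unit; exact/andP.
have [c []] := upoly_witness (fa_mul upoly_funalg pG1 pG2) pD (mulf_neq0 c1 c2) D0.
rewrite mulf_eq0 negb_or => /andP[n1c n2c].
rewrite -unitfE -unitmxE blk_unit => /andP Ul.
have [y _ Py] := is_frame_act P0 Ul.
have sy : slice i y.
  exists (s1 + c *: (s2 - s1)); rewrite addrA; split=> //.
    by rewrite rpredD // rpredZ // rpredB.
  by move=> j ij; rewrite linearD linearZ linearB /= s10 // s20 // subrr mulr0 addr0.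
case: (sub y sy) => Zy; first by rewrite (F1Z y _ Zy Py) eqxx in n1c.
by rewrite (F2Z y _ Zy Py) eqxx in n2c.
Qed.

(** The polynomial [Num i] vanishes on all frames over [slice i], hence over its closure, but not at
    a suitable 1 + c b with b the next basis vector. *)
Lemma slice_step (i : 'I_d) : exists2 y, slice i.+1 y & ~ closure (slice i) y.
Proof.
pose b := (vbasis S0)`_i.
have bS : b \in S0 by apply: mem_vbasis.
pose l c : pairT R p q := one2 + c *: b.
have pl x y : upoly (fun c => (blk (l c) *m Phi0) x y) by apply: upoly_line_blk.
have pD : upoly (fun c => \det (blk (l c))) by apply: upoly_det_line_blk.
have pL : upoly (fun c => \det (Lp (blk (l c) *m Phi0))).
  apply: (fa_det upoly_funalg) => x y.
  exact: (mpolyf_comp upoly_funalg (mpolyf_Lp x y) pl).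
have l0 : l 0 = one2 by rewrite /l scale0r addr0.
have D0 : \det (blk (l 0)) != 0 by rewrite l0 blk1 det1 oner_neq0.
have L0 : \det (Lp (blk (l 0) *m Phi0)) != 0.
  by rewrite l0 blk1 mul1mx Lp1 det1 oner_neq0.
(* Three conditions are met at once: c is nonzero, 1 + c b is invertible, and [Lp] is invertible,
   the last so that [Num i] does not vanish. *)
have [c1 [c1n D1]] := upoly_witness (upolyX _) pD (oner_neq0 _ : id 1 != 0 :> C) D0.
have [c [Lc]] := upoly_witness pL (fa_mul upoly_funalg (upolyX _) pD) L0 (mulf_neq0 c1n D1).
rewrite mulf_eq0 negb_or => /andP[cn].
rewrite -unitfE -unitmxE blk_unit => /andP Ul.
have cE (j : 'I_d) : coord (vbasis S0) j b = (i == j)%:R.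
  by rewrite coord_vbasis_nth eq_sym.
have [y _ Py] := is_frame_act P0 Ul; exists y.
  exists (c *: b); split=> // [|j ij]; first exact: rpredZ.
  rewrite linearZ /= cE; case: eqP => [e|_]; last by rewrite mulr0.
  by rewrite e ltnn in ij.
move/(closureP _ Py)/(_ _ (mpolyf_Num i)) => H.
have Ey : (blk (l c) *m Phi0) *m bd one3 = blk (one2 + c *: b) *m Phi0.
  by rewrite bd_one mulmx1.
have : Num i (blk (l c) *m Phi0) = 0.
  apply: H => z Psi [s [sS Us s0 Pz]] Qz.
  have [t [tG Ut ->]] := is_frame_bd_trans Pz Qz.
  have [u [uG Uu tu _]] := bdV_in tG Ut.
  have E : (blk (one2 + s) *m Phi0 *m bd t) *m bd u = blk (one2 + s) *m Phi0.
    by rewrite -[LHS]mulmxA tu mulmx1.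
  by rewrite (NumE i sS uG E) s0 // mulr0.
rewrite (NumE i (rpredZ c bS) (one3_in R p q r) Ey) linearZ /= cE eqxx mulr1 => /eqP.
by rewrite mulf_eq0 (negbTE Lc) (negbTE cn).
Qed.

Theorem krull_lower : exists Z, irreducible_chain (Korbit x0) d Z.
Proof.
(* The slices need not be closed in the orbit. Their closures remain irreducible, and the inclusions
   stay strict because [slice_step] concerns the closure. *)
exists (fun i => Korbit x0 `&` closure (slice i)).
have sub i : slice i `<=` Korbit x0 `&` closure (slice i).
  by move=> y sy; split; [apply: slice_sub sy|apply: subset_closure].
split=> i im; first split; last first.
- have [y y1 y2] := slice_step (Ordinal im); split.
    by move=> z [Oz cz]; split=> //; apply: closureS cz; apply: sliceS.
  by move=> /(_ y (sub _ y y1))[_].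
- by exists (closure (slice i)); first exact: closed_closure.
- split; last first.
    move=> Z1 Z2 c1 c2 ZZ.
    have clo Z : closed Z -> slice i `<=` Z -> Korbit x0 `&` closure (slice i) `<=` Z.
      by move=> cZ sZ y [_ cy]; apply: cZ; apply: closureS cy.
    have [s1|s2] := slice_irr c1 c2 (subset_trans (sub i) ZZ).
      by left; apply: clo.
    by right; apply: clo.
  exists x0; apply: sub; exists 0; rewrite addr0; split.
  + exact: mem0v.
  + exact: gunit1.
  + by move=> j _; rewrite linear0.
  + by rewrite blk1 mul1mx.
Qed.

Theorem krull_dim_orbit : has_krull_dim (Korbit x0) d.
Proof. by split; [apply: krull_lower|move=> m Z; apply: krull_upper]. Qed.

Lemma dim_slice_space : d = (p ^ 2 + q ^ 2 - \dim Aend)%N.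
Proof. by rewrite /S0 dimv_compl dimvf. Qed.

End KrullLowerBound.

(** * Reindexing sums over the graph by columns *)

Lemma big_image_pred (I J : finType) (S : pred J) (Q : pred I) (phi : J -> I) (F : I -> nat) :
  {in S &, injective phi} -> (forall i, Q i = [exists c, S c && (phi c == i)]) ->
  (\sum_(i | Q i) F i = \sum_(c | S c) F (phi c))%N.
Proof.
move=> inj QE; rewrite -(big_imset F inj); apply: eq_bigl => i; rewrite QE.
apply/existsP/imsetP => [[c /andP[Sc /eqP <-]]|[c Sc ->]]; first by exists c.
by exists c; rewrite eqxx andbT.
Qed.

Section CodedColumns.
Variables (n r : nat) (n0 : (0 < n)%N) (f : 'I_r -> nat).

(** The row of column c, numbered from 0. If the column has no entry, the value is meaningless, so
    each use is guarded by [0 < f c]. *)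
Definition coded c : 'I_n := insubd (Ordinal n0) (f c).-1.

Hypothesis f_le : forall c, (f c <= n)%N.
Hypothesis f_inj : forall c c', (0 < f c)%N -> f c = f c' -> c = c'.

Lemma codedE c : (0 < f c)%N -> f c = (coded c).+1.
Proof.
move=> c0; have cn : ((f c).-1 < n)%N by rewrite prednK.
by rewrite /coded val_insubd cn prednK.
Qed.

Lemma coded_eq c i : (0 < f c)%N && (coded c == i) = (i.+1 == f c).
Proof.
case: posnP => [-> //|c0 /=]; apply/eqP/eqP => [<-|e]; first by rewrite -codedE.
by apply/val_inj/succn_inj; rewrite -codedE // -e.
Qed.

Lemma coded_inj : {in [pred c | (0 < f c)%N] &, injective coded}.
Proof. by move=> c d c0 d0 e; apply: (f_inj c0); rewrite (codedE c0) (codedE d0) e. Qed.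

(** With [g] the code of the other block: the occupied vertices of a row of the graph are its marked
    points and its ends of edges. *)
Lemma coded_sum (g : 'I_r -> nat) F :
  (\sum_(i : 'I_n | [exists c, f c == i.+1]) F i =
   \sum_(i : 'I_n | [exists c, (f c == i.+1) && (g c == 0%N)]) F i +
   \sum_(c | (0 < f c)%N && (0 < g c)%N) F (coded c))%N.
Proof.
rewrite (@big_image_pred _ _ (fun c => 0 < f c)%N _ coded); last 2 first.
- exact: coded_inj.
- by move=> i; apply: eq_existsb => c; rewrite coded_eq eq_sym.
rewrite (bigID (fun c => g c == 0%N)) /=; congr addn; last first.
  by apply: eq_bigl => c; rewrite -lt0n.
apply/esym/big_image_pred => [c d /andP[c0 _] /andP[d0 _]|i]; first exact: coded_inj.
by apply: eq_existsb => c; rewrite andbAC coded_eq eq_sym.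
Qed.

End CodedColumns.

(** * A basis of the endomorphism algebra *)

Section EndomorphismDimension.
Variables (R : realType) (p q r : nat) (hp : (0 < p)%N) (hq : (0 < q)%N).
Local Notation C := (R[i])%C.
Variables (P : config r) (vP : valid p q P).
Local Notation om := (cmx p q C P).
Local Notation Aend := (Aend om).

Definition occ1 (i : 'I_p) : bool := [exists c, (P c).1 == i.+1].
Definition occ2 (j : 'I_q) : bool := [exists c, (P c).2 == j.+1].
Definition mark1 (i : 'I_p) : bool := [exists c, ((P c).1 == i.+1) && ((P c).2 == 0%N)].
Definition mark2 (j : 'I_q) : bool := [exists c, ((P c).2 == j.+1) && ((P c).1 == 0%N)].
Definition isedge (c : 'I_r) : bool := (0 < (P c).1)%N && (0 < (P c).2)%N.
Local Notation px := (coded hp (fun c => (P c).1)).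
Local Notation py := (coded hq (fun c => (P c).2)).

Lemma pxE c : (0 < (P c).1)%N -> (P c).1 = (px c).+1.
Proof. exact: (codedE hp (valid_le1 vP)). Qed.

Lemma pyE c : (0 < (P c).2)%N -> (P c).2 = (py c).+1.
Proof. exact: (codedE hq (valid_le2 vP)). Qed.

Lemma mul_ebasis m (A : 'M[C]_m) k (i : 'I_m) : (A *m ebasis R m i.+1) k 0 = A k i.
Proof. by rewrite ebasisS -colE mxE. Qed.

Lemma blk_cmx_col s c : col c (blk s *m om) =
  col_mx (s.1 *m ebasis R p (P c).1) (s.2 *m ebasis R q (P c).2).
Proof. by rewrite col_mulmx cmxE col_colmx mul_block_col !mul0mx addr0 add0r. Qed.

Lemma blk_cmx_plus s k c : (blk s *m om) (lshift q k) c = (s.1 *m ebasis R p (P c).1) k 0.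
Proof. by have /colP/(_ (lshift q k)) := blk_cmx_col s c; rewrite mxE col_mxEu. Qed.

Lemma blk_cmx_minus s k c : (blk s *m om) (rshift p k) c = (s.2 *m ebasis R q (P c).2) k 0.
Proof. by have /colP/(_ (rshift p k)) := blk_cmx_col s c; rewrite mxE col_mxEd. Qed.

Lemma Aend_elim s : s \in Aend -> [/\ upper s.1, upper s.2 & exists z, blk s *m om = om *m z].
Proof.
case/mem_Aend => t /mem_Gvs[u1 u2]; rewrite /wframe blk_mkframe mkframe_bdiag.
rewrite !mulmx1 !mul1mx => /mkframe_inj[-> -> E]; split=> //; by exists t.2.
Qed.

Lemma Aend_intro s z : upper s.1 -> upper s.2 -> blk s *m om = om *m z -> s \in Aend.
Proof.
move=> u1 u2 E; apply/mem_Aend; exists (s.1, s.2, z); first exact/mem_Gvs.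
by rewrite /wframe blk_mkframe mkframe_bdiag /= !mulmx1 !mul1mx E.
Qed.

Definition bindex := ('I_p * 'I_p + 'I_q * 'I_q + 'I_r * 'I_r)%type.

(** Index set of a basis of [Aend]. An entry (k, i) of a triangular block is arbitrary if i is a
    free point, or if k is marked, the marked basis vector being in the subspace. An entry between
    ends of edges forces the same entry on the other side, hence one index for a pair of edges. *)
Definition bpred (b : bindex) : bool :=
  match b with
  | inl (inl (k, i)) => (k <= i)%N && (~~ occ1 i || mark1 k)
  | inl (inr (k, i)) => (k <= i)%N && (~~ occ2 i || mark2 k)
  | inr (c', c) => [&& isedge c', isedge c, (P c').1 <= (P c).1 & (P c').2 <= (P c).2]%N
  end.

Definition bcoord (b : bindex) (s : pairT R p q) : C :=
  match b with
  | inl (inl (k, i)) => s.1 k i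
  | inl (inr (k, i)) => s.2 k i
  | inr (c', c) => s.1 (px c') (px c)
  end.

Definition bvec (b : bindex) : pairT R p q :=
  match b with
  | inl (inl (k, i)) => (delta_mx k i, 0)
  | inl (inr (k, i)) => (0, delta_mx k i)
  | inr (c', c) => (delta_mx (px c') (px c), delta_mx (py c') (py c))
  end.

Lemma bcoord_linear b : linear (bcoord b : _ -> C^o).
Proof. by case: b => [[[k i]|[k i]]|[c' c]] a s t /=; rewrite !mxE. Qed.

(** If k is the end of an edge, its row and the row of the other end read the same coefficient of z.
    An entry without index therefore vanishes, because k is free, or because the matching entry lies
    below the diagonal or is absent; otherwise it is the coordinate of a pair of edges. *)
Lemma Aend_bcoord_inj s : s \in Aend -> (forall b, bpred b -> bcoord b s = 0) -> s = 0.
Proof.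
case/Aend_elim => u1 u2 [z E] b0.
have free1 (k : 'I_p) c : ~~ occ1 k -> (om *m z) (lshift q k) c = 0.
  move=> fk; rewrite /cmx mul_col_mx col_mxEu mxE big1 // => c' _; rewrite mxE.
  case: eqP => [e|_]; last by rewrite mul0r.
  by case/negP: fk; apply/existsP; exists c'; rewrite -e.
have free2 (k : 'I_q) c : ~~ occ2 k -> (om *m z) (rshift p k) c = 0.
  move=> fk; rewrite /cmx mul_col_mx col_mxEd mxE big1 // => c' _; rewrite mxE.
  case: eqP => [e|_]; last by rewrite mul0r.
  by case/negP: fk; apply/existsP; exists c'; rewrite -e.
have s1 : s.1 = 0.
  apply/matrixP => k i; rewrite [RHS]mxE; have [ik|ki] := ltnP i k; first exact: u1.
  have [Bki|] := boolP (bpred (inl (inl (k, i)))); first exact: (b0 _ Bki).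
  rewrite /= ki negb_or negbK /= => /andP[/existsP[c /eqP xc] nmk].
  have XE : (blk s *m om) (lshift q k) c = s.1 k i by rewrite blk_cmx_plus xc mul_ebasis.
  have [/existsP[c' /eqP xc']|fk] := boolP (occ1 k); last by rewrite -XE E free1.
  have yc'0 : (0 < (P c').2)%N.
    rewrite lt0n; apply: contra nmk => yc'; apply/existsP; exists c'.
    by rewrite xc' eqxx.
  have YE := cmx_mul_minus z c vP (pyE yc'0).
  have XZ := cmx_mul_plus z c vP xc'.
  rewrite -XE E XZ -YE -E blk_cmx_minus; case: (posnP (P c).2) => [y0|yc0].
    by rewrite y0 ebasis0 mulmx0 mxE.
  rewrite {1}(pyE yc0) mul_ebasis.
  have [yy|yy] := leqP (P c').2 (P c).2; last first.
    by apply: u2; move: yy; rewrite (pyE yc0) (pyE yc'0).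
  have x0 : (0 < (P c).1)%N by rewrite xc.
  have x0' : (0 < (P c').1)%N by rewrite xc'.
  have Bcc : bpred (inr (c', c)).
    by rewrite /= /isedge x0 x0' yc0 yc'0 yy xc xc' ltnS ki.
  have ei : px c = i by apply: val_inj; have := pxE x0; rewrite xc => -[].
  have ek : px c' = k by apply: val_inj; have := pxE x0'; rewrite xc' => -[].
  have := b0 _ Bcc; rewrite /= ei ek -XE E XZ -YE -E.
  by rewrite blk_cmx_minus {1}(pyE yc0) mul_ebasis.
have s2 : s.2 = 0.
  apply/matrixP => k i; rewrite [RHS]mxE; have [ik|ki] := ltnP i k; first exact: u2.
  have [Bki|] := boolP (bpred (inl (inr (k, i)))); first exact: (b0 _ Bki).
  rewrite /= ki negb_or negbK /= => /andP[/existsP[c /eqP xc] nmk].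
  have XE : (blk s *m om) (rshift p k) c = s.2 k i by rewrite blk_cmx_minus xc mul_ebasis.
  have [/existsP[c' /eqP xc']|fk] := boolP (occ2 k); last by rewrite -XE E free2.
  have yc'0 : (0 < (P c').1)%N.
    rewrite lt0n; apply: contra nmk => yc'; apply/existsP; exists c'.
    by rewrite xc' eqxx.
  have YE := cmx_mul_plus z c vP (pxE yc'0).
  have XZ := cmx_mul_minus z c vP xc'.
  by rewrite -XE E XZ -YE -E blk_cmx_plus s1 mul0mx mxE.
by case: s s1 s2 {u1 u2 E b0} => a b /= -> ->.
Qed.

(** Entries attached to pairs of edges have an occupied second index and an unmarked first one, so
    they never meet the entries indexed directly. *)
Lemma bvec_dual b b' : bpred b -> bpred b' -> bcoord b (bvec b') = (b == b')%:R.
Proof.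
have px_inj c d : isedge c -> px c = px d -> isedge d -> c = d.
  by move=> /andP[c0 _] e /andP[d0 _]; apply: (coded_inj (valid_le1 vP) (valid_inj1 vP)) e.
have edge_occ c : isedge c -> occ1 (px c).
  by case/andP=> c0 _; apply/existsP; exists c; rewrite -pxE.
have edge_nmark c : isedge c -> ~~ mark1 (px c).
  case/andP=> x0 y0; apply/negP => /existsP[d /andP[/eqP xd /eqP yd]].
  have e : c = d by apply: (valid_inj1 vP x0); rewrite xd -pxE.
  by rewrite e yd in y0.
have edge_occ2 c : isedge c -> occ2 (py c).
  by case/andP=> _ c0; apply/existsP; exists c; rewrite -pyE.
have edge_nmark2 c : isedge c -> ~~ mark2 (py c).
  case/andP=> x0 y0; apply/negP => /existsP[d /andP[/eqP xd /eqP yd]].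
  have e : c = d by apply: (valid_inj2 vP y0); rewrite xd -pyE.
  by rewrite e yd in x0.
case: b => [[[k i]|[k i]]|[c d]]; case: b' => [[[k' i']|[k' i']]|[c' d']] B B' /=;
  rewrite ?mxE //.
- case/andP: B => _; case/and4P: B' => e1 e2 _ _.
  case: eqP => // ->; case: eqP => // ->.
  by rewrite edge_occ // (negbTE (edge_nmark _ e1)).
- case/andP: B => _; case/and4P: B' => e1 e2 _ _.
  case: eqP => // ->; case: eqP => // ->.
  by rewrite edge_occ2 // (negbTE (edge_nmark2 _ e1)).
- case/andP: B' => _; case/and4P: B => e1 e2 _ _.
  case: eqP => // <-; case: eqP => // <-.
  by rewrite edge_occ // (negbTE (edge_nmark _ e1)).
- case/and4P: B' => e1' e2' _ _; case/and4P: B => e1 e2 _ _.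
  have e x y : isedge x -> isedge y -> (px x == px y) = (x == y).
    by move=> ex ey; apply/eqP/eqP => [/px_inj -> //|-> //].
  by rewrite !e.
Qed.

Lemma bvec_in b : bpred b -> bvec b \in Aend.
Proof.
have row1 (i : 'I_p) c : (P c).1 = i.+1 ->
    row i (\matrix_(i < p, c < r) (i.+1 == (P c).1)%:R : 'M[C]_(p, r)) = delta_mx 0 c.
  move=> xc; apply/rowP => c'; rewrite !mxE eqxx /=; congr (nat_of_bool _)%:R.
  have [cc|cc] := (c' =P c); first by rewrite cc xc eqxx.
  apply: negbTE; apply/eqP => e; apply: cc; apply: (valid_inj1 vP); first by rewrite -e.
  by rewrite xc.
have row2 (i : 'I_q) c : (P c).2 = i.+1 ->
    row i (\matrix_(i < q, c < r) (i.+1 == (P c).2)%:R : 'M[C]_(q, r)) = delta_mx 0 c.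
  move=> xc; apply/rowP => c'; rewrite !mxE eqxx /=; congr (nat_of_bool _)%:R.
  have [cc|cc] := (c' =P c); first by rewrite cc xc eqxx.
  apply: negbTE; apply/eqP => e; apply: cc; apply: (valid_inj2 vP); first by rewrite -e.
  by rewrite xc.
have free1 (i : 'I_p) : ~~ occ1 i ->
    row i (\matrix_(i < p, c < r) (i.+1 == (P c).1)%:R : 'M[C]_(p, r)) = 0.
  move=> fi; apply/rowP => c; rewrite !mxE; case: eqP => // e.
  by case/negP: fi; apply/existsP; exists c; rewrite -e.
have free2 (i : 'I_q) : ~~ occ2 i ->
    row i (\matrix_(i < q, c < r) (i.+1 == (P c).2)%:R : 'M[C]_(q, r)) = 0.
  move=> fi; apply/rowP => c; rewrite !mxE; case: eqP => // e.
  by case/negP: fi; apply/existsP; exists c; rewrite -e.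
have dE m n (k i : 'I_m) (X : 'M[C]_(m, n)) : delta_mx k i *m X = delta_mx k 0 *m row i X.
  by rewrite rowE mulmxA mul_delta_mx.
have colE0 (c : 'I_r) : om *m delta_mx c (0 : 'I_1) = ecol R p q (P c).
  by rewrite -colE cmxE col_colmx.
have up_delta m (k i : 'I_m) : (k <= i)%N -> upper (delta_mx k i : 'M[C]_m).
  move=> ki x y ba; rewrite mxE; case: eqP => // ak; case: eqP => // bi.
  by move: ba; rewrite ak bi ltnNge ki.
have up0 m : upper (0 : 'M[C]_m) by move=> x y _; rewrite mxE.
case: b => [[[k i]|[k i]]|[c' c]].
- case/andP=> ki /orP[fi|/existsP[c /andP[/eqP xc /eqP yc]]].
    apply: (Aend_intro (z := 0)) => //=; first exact: up_delta.
    by rewrite mulmx0 /blk /cmx mul_block_col !mul0mx !addr0 dE free1 // mulmx0 col_mx0.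
  (* The image is spanned by the marked basis vector, which is column c of omega, so the action on
     the subspace only involves row c of z. *)
  apply: (Aend_intro (z := delta_mx c 0 *m
    row i (\matrix_(i < p, c < r) (i.+1 == (P c).1)%:R : 'M[C]_(p, r)))) => //=.
    exact: up_delta.
  rewrite mulmxA colE0 /ecol xc yc ebasisS ebasis0 [RHS]mul_col_mx mul0mx.
  by rewrite /blk /cmx mul_block_col !mul0mx !addr0 dE.
- case/andP=> ki /orP[fi|/existsP[c /andP[/eqP xc /eqP yc]]].
    apply: (Aend_intro (z := 0)) => //=; first exact: up_delta.
    by rewrite mulmx0 /blk /cmx mul_block_col !mul0mx !add0r dE free2 // mulmx0 col_mx0.
  apply: (Aend_intro (z := delta_mx c 0 *m
    row i (\matrix_(i < q, c < r) (i.+1 == (P c).2)%:R : 'M[C]_(q, r)))) => //=.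
    exact: up_delta.
  rewrite mulmxA colE0 /ecol xc yc ebasisS ebasis0 [RHS]mul_col_mx mul0mx.
  by rewrite /blk /cmx mul_block_col !mul0mx !add0r dE.
- case/and4P=> /andP[x0' y0'] /andP[x0 y0] xx yy.
  apply: (Aend_intro (z := delta_mx c' (0 : 'I_1) *m delta_mx 0 c)) => /=.
  + by apply: up_delta; move: xx; rewrite (pxE x0) (pxE x0').
  + by apply: up_delta; move: yy; rewrite (pyE y0) (pyE y0').
  rewrite mulmxA colE0 /ecol (pxE x0') (pyE y0') !ebasisS [RHS]mul_col_mx.
  rewrite /blk /cmx mul_block_col !mul0mx addr0 add0r.
  by rewrite dE (row1 _ c) -?pxE // [X in col_mx _ X]dE (row2 _ c) -?pyE.
Qed.

Theorem dim_Aend : \dim Aend = #|bpred|.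
Proof.
pose B := {b : bindex | bpred b}.
pose W : vectType C := {ffun B -> C^o}.
have dW : \dim {:W} = #|bpred|.
  by rewrite dimvf /dim /= muln1 card_sig; apply: eq_card => b; rewrite !inE.
apply/eqP; rewrite eqn_leq -dW; apply/andP; split.
  apply: (@dim_le_inj _ _ _ (fun s => [ffun b : B => bcoord (val b) s : C^o] : W)).
  - move=> a s t; apply/ffunP => b; rewrite !ffunE; exact: bcoord_linear.
  - by move=> s _; apply: memvf.
  - move=> s sA s0; apply: Aend_bcoord_inj => // b Bb.
    by have /ffunP/(_ (exist _ b Bb)) := s0; rewrite !ffunE.
apply: (@dim_le_inj _ _ _ (fun w : W => \sum_b w b *: bvec (val b) : pairT R p q)).
- move=> a v w; rewrite scaler_sumr -big_split; apply: eq_bigr => b _ /=.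
  by rewrite !ffunE scalerDl scalerA.
- by move=> w _; apply: rpred_sum => b _; apply/rpredZ/bvec_in/(valP b).
- move=> w _ w0; apply/ffunP => b; rewrite [RHS]ffunE.
  pose l := HB.pack (bcoord (val b) : _ -> C^o)
    (GRing.isLinear.Build C _ _ _ (bcoord (val b) : _ -> C^o) (bcoord_linear (val b))) :
    {linear pairT R p q -> C^o}.
  have lB (b' : B) : l (bvec (val b')) = (val b == val b')%:R :> C^o.
    exact: bvec_dual (valP b) (valP b').
  have -> : w b = l (\sum_b w b *: bvec (val b)); last by rewrite w0 linear0.
  rewrite linear_sum (bigD1 b isT) [X in _ = _ + X]big1 => [|b' /andP[_ b'b]].
    by rewrite addr0 linearZ lB eqxx; apply/esym/mulr1.
  by rewrite linearZ lB (inj_eq val_inj) eq_sym (negbTE b'b); apply: mulr0.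
Qed.

End EndomorphismDimension.

(** * The dimension formula *)

Section OrbitDimension.
Variables (R : realType) (p q r : nat) (hp : (0 < p)%N) (hq : (0 < q)%N).
Local Notation C := (R[i])%C.
Variables (w : param R p q r) (P : config r) (vP : valid p q P) (wE : val w = cmx p q C P).
Local Notation px := (coded hp (fun c => (P c).1)).
Local Notation py := (coded hq (fun c => (P c).2)).

Lemma natr_eq0b (b : bool) : (b%:R == 0 :> C) = ~~ b.
Proof. by case: b; rewrite ?eqxx // oner_eq0. Qed.

Lemma tau1_cmx i c : tau1 w i c = (i.+1 == (P c).1)%:R.
Proof. by rewrite /tau1 wE /cmx col_mxKu mxE. Qed.

Lemma tau2_cmx j c : tau2 w j c = (j.+1 == (P c).2)%:R.
Proof. by rewrite /tau2 wE /cmx col_mxKd mxE. Qed.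

Lemma col1_eq0 c : [forall i, tau1 w i c == 0] = ((P c).1 == 0%N).
Proof.
apply/forallP/eqP => [c0|c0 i]; last by rewrite tau1_cmx natr_eq0b c0.
apply/eqP; rewrite -[_ == _]negbK -lt0n; apply/negP => cgt0.
by have := c0 (px c); rewrite tau1_cmx natr_eq0b -(codedE hp (valid_le1 vP) cgt0) eqxx.
Qed.

Lemma col2_eq0 c : [forall j, tau2 w j c == 0] = ((P c).2 == 0%N).
Proof.
apply/forallP/eqP => [c0|c0 i]; last by rewrite tau2_cmx natr_eq0b c0.
apply/eqP; rewrite -[_ == _]negbK -lt0n; apply/negP => cgt0.
by have := c0 (py c); rewrite tau2_cmx natr_eq0b -(codedE hq (valid_le2 vP) cgt0) eqxx.
Qed.

Lemma marked_plusE i : marked_plus w i = mark1 P i.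
Proof. by apply: eq_existsb => c; rewrite tau1_cmx natr_eq1 col2_eq0 eq_sym. Qed.

Lemma marked_minusE j : marked_minus w j = mark2 P j.
Proof. by apply: eq_existsb => c; rewrite tau2_cmx natr_eq1 col1_eq0 eq_sym. Qed.

Lemma edgeE e : edge w e = [exists c, isedge P c && ((px c, py c) == e)].
Proof.
case: e => i j; apply: eq_existsb => c.
rewrite tau1_cmx tau2_cmx !natr_eq1 /= -(coded_eq hp (valid_le1 vP)).
rewrite -(coded_eq hq (valid_le2 vP)) /isedge xpair_eqE.
by rewrite andbACA.
Qed.

Lemma free_plusE i : free_plus w i = ~~ occ1 P i.
Proof.
rewrite /free_plus -[X in _ && X]negbK negb_forall -negb_or marked_plusE; congr (~~ _).
apply/orP/existsP => [[/existsP[c /andP[ci _]]|/existsP[j]]|[c ci]].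
- by exists c.
- rewrite negbK => /existsP[c /andP[]]; rewrite tau1_cmx natr_eq1 eq_sym => ci _.
  by exists c.
- case: (posnP (P c).2) => [y0|y0]; [left|right].
    by apply/existsP; exists c; rewrite ci y0.
  apply/existsP; exists (py c); rewrite negbK; apply/existsP; exists c.
  by rewrite tau1_cmx tau2_cmx !natr_eq1 eq_sym ci -(codedE hq (valid_le2 vP)) /=.
Qed.

Lemma free_minusE j : free_minus w j = ~~ occ2 P j.
Proof.
rewrite /free_minus -[X in _ && X]negbK negb_forall -negb_or marked_minusE; congr (~~ _).
apply/orP/existsP => [[/existsP[c /andP[ci _]]|/existsP[k]]|[c ci]].
- by exists c.
- rewrite negbK => /existsP[c /andP[_]]; rewrite tau2_cmx natr_eq1 eq_sym => ci.
  by exists c.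
- case: (posnP (P c).1) => [x0|x0]; [left|right].
    by apply/existsP; exists c; rewrite ci x0.
  apply/existsP; exists (px c); rewrite negbK; apply/existsP; exists c.
  by rewrite tau1_cmx tau2_cmx !natr_eq1 andbC eq_sym ci -(codedE hp (valid_le1 vP)) /=.
Qed.

Lemma edge_sum F : (\sum_(e | edge w e) F e = \sum_(c | isedge P c) F (px c, py c))%N.
Proof.
apply: big_image_pred edgeE => c d /andP[c0 _] /andP[d0 _] [e _].
exact: (coded_inj (valid_le1 vP) (valid_inj1 vP)).
Qed.

Lemma card_ord_le n (i : 'I_n) : #|[pred k : 'I_n | (k <= i)%N]| = i.+1.
Proof.
rewrite cardE size_filter -enumT -(count_map val (fun k => (k <= i)%N)) val_enum_ord.
by rewrite -size_filter (filter_iota_leq 0 (ltn_ord i)) size_iota.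
Qed.

Lemma sum_left_columns n (occ mark : pred 'I_n) :
  (\sum_(u : 'I_n * 'I_n) ((u.1 <= u.2) && (~~ occ u.2 || mark u.1)) =
   \sum_(i | ~~ occ i) i.+1 + \sum_(i | occ i) #|[pred k : 'I_n | mark k & (k <= i)%N]|)%N.
Proof.
rewrite -(pair_bigA _ (fun k i : 'I_n => ((k <= i) && (~~ occ i || mark k) : nat)%N)) /=.
rewrite exchange_big (bigID occ) /= addnC; congr addn; apply: eq_bigr => i oi.
  rewrite -card_ord_le -sum1_card [RHS]big_mkcond; apply: eq_bigr => k _.
  by rewrite oi andbT inE; case: leqP.
rewrite -sum1_card [RHS]big_mkcond; apply: eq_bigr => k _.
by rewrite oi inE andbC /=; case: (mark k); case: leqP.
Qed.

(** The basis is grouped by second index: a free point contributes its number, a marked point or an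
    end of an edge the marked points on its left in the same row, and an edge also the edges on its
    left. Collecting both ends of each edge gives the three sums. *)
Lemma card_bpred :
  (#|(@bpred p q r P : pred (bindex p q r))| =
    (\sum_(i | free_plus w i) i.+1 + \sum_(j | free_minus w j) j.+1)
    + (\sum_(i | marked_plus w i) marked_plus_left w i
       + \sum_(j | marked_minus w j) marked_minus_left w j)
    + \sum_(e | edge w e)
        (marked_plus_left w e.1 + marked_minus_left w e.2 + edges_left w e))%N.
Proof.
rewrite (eq_bigl _ _ free_plusE) (eq_bigl _ _ free_minusE).
rewrite (eq_bigl _ _ marked_plusE) (eq_bigl _ _ marked_minusE) edge_sum /= !big_split /=.
have -> : (\sum_(c | isedge P c) edges_left w (px c, py c) =
    \sum_(u : 'I_r * 'I_r) bpred (p := p) (q := q) P (inr u))%N.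
  rewrite [RHS](eq_bigr (fun u : 'I_r * 'I_r =>
    (bpred (p := p) (q := q) P (inr (u.1, u.2)) : nat)%N)); last by case.
  rewrite -(pair_bigA _ (fun c' c => (bpred (p := p) (q := q) P (inr (c', c)) : nat)%N)) /=.
  rewrite exchange_big big_mkcond; apply: eq_bigr => c _ /=.
  case: ifP => [ec|ec]; last by rewrite big1 // => c' _; rewrite andbF.
  rewrite /edges_left -sum1_card.
  under eq_bigl => e do rewrite inE.
  rewrite big_mkcondr edge_sum /= big_mkcond; apply: eq_bigr => c' _.
  case: ifP => ec' //.
  have /andP[x0 y0] := ec; have /andP[x0' y0'] := ec'.
  have xE := codedE hp (valid_le1 vP); have yE := codedE hq (valid_le2 vP).
  by rewrite (xE _ x0) (xE _ x0') (yE _ y0) (yE _ y0') !ltnS; case: ifP.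
have left_plus i : marked_plus_left w i = #|[pred k : 'I_p | mark1 P k & (k <= i)%N]|.
  by apply: eq_card => k; rewrite !inE marked_plusE.
have left_minus i : marked_minus_left w i = #|[pred k : 'I_q | mark2 P k & (k <= i)%N]|.
  by apply: eq_card => k; rewrite !inE marked_minusE.
have plus_sum := coded_sum hp (valid_le1 vP) (valid_inj1 vP) (fun c => (P c).2).
have minus_sum F : (\sum_(j | occ2 P j) F j =
    \sum_(j | mark2 P j) F j + \sum_(c | isedge P c) F (py c))%N.
  rewrite (coded_sum hq (valid_le2 vP) (valid_inj2 vP) (fun c => (P c).1)); congr addn.
  by apply: eq_bigl => c; rewrite andbC.
have plusE := sum_left_columns (@occ1 p r P) (mark1 P).
have minusE := sum_left_columns (@occ2 q r P) (mark2 P).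
have sumE : #|(@bpred p q r P : pred (bindex p q r))| = (\sum_b @bpred p q r P b)%N.
  by rewrite -sum1_card big_mkcond; apply: eq_bigr => b _; rewrite unfold_in.
rewrite sumE !big_sumType /=.
rewrite (eq_bigr (fun u : 'I_p * 'I_p =>
  ((u.1 <= u.2) && (~~ occ1 P u.2 || mark1 P u.1) : nat)%N)); last by case.
rewrite [X in (_ + X + _)%N](eq_bigr (fun u : 'I_q * 'I_q =>
  ((u.1 <= u.2) && (~~ occ2 P u.2 || mark2 P u.1) : nat)%N)); last by case.
rewrite plusE minusE plus_sum minus_sum.
rewrite !(eq_bigr _ (fun i _ => left_plus i)) !(eq_bigr _ (fun i _ => left_minus i)).
rewrite !(eq_bigr _ (fun c _ => left_plus (px c))) !(eq_bigr _ (fun c _ => left_minus (py c))).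
have addnACA7 a b c d e f g :
    (a + (b + c) + (d + (e + f)) + g = a + d + (b + e) + (c + f + g))%N by lia.
exact: addnACA7.
Qed.

End OrbitDimension.

Theorem theorem9p4 (R : realType) (p q r : nat)
    (hp : (0 < p)%N) (hq : (0 < q)%N) (hr : (0 < r)%N) (hrn : (r <= p + q)%N) :
  [/\ set_bij [set: param_bar R p q r]
        (range (fun x : flagGr R p q r => Korbit x)) (@orbit_bar R p q r),

      forall w : param R p q r,
        exists2 d : nat, has_krull_dim (Korbit (param_point w)) d &
          d%:Z = (p ^ 2 + q ^ 2)%N%:Z
            - (\sum_(i | free_plus w i) i.+1 + \sum_(j | free_minus w j) j.+1)%N%:Z
            - (\sum_(i | marked_plus w i) marked_plus_left w i
               + \sum_(j | marked_minus w j) marked_minus_left w j)%N%:Z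
            - (\sum_(e | edge w e) (marked_plus_left w e.1
                 + marked_minus_left w e.2 + edges_left w e))%N%:Z

    & forall w w' : param R p q r,
        Korbit (param_point w) `<=` closure (Korbit (param_point w')) <->
        forall X : objJ hp hq (R[i])%C, indecomposableJ X ->
          (\dim (rep_hom X (point_obj hp hq (param_point w')))
             <= \dim (rep_hom X (point_obj hp hq (param_point w))))%N].
Proof.
split; [exact: orbit_bar_bij| |exact: closure_hom_order].
move=> w; have [P vP wE] := param_config w.
exists (\dim (S0 (cmx p q (R[i])%C P))).
  exact: (krull_dim_orbit (cmx_rank _ vP) (param_point_cmx wE)).
have dimA : \dim (Aend (cmx p q (R[i])%C P)) = _ :=
  etrans (dim_Aend R hp hq vP) (card_bpred hp hq vP wE).
(* Makes the truncated subtraction in [dim_slice_space] exact, so that it passes to the integers. *)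
have le_dim : (\dim (Aend (cmx p q (R[i])%C P)) <= p ^ 2 + q ^ 2)%N.
  by apply: leq_trans (dimvS (subvf _)) _; rewrite dimvf.
have subzE (N a b c d : nat) : d = (a + b + c)%N -> (d <= N)%N ->
  (N - d)%N%:Z = N%:Z - a%:Z - b%:Z - c%:Z by lia.
rewrite dim_slice_space; exact: subzE dimA le_dim.
Qed.
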